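(* Let $(D,\mathbf r)$ be a regular harmonic structure on a post critically finite (p.c.f.) self-similar structure $(K,\mathcal S,\{F_i:i\in\mathcal S\})$ with $\mathcal S=\{1,\dots,N\}$, and let $\mu$ be a self-similar Borel measure on $K$ with weights $(\mu_1,\dots,\mu_N)$ such that $r_i\mu_i<1$ for all $i\in\mathcal S$. Let $d_S$ be the spectral exponent of $(\mathcal E,\mathcal F,\mu)$. Let $\partial:\mathcal F\to\mathcal H$ be the associated derivation, $P$ the orthogonal projection of $\mathcal H$ onto $\overline{\mathrm{Im}\,\partial}$, $F:=P-P^\perp$ with $P^\perp=I-P$, and let $\tau_\omega$ be a Dixmier trace. Then the $d_S$-energy functional $\Phi^{d_S}_\omega(a):=\tau_\omega\bigl(|[F,a]|^{d_S}\bigr)$ is a self-similar conformal invariant, i.e. $$\Phi^{d_S}_\omega(a)=\sum_{i=1}^N\Phi^{d_S}_\omega(a\circ F_i)\qquad\text{for all }a\in\mathcal F .$$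
   Context: **Self-similar structures.** $K$ is a compact metrizable space, $\mathcal S=\{1,\dots,N\}$ with $N\ge2$, and each $F_i:K\to K$ ($i\in\mathcal S$) is a continuous injection. Put $\Sigma=\mathcal S^{\mathbb N}$ and $\sigma_i(w_1w_2\dots)=iw_1w_2\dots$. $(K,\mathcal S,\{F_i\})$ is a self-similar structure if there is a continuous surjection $\pi:\Sigma\to K$ with $F_i\circ\pi=\pi\circ\sigma_i$ for all $i$. Let $W_m=\mathcal S^m$ be the set of words of length $m$ and $F_w=F_{w_1}\circ\dots\circ F_{w_m}$ for $w=w_1\dots w_m$ ($F_\emptyset=\mathrm{id}$). With $\sigma(w_1w_2\dots)=w_2w_3\dots$, $K_i=F_i(K)$, $\mathcal C=\pi^{-1}(\bigcup_{i\ne j}K_i\cap K_j)$ and $\mathcal P=\bigcup_{n\ge1}\sigma^n(\mathcal C)$, the structure is p.c.f. if $\mathcal P$ is finite. Put $V_0=\pi(\mathcal P)$, $V_m=\bigcup_{w\in W_m}F_w(V_0)$, $V_*=\bigcup_mV_m$ (dense in $K$). For a set $V$, $l(V)$ is the space of scalar functions on $V$. **Harmonic structures.** $D$ is a Laplacian on the finite set $V_0$: a real symmetric nonnegative definite matrix on $V_0$ with nonpositive off-diagonal entries and zero column sums, whose kernel consists of the constants; $\mathcal E_D[u]=(Du|u)$. $\mathbf r=(r_1,\dots,r_N)$ with $r_i>0$, and $r_w=r_{w_1}\cdots r_{w_m}$. Put $\mathcal E^{(m)}[u]=\sum_{w\in W_m}r_w^{-1}\mathcal E_D[u\circ F_w]$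 for $u\in l(V_m)$. $(D,\mathbf r)$ is a harmonic structure if $\mathcal E^{(m)}[u]=\min\{\mathcal E^{(m+1)}[v]:v\in l(V_{m+1}),\ v|_{V_m}=u\}$ for all $m\ge0$ and $u\in l(V_m)$; it is regular if $r_i<1$ for all $i\in\mathcal S$. **Dirichlet form.** $\mathcal F=\{u\in l(V_* ):\lim_m\mathcal E^{(m)}[u|_{V_m}]<\infty\}$ and $\mathcal E[u]=\lim_m\mathcal E^{(m)}[u|_{V_m}]$. In the regular case each $u\in\mathcal F$ extends uniquely to a continuous function on $K$, and $\mathcal F$ is thereby a uniformly dense subalgebra of $C(K)$. One has $u\in\mathcal F$ iff $u\circ F_i\in\mathcal F$ for all $i$, and then $\mathcal E[u]=\sum_ir_i^{-1}\mathcal E[u\circ F_i]$. Complex-valued functions are treated by $\mathcal E[u+iv]=\mathcal E[u]+\mathcal E[v]$ for $u,v$ real. **Measure and spectral exponent.** For $\mu_i>0$ with $\sum_i\mu_i=1$, the self-similar measure $\mu$ with weights $(\mu_1,\dots,\mu_N)$ is the unique Borel probability measure on $K$ with $\int_Kf\,d\mu=\sum_i\mu_i\int_Kf\circ F_i\,d\mu$ for $f\in C(K)$. The spectral exponent $d_S$ is the unique positive number with $\sum_{i\in\mathcal S}(r_i\mu_i)^{d_S/2}=1$. **Derivation.** It is known that there is a Hilbert space $\mathcal H$ carrying a $*$-representation of $C(K)$ (written as multiplication, $a\xi=\xi a$), and a linear map $\partial:\mathcal F\to\mathcal H$, with $\partial(ab)=(\partial a)b+a(\partial b)$ for $a,b\in\mathcal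 F$ and $\|\partial u\|_{\mathcal H}^2=\mathcal E[u]$ for $u\in\mathcal F$. The module also carries an antilinear isometric involution $J$ with $J(a\xi)=\bar a J\xi$ and $J\partial a=\partial\bar a$. The pair is unique up to unitary equivalence when the vectors $(\partial a)b$, $a\in\mathcal F$, $b\in C(K)$, span a dense subspace of $\mathcal H$. For $a\in C(K)$, $[F,a]$ is the commutator of $F$ with the operator by which $a$ acts on $\mathcal H$. **Dixmier traces.** A Dixmier functional is a state $\omega$ on $L^\infty(\mathbb R_+^* )$ with $\operatorname{ess\,liminf}_{t\to\infty}f\le\omega(f)\le\operatorname{ess\,limsup}_{t\to\infty}f$ for real $f$, invariant under the dilations $f(t)\mapsto f(ct)$ and the power maps $f(t)\mapsto f(t^c)$, $c>0$. For a compact operator $T\ge0$ with singular values $\mu_0(T)\ge\mu_1(T)\ge\dots$ satisfying $\sum_{n<M}\mu_n(T)=O(\log M)$, $\tau_\omega(T)=\omega\Bigl(t\mapsto\frac1{\log(1+t)}\int_0^t\mu_{\lfloor s\rfloor}(T)\,ds\Bigr)$. For $a\in\mathcal F$ the operator $|[F,a]|^{d_S}$ is of this kind. *)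

(* Defs.v *)
From HB Require Import structures.
From mathcomp Require Export all_boot all_order all_algebra sesquilinear.
From mathcomp Require Export all_classical all_reals all_analysis.
From mathcomp.real_closed Require Export complex.

Set Implicit Arguments.
Unset Strict Implicit.
Unset Printing Implicit Defensive.

Import Order.TTheory GRing.Theory Num.Theory.
Import numFieldNormedType.Exports.

Local Open Scope classical_set_scope.
Local Open Scope ring_scope.

(* The alphabet {1, ..., N} is 'I_N; infinite words carry the product of the
   discrete topologies. *)
Definition shift_space (N : nat) := {ptws nat -> discrete_topology 'I_N}.

Definition push_word N (i : 'I_N) (w : shift_space N) : shift_space N :=
  fun n => if n is n'.+1 then w n' else i.

Definition shift_word N (w : shift_space N) : shift_space N := fun n => w n.+1.

Section ContinuousFunctions.
Context (R : realType) (K : pseudoPMetricType R).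

Definition CK : set (K -> R[i]) := [set a | continuous (a : K -> R[i]^o)].

Definition conj_fun (a : K -> R[i]) : K -> R[i] := fun x => (a x)^*.

End ContinuousFunctions.

Section SelfSimilar.
Context (R : realType) (K : pseudoPMetricType R) (N : nat).
Variables (F : 'I_N -> K -> K) (pi : shift_space N -> K).

(* [hausdorff_space] turns the pseudometric of [K] into a metric. *)
Definition self_similar_structure : Prop :=
  [/\ compact [set: K] /\ hausdorff_space K, (2 <= N)%N,
      forall i, continuous (F i) /\ injective (F i),
      continuous pi /\ set_surj setT setT pi
    & forall i w, F i (pi w) = pi (push_word i w)].

Definition critical_set : set (shift_space N) :=
  pi @^-1` [set x | exists i j, i <> j /\ (range (F i) `&` range (F j)) x].

Definition post_critical_set : set (shift_space N) :=
  \bigcup_(n in [set n | (1 <= n)%N])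
    (iter n (@shift_word N) @` critical_set).

Definition pcf : Prop := finite_set post_critical_set.

Definition Fword (w : seq 'I_N) : K -> K := foldr (fun i g => F i \o g) id w.

Definition V0 : set K := pi @` post_critical_set.

Definition V (m : nat) : set K :=
  \bigcup_(w in [set: m.-tuple 'I_N]) (Fword w @` V0).

(* An element of l(V_m) is represented by any function on K restricting to it:
   the definitions below only use its values on V_m, and every function on V_m
   extends to K. The matrix D is likewise only used on V_0. *)
Variables (D : K -> K -> R) (r : 'I_N -> R).

Definition laplacian (u : K -> R) (p : K) : R := \sum_(q \in V0) D p q * u q.

Definition energyD (u : K -> R) : R := \sum_(p \in V0) laplacian u p * u p.

Definition is_laplacian : Prop :=
  [/\ {in V0 &, forall p q, D p q = D q p},
      {in V0 &, forall p q, p != q -> D p q <= 0},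
      {in V0, forall q, \sum_(p \in V0) D p q = 0},
      forall u, 0 <= energyD u
    & forall u, {in V0, forall p, laplacian u p = 0} <->
        exists c, {in V0, forall p, u p = c}].

Definition energy_m (m : nat) (u : K -> R) : R :=
  \sum_(w : m.-tuple 'I_N) (\prod_(i <- w) r i)^-1 * energyD (u \o Fword w).

Definition harmonic_structure : Prop :=
  [/\ is_laplacian, forall i, 0 < r i
    & forall m u,
        (forall v, {in V m, v =1 u} -> energy_m m u <= energy_m m.+1 v) /\
        (exists2 v, {in V m, v =1 u} & energy_m m.+1 v = energy_m m u)].

Definition regular_structure : Prop := forall i, r i < 1.

(* The form domain, a function on V_* being identified with its continuous
   extension to K. As the energies are nondecreasing in m, their limit is
   finite iff they converge in R. *)
Definition form_domain : set (K -> R[i]) :=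
  [set a | [/\ CK a,
               cvgn (fun m => energy_m m (fun x => complex.Re (a x)))
             & cvgn (fun m => energy_m m (fun x => complex.Im (a x)))]].

Definition energy (a : K -> R[i]) : R :=
  limn (fun m => energy_m m (fun x => complex.Re (a x))) +
  limn (fun m => energy_m m (fun x => complex.Im (a x))).

Definition self_similar_measure (mu_ : 'I_N -> R)
    (mu : probability (g_sigma_algebraType (@open K)) R) : Prop :=
  [/\ forall i, 0 < mu_ i, \sum_i mu_ i = 1
    & forall f : K -> R, continuous f ->
        \int[mu]_x f x = \sum_i mu_ i * \int[mu]_x f (F i x)].

Definition spectral_exponent (mu_ : 'I_N -> R) (dS : R) : Prop :=
  0 < dS /\ \sum_i (r i * mu_ i) `^ (dS / 2) = 1.

Section Derivation.
Context (H : completeNormedModType R[i]) (dot : {dot H for Num.conj}).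
Variables (act : (K -> R[i]) -> H -> H) (d : (K -> R[i]) -> H) (J : H -> H).

(* [dot] is linear on the left and antilinear on the right. *)
Definition hilbert_inner_product : Prop := forall x, dot x x = `|x| ^+ 2.

(* Only the values of [act] on continuous functions matter. *)
Definition star_representation : Prop :=
  [/\ forall a, CK a -> continuous (act a) /\
        (forall c x y, act a (c *: x + y) = c *: act a x + act a y),
      forall a b, CK a -> CK b -> forall c x,
        act (fun t => c * a t + b t) x = c *: act a x + act b x,
      forall a b, CK a -> CK b -> forall x,
        act (fun t => a t * b t) x = act a (act b x)
    & forall a, CK a -> forall x y, dot (act a x) y = dot x (act (conj_fun a) y)].

Definition module_span : set H :=
  [set x | exists n (a b : 'I_n -> K -> R[i]),
     [/\ forall k, form_domain (a k), forall k, CK (b k)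
       & x = \sum_k act (b k) (d (a k))]].

Definition antilinear_involution : Prop :=
  [/\ forall c x y, J (c *: x + y) = c^* *: J x + J y,
      forall x, `|J x| = `|x|, forall x, J (J x) = x,
      forall a, CK a -> forall x, J (act a x) = act (conj_fun a) (J x)
    & forall a, form_domain a -> J (d a) = d (conj_fun a)].

Definition derivation : Prop :=
  [/\ forall a b, form_domain a -> form_domain b -> forall c,
        d (fun t => c * a t + b t) = c *: d a + d b,
      forall a b, form_domain a -> form_domain b ->
        d (fun t => a t * b t) = act b (d a) + act a (d b),
      forall a, form_domain a -> `|d a| ^+ 2 = (energy a)%:C%C
    & closure module_span = setT].

End Derivation.
End SelfSimilar.

Section HilbertOperators.
Context (R : realType) (H : completeNormedModType R[i]).
Variable (dot : {dot H for Num.conj}).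

Definition orth_proj (W : set H) (x : H) : H :=
  xget 0 [set y | W y /\ forall v, W v -> dot (x - y) v = 0].

Definition adjoint (T : H -> H) (y : H) : H :=
  xget 0 [set z | forall x, dot (T x) y = dot x z].

Definition op_norm (T : H -> H) : R :=
  sup [set complex.Re `|T x| | x in [set x | `|x| <= 1]].

Definition poly_op (q : {poly R}) (T : H -> H) (x : H) : H :=
  \sum_(k < size q) (q`_k)%:C%C *: iter k T x.

(* |T|^p = f(T^* T) with f(t) = t^(p/2), by continuous functional calculus on
   [0, ||T||^2], which contains the spectrum of T^* T. *)
Definition is_abs_pow (T : H -> H) (p : R) (B : H -> H) : Prop :=
  forall e : R, 0 < e -> exists q : {poly R},
    (forall t : R, 0 <= t <= op_norm T ^+ 2 -> `|q.[t] - t `^ (p / 2)| <= e) /\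
    (forall x, `|poly_op q (adjoint T \o T) x - B x| <= e%:C%C * `|x|).

Definition abs_pow (T : H -> H) (p : R) : H -> H :=
  xget (fun=> 0) [set B | is_abs_pow T p B].

Definition compact_op (T : H -> H) : Prop :=
  compact (closure (T @` [set x | `|x| <= 1])).

(* The eigenvalues of |T| = (T^* T)^(1/2) in decreasing order, repeated
   according to multiplicity and completed by zeros, n = 0 giving the
   largest. *)
Definition singular_value (T : H -> H) (n : nat) : R :=
  sup [set t | t = 0 \/ 0 <= t /\ exists (e : 'I_n.+1 -> H) (s : 'I_n.+1 -> R),
    [/\ forall j k, dot (e j) (e k) = (j == k)%:R, forall k, t <= s k
      & forall k, adjoint T (T (e k)) = (s k ^+ 2)%:C%C *: e k]].

End HilbertOperators.

Section Dixmier.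
Context (R : realType).
Local Notation leb := (@lebesgue_measure R).

Definition Linfty (f : R -> R) : Prop :=
  measurable_fun (`]0, +oo[ : set R) f /\
  exists M : R, {ae leb, forall t : R, 0 < t -> `|f t| <= M}.

Definition ess_liminf (f : R -> R) : \bar R :=
  ereal_sup [set y | exists t0, {ae leb, forall t, t0 < t -> (y <= (f t)%:E)%E}].

Definition ess_limsup (f : R -> R) : \bar R :=
  ereal_inf [set y | exists t0, {ae leb, forall t, t0 < t -> ((f t)%:E <= y)%E}].

(* A state on the real part of L^oo(R_+^* ), which determines the state on
   complex functions. Only the values of [omega] on [Linfty] matter. *)
Definition dixmier_functional (omega : (R -> R) -> R) : Prop :=
  [/\ [/\ forall f g, Linfty f -> Linfty g ->
            {ae leb, forall t, 0 < t -> f t = g t} -> omega f = omega g,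
          forall f g c, Linfty f -> Linfty g ->
            omega (fun t => c * f t + g t) = c * omega f + omega g,
          forall f, Linfty f ->
            {ae leb, forall t, 0 < t -> 0 <= f t} -> 0 <= omega f
        & omega (fun=> 1) = 1],
      forall f, Linfty f ->
        (ess_liminf f <= (omega f)%:E <= ess_limsup f)%E,
      forall f c, Linfty f -> 0 < c -> omega (fun t => f (c * t)) = omega f
    & forall f c, Linfty f -> 0 < c -> omega (fun t => f (t `^ c)) = omega f].

Context (H : completeNormedModType R[i]) (dot : {dot H for Num.conj}).
Variable (omega : (R -> R) -> R).

Definition dixmier_traceable (T : H -> H) : Prop :=
  compact_op T /\
  exists C : R, \forall M \near \oo,
    \sum_(n < M) singular_value dot T n <= C * ln M%:R.

(* For positive T; as usual for traces, the value is +oo outside the ideal. *)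
Definition dixmier_trace (T : H -> H) : \bar R :=
  if `[< dixmier_traceable T >] then
    (omega (fun t => (ln (1 + t))^-1 *
       \int[leb]_(s in `[0, t]) singular_value dot T (Num.truncn s)))%:E
  else +oo%E.

End Dixmier.

Section EnergyFunctional.
Context (R : realType) (K : pseudoPMetricType R) (N : nat).
Variables (F : 'I_N -> K -> K) (pi : shift_space N -> K).
Variables (D : K -> K -> R) (r : 'I_N -> R).
Context (H : completeNormedModType R[i]) (dot : {dot H for Num.conj}).
Variables (act : (K -> R[i]) -> H -> H) (d : (K -> R[i]) -> H).

Definition phase_proj : H -> H :=
  orth_proj dot (closure (d @` form_domain F pi D r)).

Definition phase (x : H) : H := phase_proj x - (x - phase_proj x).

Definition phase_commutator (a : K -> R[i]) (x : H) : H :=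
  phase (act a x) - act a (phase x).

Definition energy_functional (omega : (R -> R) -> R) (dS : R)
    (a : K -> R[i]) : \bar R :=
  dixmier_trace dot omega (abs_pow dot (phase_commutator a) dS).

End EnergyFunctional.

(* Main.v *)
Require Import Defs.
From mathcomp Require Import ring lra measurable_realfun.

(** The map sending [b * da] to the family of the [r_i^(-1/2) (b o F_i) * d(a o F_i)]
    extends to a unitary [S] from [H] onto the [N]-fold direct sum of [H]. It is
    isometric because the energy is self-similar: the involution makes
    [<du, dv>] real for real [u] and [v], so that the Leibniz rule expresses
    [<g du, dv>] through inner products of derivatives. It is onto because a
    vector of [H] orthogonal to all [b * da] with [b] zero on the finite set [V0]
    vanishes.

    Functions vanishing on [V0] extend by zero from a cell to [K], so [P] differs
    from the direct sum of its copies on the cells by a finite rank operator.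
    Hence [[F, a]] agrees with the direct sum of the [[F, a o F_i]] on a subspace
    of finite codimension, and it is compact since [a] oscillates little on small
    cells.
    The numbers of singular values above a threshold therefore differ by a
    bounded amount, and [sum_(n < t) mu_n([F, a])^p <= sum_i sum_(n < t)
    mu_n([F, a o F_i])^p <= sum_(n < N t) mu_n([F, a])^p] up to bounded errors.
    As the Dixmier functional ignores the dilation by [N], the traces add up, and
    either all of them are finite or both sides are infinite. *)

Set Implicit Arguments.
Unset Strict Implicit.
Unset Printing Implicit Defensive.

Import Order.TTheory GRing.Theory Num.Theory.
Import numFieldNormedType.Exports.

Local Open Scope classical_set_scope.
Local Open Scope ring_scope.

(** * Hilbert spaces *)

(** Eigenvalues are never enumerated. Operators are handled through [small_op] and through families
    of eigenvectors above a threshold: an orthonormal family longer than a list of linear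
    constraints has a nonzero combination satisfying all of them. An identity of norms valid on the
    complement of a finite list [Y] therefore moves every counting function by at most [size Y],
    whatever the threshold. This uniformity gives an error in the partial sums that does not grow
    with the number of terms, and division by ln (1 + t) removes it in the limit.

    Surjectivity of [S] is the main obstacle: an isometry onto a proper subspace would leave room
    for more singular values on the cells than on [H]. Only vectors carried by [V0] could be missed,
    and there are none: near a boundary point, du is traded for derivatives of functions that tend
    uniformly to 0 with bounded energy, hence tend weakly to 0.

    Regularity gives a bound below 1 for all [r i], so the oscillation of harmonic functions decays
    geometrically with the depth of the cells. They are thus continuous on [K], which supplies all
    the functions with prescribed values on [V0]. *)

Lemma le0_of_small (R : realType) (t c : R) : (forall e : R, 0 < e -> t <= c * e) -> t <= 0.
Proof.
move=> h; apply/ler_addgt0Pr => e e0; rewrite add0r.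
have c0 : 0 < `|c| + 1 by rewrite ltr_wpDl.
apply: le_trans (h (e / (`|c| + 1)) _) _; first by rewrite divr_gt0.
rewrite mulrCA ler_piMr ?(ltW e0)// ler_pdivrMr// mul1r.
by rewrite (le_trans (ler_norm c))// lerDl.
Qed.

Section Modulus.
Context (R : realType).
Implicit Types z w : R[i].

(** The norm of [R[i]] is itself [R[i]]-valued; estimates are carried out in [R], with this real
    part for scalars and with [nm] for vectors. *)
Definition cmod z : R := complex.Re `|z|.

Lemma cmodE z : (cmod z)%:C%C = `|z|.
Proof. by rewrite RRe_real// normr_real. Qed.

Lemma cmod_ge0 z : 0 <= cmod z.
Proof. by rewrite -ler0c cmodE. Qed.

Lemma cmodM z w : cmod (z * w) = cmod z * cmod w.
Proof. by apply: (@complexI R); rewrite rmorphM /= !cmodE normrM. Qed.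

Lemma cmodD z w : cmod (z + w) <= cmod z + cmod w.
Proof. by rewrite -lecR rmorphD /= !cmodE ler_normD. Qed.

Lemma cmodJ z : cmod (z^*) = cmod z.
Proof. by apply: (@complexI R); rewrite !cmodE norm_conjC. Qed.

Lemma cmod_real (x : R) : cmod (x%:C)%C = `|x|.
Proof. by rewrite /cmod normc_def /= expr0n addr0 sqrtr_sqr. Qed.

Lemma cmod_sq z : cmod z ^+ 2 = complex.Re z ^+ 2 + complex.Im z ^+ 2.
Proof. by rewrite /cmod normc_def /= sqr_sqrtr// addr_ge0 ?sqr_ge0. Qed.

Lemma mulJ_cmod z : z * z^* = (cmod z ^+ 2)%:C%C.
Proof. by rewrite -normCK rmorphXn /= cmodE. Qed.

Lemma cmod_eq0 z : cmod z = 0 -> z = 0.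
Proof. by move=> z0; apply/eqP; rewrite -normr_eq0 -cmodE z0. Qed.

Lemma Re_abs_le_cmod z : `|complex.Re z| <= cmod z.
Proof.
rewrite -(ler_pXn2r (n:=2))// ?nnegrE ?cmod_ge0//.
by rewrite cmod_sq real_normK ?num_real// lerDl sqr_ge0.
Qed.

Lemma Im_le_cmod z : `|complex.Im z| <= cmod z.
Proof.
rewrite -(ler_pXn2r (n:=2))// ?nnegrE ?cmod_ge0//.
by rewrite cmod_sq real_normK ?num_real// lerDr sqr_ge0.
Qed.

Lemma Re_le_cmod z : complex.Re z <= cmod z.
Proof. exact: le_trans (ler_norm _) (Re_abs_le_cmod z). Qed.

Lemma ReJ z : complex.Re z^* = complex.Re z.
Proof. by case: z. Qed.

Lemma ImJ z : complex.Im z^* = - complex.Im z.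
Proof. by case: z. Qed.

Lemma ReD z w : complex.Re (z + w) = complex.Re z + complex.Re w.
Proof. by case: z; case: w. Qed.

Lemma ReB z w : complex.Re (z - w) = complex.Re z - complex.Re w.
Proof. by case: z; case: w. Qed.

Lemma ImB z w : complex.Im (z - w) = complex.Im z - complex.Im w.
Proof. by case: z w => ? ? []. Qed.

Lemma ReN z : complex.Re (- z) = - complex.Re z.
Proof. by case: z. Qed.

Lemma ReZ (x : R) z : complex.Re (x%:C%C * z) = x * complex.Re z.
Proof. by case: z => a b /=; rewrite mul0r subr0. Qed.

Lemma cmodN z : cmod (- z) = cmod z.
Proof. by rewrite -mulN1r cmodM /cmod normrN normr1 mul1r. Qed.

Lemma cmod_sum (I : Type) (s : seq I) (f : I -> R[i]) :
  cmod (\sum_(i <- s) f i) <= \sum_(i <- s) cmod (f i).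
Proof.
elim: s => [|i s IH]; first by rewrite !big_nil /cmod normr0.
by rewrite !big_cons (le_trans (cmodD _ _))// lerD2l.
Qed.

Lemma cmod_small_eq0 z (c : R) : (forall e : R, 0 < e -> cmod z <= c * e) -> z = 0.
Proof. by move=> h; apply/cmod_eq0/eqP; rewrite eq_le cmod_ge0 (le0_of_small h). Qed.

End Modulus.

Lemma exists_inv_lt (R : realType) (e : R) :
  0 < e -> exists n, n.+1%:R^-1 < e.
Proof.
move=> e0; have /cvgrPdist_lt/(_ _ e0)[n _ /(_ n (leqnn n))] := @cvg_harmonic R.
by rewrite /harmonic sub0r normrN ger0_norm ?invr_ge0// => ?; exists n.
Qed.

Section Hilbert.
Context (R : realType) (H : completeNormedModType R[i]).

Definition nm (x : H) : R := complex.Re `|x|.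

Lemma nmE x : (nm x)%:C%C = `|x|.
Proof. by rewrite RRe_real// normr_real. Qed.

Lemma nm_ge0 x : 0 <= nm x.
Proof. by rewrite -ler0c nmE. Qed.

Lemma nm0 : nm 0 = 0.
Proof. by rewrite /nm normr0. Qed.

Lemma nm_eq0 x : nm x = 0 -> x = 0.
Proof. by move=> x0; apply/eqP; rewrite -normr_eq0 -nmE x0. Qed.

Lemma nm_gt0 x : x != 0 -> 0 < nm x.
Proof.
by move=> x0; rewrite lt_def nm_ge0 andbT; apply: contra_neq x0 => /nm_eq0.
Qed.

Lemma nmZ c x : nm (c *: x) = cmod c * nm x.
Proof. by apply: (@complexI R); rewrite rmorphM /= nmE cmodE nmE normrZ. Qed.

Lemma nmN x : nm (- x) = nm x.
Proof. by rewrite /nm normrN. Qed.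

Lemma nmD x y : nm (x + y) <= nm x + nm y.
Proof. by rewrite -lecR rmorphD /= !nmE ler_normD. Qed.

Lemma nmB x y : nm (x - y) <= nm x + nm y.
Proof. by rewrite -(nmN y) nmD. Qed.

Lemma nm_distrC x y : nm (x - y) = nm (y - x).
Proof. by rewrite -nmN opprB. Qed.

Lemma nm_dist_tri y x z : nm (x - z) <= nm (x - y) + nm (y - z).
Proof. by rewrite (le_trans _ (nmD _ _))// addrA subrK. Qed.

Lemma nm_sum (I : Type) (s : seq I) (f : I -> H) :
  nm (\sum_(i <- s) f i) <= \sum_(i <- s) nm (f i).
Proof.
elim: s => [|i s IH]; first by rewrite !big_nil nm0.
by rewrite !big_cons (le_trans (nmD _ _))// lerD2l.
Qed.

Lemma nm_small_eq0 x (C : R) : (forall e : R, 0 < e -> nm x <= C * e) -> x = 0.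
Proof. by move=> h; apply/nm_eq0/eqP; rewrite eq_le nm_ge0 (le0_of_small h). Qed.

Section LinearMap.
Variable T : H -> H.
Hypothesis T_lin : forall c x y, T (c *: x + y) = c *: T x + T y.

Lemma lin_0 : T 0 = 0.
Proof. by have := T_lin (-1) 0 0; rewrite scaler0 addr0 scaleN1r addNr. Qed.

Lemma lin_Z c x : T (c *: x) = c *: T x.
Proof. by rewrite -[c *: x]addr0 T_lin lin_0 addr0. Qed.

Lemma lin_B x y : T (x - y) = T x - T y.
Proof. by rewrite addrC -scaleN1r T_lin scaleN1r addrC. Qed.

End LinearMap.

Lemma closure_nmP (A : set H) x :
  closure A x <-> forall e : R, 0 < e -> exists2 y, A y & nm (x - y) < e.
Proof.
split=> [cAx e e0|h B].
  have [|y [Ay yB]] := cAx (ball x e%:C%C).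
    by apply: nbhsx_ballx; rewrite ltcR.
  exists y => //; move: yB; rewrite -ball_normE /= => yB.
  by rewrite -ltcR nmE.
move=> /nbhs_ballP [e /= e0 eB].
have e0' : (complex.Re e)%:C%C = e by rewrite RRe_real// gtr0_real.
have [|y Ay ye] := h (complex.Re e); first by rewrite -ltcR e0'.
exists y; split => //; apply: eB; rewrite -ball_normE /=.
by rewrite -e0' -nmE ltcR.
Qed.

Lemma nm_complete (u : nat -> H) :
  (forall e : R, 0 < e -> exists n, forall m, (n <= m)%N -> nm (u m - u n) <= e) ->
  exists l, forall e : R, 0 < e ->
    exists n, forall m, (n <= m)%N -> nm (u m - l) <= e.
Proof.
move=> cu.
have : cvg (u @ \oo).
  apply/cauchy_cvgP/cauchy_ballP => e e0.
  have e0' : (complex.Re e)%:C%C = e by rewrite RRe_real// gtr0_real.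
  have er0 : 0 < complex.Re e by rewrite -ltcR e0'.
  have e4 : 0 < complex.Re e / 4 by rewrite divr_gt0.
  have [n hn] := cu _ e4.
  have hnear : \forall m \near (u @ \oo), nm (m - u n) <= complex.Re e / 4.
    by exists n => // m /= nm'; apply: hn.
  pose A : set H := [set m | nm (m - u n) <= complex.Re e / 4].
  exists (A, A); first by split.
  move=> [p q] [/= p1 q1].
  rewrite -ball_normE /= -e0' -nmE ltcR.
  apply: le_lt_trans (nm_dist_tri (u n) _ _) _; rewrite (nm_distrC (u n)).
  by move: p1 q1 e4; rewrite /A /=; lra.
move=> /cvg_ex [l ul]; exists l => e e0.
have /cvg_ballP/(_ e%:C%C) := ul; rewrite ltcR => /(_ e0) [n _ hn].
exists n => m nm'; have := hn m nm'; rewrite -ball_normE /= -nmE ltcR => /ltW.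
by rewrite nm_distrC.
Qed.

Variable (dot : {dot H for Num.conj}).
Hypothesis Hdot : hilbert_inner_product dot.

Lemma dotC x y : dot x y = (dot y x)^*.
Proof. by rewrite hermC expr0 mul1r. Qed.

Lemma dotDl x y z : dot (x + y) z = dot x z + dot y z.
Proof. exact: linearDl. Qed.

Lemma dotZl c x z : dot (c *: x) z = c * dot x z.
Proof. exact: linearZl_LR. Qed.

Lemma dotDr x y z : dot z (x + y) = dot z x + dot z y.
Proof. exact: linearDr. Qed.

Lemma dotZr c x z : dot z (c *: x) = c^* * dot z x.
Proof. by rewrite dotC dotZl rmorphM /= -dotC. Qed.

Lemma dot0l z : dot 0 z = 0.
Proof. exact: linear0l. Qed.

Lemma dot0r z : dot z 0 = 0.
Proof. exact: linear0r. Qed.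

Lemma dotNl x z : dot (- x) z = - dot x z.
Proof. exact: linearNl. Qed.

Lemma dotNr x z : dot z (- x) = - dot z x.
Proof. exact: linearNr. Qed.

Lemma dotBl x y z : dot (x - y) z = dot x z - dot y z.
Proof. by rewrite dotDl dotNl. Qed.

Lemma dotBr x y z : dot z (x - y) = dot z x - dot z y.
Proof. by rewrite dotDr dotNr. Qed.

Lemma dot_suml (I : Type) (s : seq I) (P : pred I) (f : I -> H) z :
  dot (\sum_(i <- s | P i) f i) z = \sum_(i <- s | P i) dot (f i) z.
Proof.
by elim/big_rec2: _ => [|i y1 y2 _ <-]; [rewrite dot0l|rewrite dotDl].
Qed.

Lemma dot_sumr (I : Type) (s : seq I) (P : pred I) (f : I -> H) z :
  dot z (\sum_(i <- s | P i) f i) = \sum_(i <- s | P i) dot z (f i).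
Proof.
by elim/big_rec2: _ => [|i y1 y2 _ <-]; [rewrite dot0r|rewrite dotDr].
Qed.

Lemma dot_eq0C x y : dot x y = 0 -> dot y x = 0.
Proof. by move=> h; rewrite dotC h conjC0. Qed.

Lemma dotxx x : dot x x = (nm x ^+ 2)%:C%C.
Proof. by rewrite Hdot rmorphXn /= nmE. Qed.

Lemma nm_sq x : nm x ^+ 2 = complex.Re (dot x x).
Proof. by rewrite dotxx. Qed.

Lemma nm_sqD x y :
  nm (x + y) ^+ 2 = nm x ^+ 2 + nm y ^+ 2 + 2 * complex.Re (dot x y).
Proof.
rewrite !nm_sq dotDl !dotDr !ReD (dotC y x) ReJ; ring.
Qed.

Lemma nm_sqB x y :
  nm (x - y) ^+ 2 = nm x ^+ 2 + nm y ^+ 2 - 2 * complex.Re (dot x y).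
Proof. by rewrite nm_sqD nmN dotNr ReN mulrN. Qed.

Lemma nm_pythagoras x y : dot x y = 0 -> nm (x + y) ^+ 2 = nm x ^+ 2 + nm y ^+ 2.
Proof. by move=> xy; rewrite nm_sqD xy mulr0 addr0. Qed.

(** The best multiple of [y] lowers the squared distance by an explicit amount. Nonnegativity of
    what remains is the Cauchy-Schwarz inequality; in the projection theorem, minimality of the
    distance forces the gain to be zero. *)
Lemma nm_sub_proj x y : y != 0 ->
  nm (x - (dot x y / (nm y ^+ 2)%:C%C) *: y) ^+ 2 =
  nm x ^+ 2 - cmod (dot x y) ^+ 2 / nm y ^+ 2.
Proof.
move=> /nm_gt0 y0; rewrite -fmorphV nm_sqB nmZ dotZr cmodM rmorphM /= cmod_real.
have -> : (((nm y ^+ 2)^-1)%:C%C)^* = ((nm y ^+ 2)^-1)%:C%C by exact: conjc_real.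
rewrite [_ * dot x y]mulrAC [(dot x y)^* * _]mulrC mulJ_cmod ReZ /=.
rewrite ger0_norm ?invr_ge0 ?sqr_ge0//; field.
by rewrite lt0r_neq0.
Qed.

Lemma cauchy_schwarz x y : cmod (dot x y) <= nm x * nm y.
Proof.
rewrite -(ler_pXn2r (n:=2))// ?nnegrE ?cmod_ge0 ?mulr_ge0 ?nm_ge0// exprMn.
have [->|y0] := eqVneq y 0; first by rewrite dot0r /cmod normr0 nm0 expr0n mulr0.
have := sqr_ge0 (nm (x - (dot x y / (nm y ^+ 2)%:C%C) *: y)).
by rewrite nm_sub_proj// subr_ge0 ler_pdivrMr// exprn_gt0// nm_gt0.
Qed.

Lemma dot_small x y (C : R) :
  (forall e : R, 0 < e -> cmod (dot x y) <= C * e) -> dot x y = 0.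
Proof. exact: cmod_small_eq0. Qed.

Lemma dot_closure (A : set H) z x :
  (forall y, A y -> dot y z = 0) -> closure A x -> dot x z = 0.
Proof.
move=> h /closure_nmP cx; apply: (@dot_small _ _ (nm z)) => e /cx[y Ay xy].
rewrite -[x](subrK y) dotDl (h y Ay) addr0.
rewrite (le_trans (cauchy_schwarz _ _))// mulrC ler_wpM2l ?nm_ge0//.
exact: ltW.
Qed.

Lemma dot_ext x y : (forall z, dot x z = dot y z) -> x = y.
Proof.
move=> h; apply/subr0_eq/nm_eq0; apply/eqP; rewrite -sqrf_eq0 nm_sq.
by rewrite dotBl h subrr.
Qed.

(* Distance-minimizing sequences are Cauchy by the parallelogram law. *)
Lemma projection_theorem (W : set H) x :
  W 0 -> (forall c y z, W y -> W z -> W (c *: y + z)) -> closure W `<=` W ->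
  exists2 y, W y & forall v, W v -> dot (x - y) v = 0.
Proof.
move=> W0 Wlin Wcl.
pose D := [set nm (x - y) | y in W].
have Dinf : has_inf D.
  split; first by exists (nm (x - 0)), 0.
  by exists 0 => _ [y _ <-]; exact: nm_ge0.
pose d := inf D.
have d_ge0 : 0 <= d by apply: lb_le_inf; [case: Dinf|move=> _ [y _ <-]; exact: nm_ge0].
have d_le y : W y -> d <= nm (x - y).
  by move=> Wy; apply: ge_inf; [case: Dinf|exists y].
have midW y z : W y -> W z -> W ((2^-1) *: (y + z)).
  move=> Wy Wz; rewrite -[_ *: _]addr0; apply: (Wlin) => //.
  by rewrite -[y]scale1r; apply: Wlin.
have close y z e : 0 <= e -> W y -> W z -> nm (x - y) ^+ 2 <= d ^+ 2 + e ->
    nm (x - z) ^+ 2 <= d ^+ 2 + e -> nm (y - z) ^+ 2 <= 4 * e.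
  move=> e0 Wy Wz hy hz.
  have /d_le := midW _ _ Wy Wz.
  have -> : x - 2^-1 *: (y + z) = 2^-1 *: ((x - y) + (x - z)).
    rewrite addrACA -opprD [RHS]scalerBr -mulr2n -(scaler_nat 2 x) scalerA.
    by rewrite mulVf ?pnatr_eq0// scale1r.
  rewrite nmZ => hm.
  have hh : cmod (2^-1 : R[i]) = 2^-1.
    by rewrite -[2^-1 : R[i]](_ : (2^-1 : R)%:C%C = _) ?cmod_real ?ger0_norm ?invr_ge0// fmorphV rmorph_nat.
  rewrite hh in hm.
  have h4 : 4 * d ^+ 2 <= nm ((x - y) + (x - z)) ^+ 2.
    have : (2 * d) ^+ 2 <= nm ((x - y) + (x - z)) ^+ 2.
      rewrite ler_pXn2r ?nnegrE ?nm_ge0 ?mulr_ge0//.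
      by rewrite -ler_pdivlMl.
    by rewrite exprMn; congr (_ <= _); ring.
  have -> : y - z = (x - z) - (x - y) by rewrite opprB [RHS]addrC addrA subrK.
  have := nm_sqB (x - z) (x - y); have := nm_sqD (x - y) (x - z).
  rewrite (dotC (x - z)) ReJ.
  by lra.
have app n : exists y, W y /\ nm (x - y) ^+ 2 <= d ^+ 2 + n.+1%:R^-1.
  have [|_ [y Wy <-] hy] := @inf_adherent _ D (Num.sqrt (d ^+ 2 + n.+1%:R^-1) - d) _ Dinf.
    rewrite subr_gt0 -[X in X < _](ger0_norm d_ge0) -sqrtr_sqr ltr_sqrt.
      by rewrite ltrDl invr_gt0.
    by rewrite ltr_wpDl ?sqr_ge0.
  exists y; split => //.
  rewrite -[leRHS]sqr_sqrtr ?addr_ge0 ?sqr_ge0// ler_pXn2r ?nnegrE ?nm_ge0//.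
  by apply: ltW; rewrite (lt_le_trans hy)// -/d addrC subrK.
have [u hu] := choice app.
have [l hl] : exists l, forall e : R, 0 < e ->
    exists n, forall m, (n <= m)%N -> nm (u m - l) <= e.
  apply: nm_complete => e e0.
  have e2 : 0 < e ^+ 2 / 4 by rewrite divr_gt0 ?exprn_gt0.
  have [n hn] : exists n, n.+1%:R^-1 < e ^+ 2 / 4.
    exact: exists_inv_lt.
  exists n => m nm'.
  rewrite -(ler_pXn2r (n:=2)) ?nnegrE ?nm_ge0 ?(ltW e0)//.
  have hm : nm (x - u m) ^+ 2 <= d ^+ 2 + n.+1%:R^-1.
    by apply: le_trans (hu m).2 _; rewrite lerD2l lef_pV2 ?posrE// ler_nat.
  have n0 : 0 <= (n.+1%:R^-1 : R) by rewrite invr_ge0.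
  apply: le_trans (close _ _ _ n0 (hu m).1 (hu n).1 hm (hu n).2) _.
  by rewrite mulrC -ler_pdivlMr// ltW.
have Wl : W l.
  apply: Wcl; apply/closure_nmP => e e0.
  have e2 : 0 < e / 2 by rewrite divr_gt0.
  have [n hn] := hl _ e2.
  exists (u n); first exact: (hu n).1.
  rewrite nm_distrC (le_lt_trans (hn n (leqnn n)))//; lra.
have ld : nm (x - l) <= d.
  apply/ler_addgt0Pr => e e0.
  have e2 : 0 < e / 2 by rewrite divr_gt0.
  have [n hn] := hl _ e2.
  have d2 : 0 < (d + e / 2) ^+ 2 - d ^+ 2.
    by rewrite subr_gt0 ltr_pXn2r ?nnegrE//; lra.
  have [m hm] : exists n, n.+1%:R^-1 < (d + e / 2) ^+ 2 - d ^+ 2.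
    exact: exists_inv_lt.
  pose k := maxn n m.
  have h1 := hn k (leq_maxl _ _).
  have h2 : nm (x - u k) <= d + e / 2.
    rewrite -(ler_pXn2r (n:=2)) ?nnegrE ?nm_ge0//; last lra.
    have : (k.+1%:R^-1 : R) <= m.+1%:R^-1 by rewrite lef_pV2 ?posrE// ler_nat ltnS leq_maxr.
    move=> h; apply: le_trans (hu k).2 _; rewrite -lerBrDl.
    exact: le_trans h (ltW hm).
  by have := nm_dist_tri (u k) x l; lra.
exists l => // v Wv.
have nmld : nm (x - l) = d by apply/eqP; rewrite eq_le ld d_le.
have [->|v0] := eqVneq v 0; first by rewrite dot0r.
apply/cmod_eq0/eqP; rewrite -sqrf_eq0 eq_le sqr_ge0 andbT.
set c := dot (x - l) v / (nm v ^+ 2)%:C%C.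
have Wlv : W (c *: v + l) by apply: Wlin.
have := d_le _ Wlv; rewrite opprD addrCA addrC.
rewrite -(ler_pXn2r (n:=2)) ?nnegrE ?nm_ge0// nm_sub_proj// nmld.
rewrite lerBrDr -lerBrDl subrr pmulr_lle0// invr_gt0 exprn_gt0//.
exact: nm_gt0.
Qed.

End Hilbert.

(** * Compactness from total boundedness *)

Section Precompact.
Context (R : realType) (H : completeNormedModType R[i]).
Implicit Types (x y : H) (S : set H).

Definition totally_bounded S :=
  forall e : R, 0 < e -> exists L : seq H,
    forall y, S y -> exists2 c, c \in L & nm (y - c) <= e.

Lemma ultra_seq_cover (U : set_system H) (L : seq H) (B : H -> set H) :
  UltraFilter U -> U [set y | exists2 c, c \in L & B c y] ->
  exists2 c, c \in L & U (B c).
Proof.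
move=> UU; elim: L => [|c L IH] UL.
  by exfalso; apply: (@filter_not_empty _ U); apply: filterS UL => y [].
have [UB|UnB] := @in_ultra_setVsetC _ U (B c) UU.
  by exists c => //; rewrite mem_head.
have [|c' c'L UB] := IH; last by exists c' => //; rewrite inE c'L orbT.
apply: filterS (filterI UL UnB) => y [[c' + Bc'] nBc].
by rewrite inE => /orP[/eqP c'c|c'L]; [case: nBc; rewrite -c'c|exists c'].
Qed.

(** Every ultrafilter on the closure contains a small ball around one of finitely many centers,
    hence is Cauchy, and completeness provides its limit. *)
Lemma totally_bounded_compact S : totally_bounded S -> compact (closure S).
Proof.
move=> tb; rewrite compact_ultra => U UU US.
have ucov (e : R) : 0 < e -> exists c, U [set y | nm (y - c) <= e].
  move=> e0; have e2 : 0 < e / 2 by rewrite divr_gt0.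
  have [L hL] := tb _ e2.
  have [|c _ Uc] := @ultra_seq_cover U L (fun c => [set y | nm (y - c) <= e]) UU.
    apply: filterS US => y /closure_nmP/(_ _ e2)[z Sz yz].
    have [c cL zc] := hL z Sz; exists c => //=.
    rewrite (le_trans (nm_dist_tri z _ _))//.
    by rewrite [leRHS]splitr lerD// ltW.
  by exists c.
have : cvg U.
  apply/cauchy_cvgP/cauchy_ballP => e e0.
  have e0' : (complex.Re e)%:C%C = e by rewrite RRe_real// gtr0_real.
  have er0 : 0 < complex.Re e by rewrite -ltcR e0'.
  have e4 : 0 < complex.Re e / 4 by rewrite divr_gt0.
  have [c Uc] := ucov _ e4.
  exists ([set y | nm (y - c) <= complex.Re e / 4],
          [set y | nm (y - c) <= complex.Re e / 4]); first by split.
  move=> [p q] [/= p1 q1].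
  rewrite -ball_normE /= -e0' -nmE ltcR.
  apply: le_lt_trans (nm_dist_tri c _ _) _; rewrite (nm_distrC c).
  by move: p1 q1 e4; rewrite /=; lra.
move=> /cvg_ex[l Ul]; exists l; split => //.
apply: (@closed_cvg _ _ U _ id (closure S)) => //; exact: closed_closure.
Qed.

End Precompact.

(** * Orthonormal families *)

Section Orthonormal.
Context (R : realType) (H : completeNormedModType R[i]).
Variable (dot : {dot H for Num.conj}).
Hypothesis Hdot : hilbert_inner_product dot.

(** The index is any finite type: families get enlarged through [option], restricted to a subtype,
    and joined over a dependent sum of ordinals. *)
Definition orthonormal (I : finType) (e : I -> H) :=
  forall j k, dot (e j) (e k) = (j == k)%:R.

Section Family.
Context (I : finType) (e : I -> H).
Hypothesis oe : orthonormal e.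

Lemma orthonormal_coef (c : I -> R[i]) k : dot (\sum_j c j *: e j) (e k) = c k.
Proof.
rewrite dot_suml (bigD1 k)//= dotZl oe eqxx mulr1 big1 ?addr0// => j jk.
by rewrite dotZl oe (negPf jk) mulr0.
Qed.

Lemma orthonormal_nm_sum (c : I -> R[i]) :
  nm (\sum_j c j *: e j) ^+ 2 = \sum_j cmod (c j) ^+ 2.
Proof.
apply: (@complexI R); rewrite -(dotxx Hdot) dot_sumr rmorph_sum /=.
apply: eq_bigr => k _.
by rewrite dotZr orthonormal_coef mulrC mulJ_cmod.
Qed.

Lemma orthonormal_nm k : nm (e k) = 1.
Proof.
apply/eqP; rewrite -(@eqrXn2 _ 2)// ?nm_ge0// (nm_sq Hdot) oe eqxx.
by rewrite expr1n.
Qed.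

Definition proj_fam x := \sum_j dot x (e j) *: e j.

Lemma proj_fam_orth x k : dot (x - proj_fam x) (e k) = 0.
Proof. by rewrite dotBl orthonormal_coef subrr. Qed.

Lemma proj_fam_pythagoras x :
  nm x ^+ 2 = \sum_j cmod (dot x (e j)) ^+ 2 + nm (x - proj_fam x) ^+ 2.
Proof.
rewrite -orthonormal_nm_sum -(nm_pythagoras Hdot) ?subrKC//.
rewrite dot_suml big1// => j _; rewrite dotZl.
by rewrite (dot_eq0C (proj_fam_orth x j)) mulr0.
Qed.

Lemma nm_proj_fam_compl x : nm (x - proj_fam x) <= nm x.
Proof.
rewrite -(ler_pXn2r (n:=2)) ?nnegrE ?nm_ge0// (proj_fam_pythagoras x) lerDr.
by apply: sumr_ge0 => j _; exact: sqr_ge0.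
Qed.

Lemma cmod_coef_le x k : cmod (dot x (e k)) <= nm x.
Proof.
by rewrite (le_trans (cauchy_schwarz Hdot _ _))// orthonormal_nm mulr1.
Qed.

(* A homogeneous linear system with more unknowns than equations. *)
Lemma exists_orthogonal_combination (ys : seq H) : (size ys < #|I|)%N ->
  exists c : I -> R[i], \sum_j c j *: e j != 0 /\
    forall y, y \in ys -> dot (\sum_j c j *: e j) y = 0.
Proof.
move=> sI.
pose A : 'M[R[i]]_(#|I|, size ys) := \matrix_(k, j) dot (e (enum_val k)) ys`_j.
have : kermx A != 0.
  rewrite kermx_eq0 /row_free; apply: contraTneq sI => <-.
  by rewrite -leqNgt rank_leq_col.
case/rowV0Pn => v /sub_kermxP vA v0.
exists (fun j => v 0 (enum_rank j)); split.
  apply: contra_neq v0 => s0; apply/rowP => k.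
  rewrite mxE -(enum_valK k).
  have := orthonormal_coef (fun j => v 0 (enum_rank j)) (enum_val k).
  by rewrite s0 dot0l.
move=> y yys; rewrite dot_suml -(nth_index 0 yys).
have iys : (index y ys < size ys)%N by rewrite index_mem.
have /rowP/(_ (Ordinal iys)) := vA; rewrite !mxE => vA0; rewrite -[RHS]vA0.
rewrite (reindex_onto enum_val enum_rank)/=; last by move=> j _; rewrite enum_rankK.
apply: eq_big => [k|k _]; first by rewrite enum_valK eqxx.
by rewrite dotZl enum_valK mxE.
Qed.

End Family.

(** Only the dual form of the inclusion of spans is recorded, since lists of vectors occur as
    constraints and [proj_fam] needs orthonormal ones. A vector depending on the previous ones adds
    nothing; otherwise its normalized remainder becomes the index [None]. *)
Lemma gram_schmidt (ys : seq H) :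
  exists (I : finType) (e : I -> H), orthonormal e /\
    forall x, (forall k, dot x (e k) = 0) -> forall y, y \in ys -> dot x y = 0.
Proof.
elim: ys => [|y ys [I [e [oe he]]]].
  by exists 'I_0, (fun=> 0); split => // - [].
pose z := y - proj_fam e y.
have yz x : (forall k, dot x (e k) = 0) -> dot x y = dot x z.
  move=> xe; rewrite dotBr dot_sumr big1 ?subr0// => j _.
  by rewrite dotZr xe mulr0.
have [z0|z0] := eqVneq z 0.
  exists I, e; split => // x xe w; rewrite inE => /orP[/eqP->|]; last exact: he.
  by rewrite yz// z0 dot0r.
have nz := nm_gt0 z0.
pose f := (nm z)^-1%:C%C *: z.
have fe k : dot f (e k) = 0 by rewrite dotZl (proj_fam_orth oe) mulr0.
have ff : dot f f = 1.
  rewrite (dotxx Hdot) nmZ cmod_real ger0_norm ?invr_ge0 ?nm_ge0// mulVf ?lt0r_neq0//.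
  by rewrite expr1n.
exists (option I), (fun o => if o is Some k then e k else f); split.
  move=> [j|] [k|] //=; rewrite ?oe ?fe//; first exact: dot_eq0C.
move=> x xe w.
have xek k : dot x (e k) = 0 := xe (Some k).
rewrite inE => /orP[/eqP->|]; last exact: he.
rewrite (yz x xek); have := xe None; rewrite /= dotZr => /eqP.
rewrite mulf_eq0 conjC_eq0 => /orP[|/eqP//].
by rewrite -(rmorph0 (real_complex R)) (inj_eq (@complexI R)) invr_eq0 gt_eqF.
Qed.

End Orthonormal.

(** * Compact operators *)

Section Operators.
Context (R : realType) (H : completeNormedModType R[i]).
Variable (dot : {dot H for Num.conj}).
Hypothesis Hdot : hilbert_inner_product dot.

(** The adjoint is carried as a witness because [adjoint] is defined by choice; [adjointE]
    identifies the two. An everywhere defined adjoint also forces linearity, see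
    [adjoint_pair_linear]. *)
Definition adjoint_pair (T T' : H -> H) := forall x y, dot (T x) y = dot x (T' y).

Lemma adjoint_pairC T T' : adjoint_pair T T' -> adjoint_pair T' T.
Proof. by move=> a x y; rewrite dotC -a -dotC. Qed.

Lemma adjoint_pair_linear T T' : adjoint_pair T T' ->
  forall c x y, T (c *: x + y) = c *: T x + T y.
Proof.
move=> a c x y; apply: (dot_ext Hdot) => z.
by rewrite a !dotDl !dotZl !a.
Qed.

Lemma adjointE T T' : adjoint_pair T T' -> adjoint dot T = T'.
Proof.
move=> a; apply/funext => y; rewrite /adjoint.
apply: xget_unique => [x|z hz]; first exact: a.
by apply: (dot_ext Hdot) => x; rewrite dotC -hz a -dotC.
Qed.

(* This is compactness, in a form adapted to counting dimensions. *)
Definition small_op (T : H -> H) := forall eps : R, 0 < eps ->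
  exists ys : seq H, forall x,
    (forall y, y \in ys -> dot x y = 0) -> nm (T x) <= eps * nm x.

(** The [s k] are singular values of [T] on eigenvectors of [T' T]. Asking only that they lie above
    [t] avoids ordering them; [eigen_count] below is the counting function of the singular values in
    disguise. *)
Definition eigen_family (T T' : H -> H) (t : R) (I : finType)
    (e : I -> H) (s : I -> R) :=
  [/\ orthonormal dot e, forall k, t <= s k
    & forall k, T' (T (e k)) = (s k ^+ 2)%:C%C *: e k].

Definition eigen_count (T T' : H -> H) (t : R) (n : nat) :=
  exists (e : 'I_n -> H) (s : 'I_n -> R), eigen_family T T' t e s.

(** A finite net of [-1, 1] for rounding the real and imaginary parts of coefficients of unit
    vectors; the right end is the grid point with [k] equal to 2 (m + 1). *)
Lemma real_grid (m : nat) (t : R) : -1 <= t <= 1 ->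
  exists k : 'I_(2 * m.+1).+1, `|t - (k%:R / m.+1%:R - 1)| <= m.+1%:R^-1.
Proof.
move=> /andP[t1 t2].
have m0 : 0 < m.+1%:R :> R by [].
have u0 : 0 <= (t + 1) * m.+1%:R by rewrite mulr_ge0//; lra.
have /andP[k1 k2] := truncn_itv u0.
set k := Num.truncn _ in k1 k2.
have kn : (k < (2 * m.+1).+1)%N.
  rewrite ltnS -(ler_nat R) (le_trans k1)// natrM ler_pM2r//; lra.
exists (Ordinal kn) => /=.
have -> : t - (k%:R / m.+1%:R - 1) = ((t + 1) * m.+1%:R - k%:R) / m.+1%:R.
  by rewrite mulrBl mulfK ?lt0r_neq0//; ring.
rewrite normrM (ger0_norm (x := _^-1)) ?invr_ge0// ler_piMl ?invr_ge0//.
rewrite ger0_norm ?subr_ge0//; move: k2; rewrite -natr1; lra.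
Qed.

Lemma cmod_le_ReIm (z : R[i]) : cmod z <= `|complex.Re z| + `|complex.Im z|.
Proof.
rewrite -(ler_pXn2r (n:=2)) ?nnegrE ?cmod_ge0 ?addr_ge0//.
rewrite cmod_sq -(real_normK (num_real (complex.Re z))).
rewrite -(real_normK (num_real (complex.Im z))) sqrrD.
by rewrite lerD2r lerDl mulrn_wge0// mulr_ge0.
Qed.

Lemma Re_itv (z : R[i]) : cmod z <= 1 -> -1 <= complex.Re z <= 1.
Proof.
by move=> z1; rewrite -ler_norml (le_trans (Re_abs_le_cmod _)).
Qed.

Lemma Im_itv (z : R[i]) : cmod z <= 1 -> -1 <= complex.Im z <= 1.
Proof.
by move=> z1; rewrite -ler_norml (le_trans (Im_le_cmod _)).
Qed.

Lemma lin_sum (T : H -> H) (I : finType) (c : I -> R[i]) (e : I -> H) :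
  (forall c x y, T (c *: x + y) = c *: T x + T y) ->
  T (\sum_j c j *: e j) = \sum_j c j *: T (e j).
Proof.
move=> lT; elim/big_rec2: _ => [|j y1 y2 _ <-]; first exact: lin_0.
by rewrite lT.
Qed.

(** Off a finite-dimensional space [T] contributes at most eps / 2; on that space the bounded
    coefficients are rounded to a grid, which leaves finitely many centers. *)
Lemma small_op_compact T : (forall c x y, T (c *: x + y) = c *: T x + T y) ->
  small_op T -> compact_op T.
Proof.
move=> lT sT; apply: totally_bounded_compact => eps e0.
have e2 : 0 < eps / 2 by rewrite divr_gt0.
have [ys hys] := sT _ e2.
have [I [e [oe he]]] := gram_schmidt Hdot ys.
pose Z := \sum_j nm (T (e j)).
have Z0 : 0 <= Z by apply: sumr_ge0 => j _; exact: nm_ge0.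
(* Rounding both parts of each coefficient costs at most 2 / (m + 1), hence at most eps / 2 after
   weighting by the norms summed in [Z]; adding 1 keeps the divisor positive. *)
have [m hm] : exists m, m.+1%:R^-1 < eps / 4 / (Z + 1).
  by apply: exists_inv_lt; rewrite !divr_gt0//; lra.
pose g (k : 'I_(2 * m.+1).+1) : R := k%:R / m.+1%:R - 1.
pose c (f : {ffun I -> 'I_(2 * m.+1).+1 * 'I_(2 * m.+1).+1}) :=
  \sum_j Complex (g (f j).1) (g (f j).2) *: T (e j).
exists [seq c f | f <- enum predT] => _ [x x1 <-].
have nx : nm x <= 1 by rewrite -lecR nmE.
have co j : cmod (dot x (e j)) <= 1 by rewrite (le_trans (cmod_coef_le Hdot oe _ _)).
have [k1 hk1] := choice (fun j => real_grid m (Re_itv (co j))).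
have [k2 hk2] := choice (fun j => real_grid m (Im_itv (co j))).
exists (c [ffun j => (k1 j, k2 j)]).
  by apply/map_f; rewrite mem_enum.
have -> : T x = T (proj_fam dot e x) + T (x - proj_fam dot e x).
  by have := lT 1 (proj_fam dot e x) (x - proj_fam dot e x); rewrite !scale1r subrKC.
rewrite /proj_fam lin_sum// addrAC -sumrB.
apply: le_trans (nmD _ _) _.
have h1 : nm (T (x - proj_fam dot e x)) <= eps / 2.
  apply: le_trans (hys _ _) _.
    by apply: he => k; exact: proj_fam_orth.
  apply: le_trans (ler_wpM2l (ltW e2) (nm_proj_fam_compl Hdot oe x)) _.
  by rewrite ler_piMr// ltW.
rewrite [leRHS]splitr lerD// (le_trans (nm_sum _ _))//.
apply: (@le_trans _ _ (\sum_j (2 / m.+1%:R) * nm (T (e j)))).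
  apply: ler_sum => j _; rewrite -scalerBl nmZ ler_wpM2r ?nm_ge0//.
  rewrite (le_trans (cmod_le_ReIm _))// ffunE /= /g.
  rewrite [leRHS](_ : _ = m.+1%:R^-1 + m.+1%:R^-1); last by rewrite mulr_natl mulr2n.
  apply: lerD.
    by have := hk1 j; case: (dot x (e j)).
  by have := hk2 j; case: (dot x (e j)).
rewrite -mulr_sumr -/Z.
have : m.+1%:R^-1 * (Z + 1) <= eps / 4 by rewrite -ler_pdivlMr ?ltW//; lra.
have : 0 <= (m.+1%:R^-1 : R) by rewrite invr_ge0.
set w := m.+1%:R^-1; nra.
Qed.

Section BoundedOperator.
Variables (T T' : H -> H) (C : R).
Hypothesis TT' : adjoint_pair T T'.
Hypothesis C0 : 0 <= C.
Hypothesis hC : forall x, nm (T x) <= C * nm x.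

Let lT := adjoint_pair_linear TT'.
Let lT' := adjoint_pair_linear (adjoint_pairC TT').

Lemma nm_adjoint_le x : nm (T' x) <= C * nm x.
Proof.
have [z0|z0] := eqVneq (T' x) 0.
  by rewrite z0 nm0 mulr_ge0 ?nm_ge0.
have nz := nm_gt0 z0.
rewrite -(ler_pM2r nz) -expr2 (nm_sq Hdot) -TT'.
rewrite (le_trans (Re_le_cmod _))// (le_trans (cauchy_schwarz Hdot _ _))//.
by rewrite mulrAC ler_wpM2r ?nm_ge0.
Qed.

Lemma nm_sq_op x : nm (T x) ^+ 2 = complex.Re (dot (T' (T x)) x).
Proof. by rewrite (nm_sq Hdot) (adjoint_pairC TT'). Qed.

(** [T' T] is diagonal on the span of the family, with entries at least t^2. *)
Lemma eigen_family_lower t (I : finType) (e : I -> H) s (c : I -> R[i]) :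
  0 <= t -> eigen_family T T' t e s ->
  t * nm (\sum_j c j *: e j) <= nm (T (\sum_j c j *: e j)).
Proof.
move=> t0 [oe ts he].
rewrite -(ler_pXn2r (n:=2)) ?nnegrE ?mulr_ge0 ?nm_ge0//.
rewrite exprMn (orthonormal_nm_sum Hdot oe) nm_sq_op !lin_sum// dot_suml.
rewrite (raddf_sum (@complex.Re R)) mulr_sumr /=; apply: ler_sum => j _.
rewrite he scalerA dotZl dotC (orthonormal_coef oe).
rewrite [c j * _ * _]mulrAC mulJ_cmod ReZ /= mulrC.
rewrite ler_wpM2l ?sqr_ge0// ler_pXn2r ?nnegrE//.
exact: le_trans (ts j).
Qed.

(* The norm of T on the complement of the eigenvectors found so far is attained
   at a limit of a maximizing sequence. *)
Lemma eigenvector_exists (I : finType) (e : I -> H) (s : I -> R) t x0 :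
  compact_op T -> (forall k, T' (T (e k)) = (s k ^+ 2)%:C%C *: e k) ->
  0 < t -> x0 != 0 -> (forall k, dot x0 (e k) = 0) -> t * nm x0 <= nm (T x0) ->
  exists z sg, [/\ forall k, dot z (e k) = 0, nm z = 1, t <= sg
    & T' (T z) = (sg ^+ 2)%:C%C *: z].
Proof.
move=> cT he t0 x0n x0e tx0.
pose A x := T' (T x).
pose W := [set x | forall k, dot x (e k) = 0].
have symA x y : dot (A x) y = dot x (A y).
  by rewrite /A (adjoint_pairC TT') TT'.
have WA x : W x -> W (A x).
  by move=> Wx k; rewrite symA /A he dotZr Wx mulr0.
have WZ c x : W x -> W (c *: x) by move=> Wx k; rewrite dotZl Wx mulr0.
pose E := [set nm (T x) | x in [set x | W x /\ nm x = 1]].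
have unitW x : W x -> x != 0 -> W ((nm x)^-1%:C%C *: x) /\ nm ((nm x)^-1%:C%C *: x) = 1.
  move=> Wx xn; split; first exact: WZ.
  rewrite nmZ cmod_real ger0_norm ?invr_ge0 ?nm_ge0// mulVf// lt0r_neq0//.
  exact: nm_gt0.
have supE : has_sup E.
  split; first by exists (nm (T ((nm x0)^-1%:C%C *: x0))), ((nm x0)^-1%:C%C *: x0) => //; exact: unitW.
  by exists C => _ [x [_ x1] <-]; rewrite (le_trans (hC x))// x1 mulr1.
pose sg := sup E.
have hW x : W x -> nm (T x) <= sg * nm x.
  move=> Wx; have [->|xn] := eqVneq x 0; first by rewrite (lin_0 lT) nm0 mulr0.
  have nx := nm_gt0 xn.
  have : nm (T ((nm x)^-1%:C%C *: x)) <= sg.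
    by apply: sup_ubound; [exact: supE.2|exists ((nm x)^-1%:C%C *: x) => //; exact: unitW].
  rewrite (lin_Z lT) nmZ cmod_real ger0_norm ?invr_ge0 ?nm_ge0//.
  by rewrite mulrC ler_pdivrMr.
have tsg : t <= sg.
  by rewrite -(ler_pM2r (nm_gt0 x0n)) (le_trans tx0)// hW.
have sg0 : 0 < sg by apply: lt_le_trans tsg.
have hA x : W x -> nm (A x) <= sg * nm (T x).
  move=> Wx; have [->|z0] := eqVneq (A x) 0; first by rewrite nm0 mulr_ge0 ?nm_ge0 ?ltW.
  have nz := nm_gt0 z0.
  rewrite -(ler_pM2r nz) -expr2 (nm_sq Hdot) {1}/A (adjoint_pairC TT').
  rewrite (le_trans (Re_le_cmod _))// (le_trans (cauchy_schwarz Hdot _ _))//.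
  rewrite [sg * _]mulrC -mulrA ler_wpM2l ?nm_ge0//.
  by apply: hW; exact: WA.
(* An almost maximizing vector is almost an eigenvector: expand the square, bound |A x| by sg |T x|
   and use |T x| >= sg - del. This leaves sg^4 - sg^2 (sg - del)^2, which is at most 2 sg^3 del. *)
have near_eig x del : W x -> nm x = 1 -> 0 <= del <= sg -> sg - del <= nm (T x) ->
    nm (A x - (sg ^+ 2)%:C%C *: x) ^+ 2 <= 2 * sg ^+ 3 * del.
  move=> Wx x1 /andP[d0 d1] hx.
  rewrite (nm_sqB Hdot) nmZ cmod_real x1 dotZr.
  have -> : ((sg ^+ 2)%:C%C)^* = (sg ^+ 2)%:C%C :> R[i] by exact: conjc_real.
  rewrite ReZ -nm_sq_op ger0_norm ?sqr_ge0// mulr1.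
  have h1 : nm (A x) ^+ 2 <= sg ^+ 2 * nm (T x) ^+ 2.
    rewrite -exprMn ler_pXn2r ?nnegrE ?mulr_ge0 ?nm_ge0 ?(ltW sg0)//.
    exact: hA.
  have h2 : (sg - del) ^+ 2 <= nm (T x) ^+ 2.
    by rewrite ler_pXn2r ?nnegrE ?nm_ge0 ?subr_ge0.
  have h3 : sg ^+ 2 * (sg - del) ^+ 2 <= sg ^+ 2 * nm (T x) ^+ 2.
    by rewrite ler_wpM2l ?sqr_ge0.
  have h4 : 0 <= sg ^+ 2 * del ^+ 2 by rewrite mulr_ge0 ?sqr_ge0.
  have h5 : sg ^+ 2 * (sg - del) ^+ 2 = sg ^+ 2 ^+ 2 - 2 * sg ^+ 3 * del + sg ^+ 2 * del ^+ 2 by ring.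
  lra.
have maxi n : exists x, [/\ W x, nm x = 1 & sg - n.+1%:R^-1 <= nm (T x)].
  have n0 : 0 < (n.+1%:R^-1 : R) by rewrite invr_gt0.
  have [_ [x [Wx x1] <-] hx] := sup_adherent n0 supE.
  by exists x; split => //; exact: ltW.
have [u hu] := choice maxi.
have [y hy] : exists y, forall (del : R) n0, 0 < del ->
    exists2 n, (n0 <= n)%N & nm (T (u n) - y) <= del.
  have [|y [_ cy]] := cT ((T \o u) @ \oo) _ _.
    exists 0%N => // n _ /=; apply: subset_closure; exists (u n) => //=.
    by have [_ u1 _] := hu n; rewrite -nmE u1.
  exists y => del n0 del0.
  have [||z [[n /= n0n <-] ]] := cy [set T (u n) | n in [set n | (n0 <= n)%N]] (ball y del%:C%C).
  - by exists n0 => // n /= n0n; exists n.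
  - by apply: nbhsx_ballx; rewrite ltcR.
  rewrite -ball_normE /= -nmE ltcR nm_distrC => /ltW h.
  by exists n.
(* [y] is a cluster point of the [T (u n)]. As [T' (T (u n))] is close to sg^2 [u n], the maximizing
   vectors themselves accumulate at this multiple of [T' y]. *)
pose z := (sg ^- 2)%:C%C *: T' y.
have app (eta : R) : 0 < eta -> exists n,
    nm (z - u n) <= (C + 1) / sg ^+ 2 * eta /\ nm (A (u n) - (sg ^+ 2)%:C%C *: u n) <= eta.
  move=> eta0.
  (* The first entry of the minimum keeps the defect below [sg], as [near_eig] requires; the second
     makes 2 sg^3 times the defect at most eta^2. *)
  have [n1 hn1] : exists n, n.+1%:R^-1 < Num.min sg (eta ^+ 2 / (2 * sg ^+ 3)).
    by apply: exists_inv_lt; rewrite lt_min sg0 divr_gt0 ?mulr_gt0 ?exprn_gt0.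
  move: hn1; rewrite lt_min => /andP[n1a n1b].
  have [n n1n hn] := hy eta n1 eta0; exists n.
  have [Wu u1 hun] := hu n.
  have nn1 : (n.+1%:R^-1 : R) <= n1.+1%:R^-1 by rewrite lef_pV2 ?posrE// ler_nat.
  have h1 : nm (A (u n) - (sg ^+ 2)%:C%C *: u n) <= eta.
    rewrite -(ler_pXn2r (n:=2)) ?nnegrE ?nm_ge0 ?(ltW eta0)//.
    apply: le_trans (near_eig (u n) n.+1%:R^-1 Wu u1 _ hun) _.
      by rewrite invr_ge0 ler0n (le_trans nn1)// ltW.
    rewrite mulrC -ler_pdivlMr ?mulr_gt0 ?exprn_gt0//.
    by rewrite (le_trans nn1)// ltW.
  split => //.
  have -> : z - u n = (sg ^- 2)%:C%C *: (T' y - (sg ^+ 2)%:C%C *: u n).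
    rewrite scalerBr scalerA -rmorphM /= mulVf ?scale1r//.
    by rewrite sqrf_eq0 lt0r_neq0.
  rewrite nmZ cmod_real ger0_norm ?invr_ge0 ?sqr_ge0// mulrAC mulrC.
  rewrite ler_wpM2r ?invr_ge0 ?sqr_ge0//.
  apply: le_trans (nm_dist_tri (A (u n)) _ _) _.
  rewrite mulrDl mul1r lerD// /A -(lin_B lT') (le_trans (nm_adjoint_le _))//.
  by rewrite ler_wpM2l// nm_distrC.
have K0 : 0 <= (C + 1) / sg ^+ 2 by rewrite divr_ge0 ?sqr_ge0// addr_ge0.
exists z, sg; split => //.
- move=> k; apply: (@dot_small _ _ dot _ _ ((C + 1) / sg ^+ 2 * nm (e k))) => eta eta0.
  have [n [h1 _]] := app eta eta0; have [Wu _ _] := hu n.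
  rewrite -[z](subrK (u n)) dotDl Wu addr0 (le_trans (cauchy_schwarz Hdot _ _))//.
  by rewrite mulrAC ler_wpM2r ?nm_ge0.
- apply/eqP; rewrite -subr_eq0 -normr_eq0 eq_le normr_ge0 andbT.
  apply/ler_addgt0Pr => eta eta0; rewrite add0r.
  have K1 : 0 < (C + 1) / sg ^+ 2 + 1 by lra.
  have [n [h1 _]] := app (eta / ((C + 1) / sg ^+ 2 + 1)) (divr_gt0 eta0 K1).
  have [_ u1 _] := hu n.
  have h2 : (C + 1) / sg ^+ 2 * (eta / ((C + 1) / sg ^+ 2 + 1)) <= eta.
    by rewrite mulrCA ler_piMr ?(ltW eta0)// ler_pdivrMr// mul1r lerDl.
  have h3 : nm z <= nm (z - u n) + 1 by rewrite -u1 -{1}[z](subrK (u n)) nmD.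
  have h4 : 1 <= nm (z - u n) + nm z.
    by rewrite -u1 -{1}[u n](subrK z) nm_distrC nmD.
  rewrite ler_norml; lra.
- apply/subr0_eq; pose K := (C * C + sg ^+ 2) * ((C + 1) / sg ^+ 2) + 1.
  apply: (@nm_small_eq0 _ _ _ K) => eta eta0.
  have [n [h1 h2]] := app eta eta0.
  have -> : T' (T z) - (sg ^+ 2)%:C%C *: z = A (z - u n) - (sg ^+ 2)%:C%C *: (z - u n)
      + (A (u n) - (sg ^+ 2)%:C%C *: u n).
    rewrite /A (lin_B lT) (lin_B lT') scalerBr opprD opprK addrACA subrK.
    by rewrite addrK.
  apply: le_trans (nmD _ _) _; rewrite /K mulrDl mul1r lerD//.
  apply: le_trans (nmB _ _) _; rewrite -mulrA mulrDl lerD//.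
    rewrite -mulrA (le_trans (nm_adjoint_le _))// ler_wpM2l// (le_trans (hC _))//.
    by rewrite ler_wpM2l.
  by rewrite nmZ cmod_real ger0_norm ?sqr_ge0// ler_wpM2l ?sqr_ge0.
Qed.

Lemma eigen_family_count t (I : finType) (e : I -> H) s :
  eigen_family T T' t e s -> eigen_count T T' t #|I|.
Proof.
move=> [oe ts he]; exists (e \o enum_val), (s \o enum_val); split => //=.
by move=> j k; rewrite oe (inj_eq enum_val_inj).
Qed.

(** This takes the place of the spectral theorem. The constraints that make [T] smaller than t / 2
    bound the size of every family at level [t], since a longer one would have a combination on
    which [T] is both at least [t] and at most t / 2. On the complement of a family of maximal size,
    any vector reaching level [t] would yield one more eigenvector by [eigenvector_exists]; hence
    the strict inequality, on which the counting arguments rely. *)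
Lemma eigen_threshold t : small_op T -> 0 < t ->
  exists n (e : 'I_n -> H) s, eigen_family T T' t e s /\
    forall x, x != 0 -> (forall k, dot x (e k) = 0) -> nm (T x) < t * nm x.
Proof.
move=> sT t0.
have t2 : 0 < t / 2 by rewrite divr_gt0.
have [ys hys] := sT _ t2.
have bound n : eigen_count T T' t n -> (n <= size ys)%N.
  move=> [e [s [oe ts he]]]; rewrite leqNgt; apply/negP => ysn.
  have [|c [x0 xy]] := exists_orthogonal_combination oe (ys := ys); first by rewrite card_ord.
  have := eigen_family_lower c (ltW t0) (And3 oe ts he).
  have := hys _ xy; have := nm_gt0 x0; nra.
have ex0 : exists n, `[< eigen_count T T' t n >].
  by exists 0%N; apply/asboolP; exists (fun=> 0), (fun=> t); split => // - [].
have [n /asboolP[e [s eig]] maxn] :=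
  ex_maxnP ex0 (fun n (h : `[< _ >]) => bound n (asboolW h)).
exists n, e, s; split => // x x0 xe; rewrite ltNge; apply/negP => tx.
have [oe ts he] := eig.
have [z [sg [ze z1 tsg hz]]] :=
  eigenvector_exists (small_op_compact lT sT) he t0 x0 xe tx.
suff : (n < n)%N by rewrite ltnn.
apply: maxn; apply/asboolP.
have -> : n.+1 = #|{: option 'I_n}| by rewrite card_option card_ord.
apply: (@eigen_family_count t _ (fun o => if o is Some k then e k else z)
  (fun o => if o is Some k then s k else sg)); split => [[j|] [k|]|[j|]|[j|]] //=.
- exact/dot_eq0C/ze.
- by rewrite (dotxx Hdot) z1 expr1n.
Qed.

End BoundedOperator.
End Operators.

(** * Functional calculus *)

Section Bernstein.
Context (R : realType).
Implicit Types (x y a : R) (n : nat).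

Definition bernstein n (k : nat) x := 'C(n, k)%:R * x ^+ k * (1 - x) ^+ (n - k).

Lemma bernstein_ge0 n k x : 0 <= x <= 1 -> 0 <= bernstein n k x.
Proof.
by move=> /andP[x0 x1]; rewrite !mulr_ge0 ?exprn_ge0 ?subr_ge0.
Qed.

Lemma bernstein_sum n x : \sum_(k < n.+1) bernstein n k x = 1.
Proof.
have := exprDn (1 - x) x n; rewrite subrK expr1n => ->.
by apply: eq_bigr => k _; rewrite /bernstein -[RHS]mulr_natl [(1 - x) ^+ _ * _]mulrC mulrA.
Qed.

(** The absorption identity for binomial coefficients turns a factor [k] into a shift of the index.
    Constant [g] gives the mean, and [g k] equal to [k] the second moment. *)
Lemma bernstein_weight n (g : nat -> R) x :
  \sum_(k < n.+2) k%:R * g k * bernstein n.+1 k x =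
  n.+1%:R * x * \sum_(k < n.+1) g k.+1 * bernstein n k x.
Proof.
rewrite big_ord_recl /= !mul0r add0r mulr_sumr; apply: eq_bigr => k _.
rewrite /bump /= add1n /bernstein subSS.
have : (k.+1%:R * 'C(n.+1, k.+1)%:R : R) = n.+1%:R * 'C(n, k)%:R.
  by rewrite -!natrM -mul_bin_diag.
move=> h; rewrite exprS.
transitivity (k.+1%:R * 'C(n.+1, k.+1)%:R * g k.+1 * (x * x ^+ k) * (1 - x) ^+ (n - k)).
  by ring.
by rewrite h; ring.
Qed.

Lemma bernstein_mean n x : \sum_(k < n.+1) k%:R * bernstein n k x = n%:R * x.
Proof.
case: n => [|n]; first by rewrite big_ord1 !mul0r.
have := bernstein_weight n (fun=> 1) x.
under eq_bigr do rewrite mulr1.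
under [in RHS]eq_bigr do rewrite mul1r.
by rewrite bernstein_sum mulr1.
Qed.

Lemma bernstein_variance n x :
  \sum_(k < n.+2) (x - k%:R / n.+1%:R) ^+ 2 * bernstein n.+1 k x =
  x * (1 - x) / n.+1%:R.
Proof.
have n0 : n.+1%:R != 0 :> R by rewrite pnatr_eq0.
have h2 : \sum_(k < n.+2) k%:R * k%:R * bernstein n.+1 k x =
    n.+1%:R * x * (n%:R * x + 1).
  rewrite (bernstein_weight n (fun k => k%:R)); congr (_ * _).
  under eq_bigr do rewrite -natr1 mulrDl mul1r.
  by rewrite big_split /= bernstein_mean bernstein_sum.
transitivity (x ^+ 2 * (\sum_(k < n.+2) bernstein n.+1 k x)
   - 2 * x / n.+1%:R * (\sum_(k < n.+2) k%:R * bernstein n.+1 k x)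
   + n.+1%:R ^- 2 * (\sum_(k < n.+2) k%:R * k%:R * bernstein n.+1 k x)).
  rewrite !mulr_sumr -sumrB -big_split /=; apply: eq_bigr => k _.
  by move: (bernstein _ _ _) => b; field.
rewrite bernstein_sum bernstein_mean h2 -natr1 in n0 *.
by field.
Qed.

(** Continuity is stated with a quadratic error so that it can be averaged directly: the mean of (x
    - k / n)^2 is the variance x (1 - x) / n, without splitting the sum into near and far
    indices. *)
Lemma bernstein_approx (f : R -> R) (e K : R) : 0 < e -> 0 <= K ->
  (forall x y, 0 <= x <= 1 -> 0 <= y <= 1 -> `|f x - f y| <= e + K * (x - y) ^+ 2) ->
  exists q : {poly R}, forall x, 0 <= x <= 1 -> `|q.[x] - f x| <= 2 * e.
Proof.
move=> e0 K0 hf.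
have [n hn] : exists n, n.+1%:R^-1 < e / (K + 1).
  by apply: exists_inv_lt; rewrite divr_gt0//; lra.
pose q : {poly R} := \sum_(k < n.+2)
  (f (k%:R / n.+1%:R) * 'C(n.+1, k)%:R) *: ('X^k * (1 - 'X) ^+ (n.+1 - k)).
exists q => x x01; have /andP[x0 x1] := x01.
have -> : q.[x] = \sum_(k < n.+2) f (k%:R / n.+1%:R) * bernstein n.+1 k x.
  rewrite horner_sum; apply: eq_bigr => k _.
  by rewrite hornerZ hornerM hornerXn horner_exp hornerD hornerN hornerX hornerC /bernstein !mulrA.
have -> : f x = \sum_(k < n.+2) f x * bernstein n.+1 k x.
  by rewrite -mulr_sumr bernstein_sum mulr1.
rewrite -sumrB (le_trans (ler_norm_sum _ _ _))//.
apply: (@le_trans _ _ (\sum_(k < n.+2) (e * bernstein n.+1 k x +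
    K * ((x - k%:R / n.+1%:R) ^+ 2 * bernstein n.+1 k x)))).
  apply: ler_sum => k _.
  rewrite -mulrBl normrM (ger0_norm (bernstein_ge0 _ _ x01)) mulrA -mulrDl.
  rewrite ler_wpM2r ?bernstein_ge0// distrC hf//.
  rewrite divr_ge0 ?ler0n//= ler_pdivrMr// mul1r ler_nat.
  by rewrite -ltnS.
rewrite big_split /= -!mulr_sumr bernstein_sum bernstein_variance mulr1.
have h1 : x * (1 - x) <= 1 by nra.
have h0 : 0 <= x * (1 - x) by nra.
have n0 : 0 <= (n.+1%:R^-1 : R) by rewrite invr_ge0.
move: hn; rewrite ltr_pdivlMr ?ltr_wpDl//.
by move: n0; set w := n.+1%:R^-1 => w0 hw; nra.
Qed.

(** For 0 <= s <= 1 one has s x^b <= (s x)^b. Adding the cases s = y / x and s = (x - y) / x gives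
    the subadditivity x^b <= y^b + (x - y)^b. *)
Lemma powR_holder (b x y : R) : 0 < b <= 1 -> 0 <= x -> 0 <= y ->
  `|x `^ b - y `^ b| <= `|x - y| `^ b.
Proof.
move=> /andP[b0 b1].
wlog xy : x y / y <= x.
  move=> hw x0 y0; have [yx|xy] := leP y x; first exact: hw.
  by rewrite distrC (distrC x) hw// ltW.
move=> x0 y0.
have bn : b != 0 by rewrite gt_eqF.
have yb : y `^ b <= x `^ b by apply: ge0_ler_powR; rewrite ?nnegrE// ltW.
rewrite (ger0_norm (x := _ - _)) ?subr_ge0// ger0_norm ?subr_ge0//.
have [x00|xn] := eqVneq x 0.
  have -> : y = x by apply/eqP; rewrite eq_le xy x00.
  by rewrite subrr powR_ge0.
have xp : 0 < x by rewrite lt_def xn.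
have sub s : 0 <= s <= 1 -> s * x `^ b <= (s * x) `^ b.
  move=> /andP[s0 s1]; rewrite powRM// ler_wpM2r ?powR_ge0//.
  move: s0; rewrite le_eqVlt => /orP[/eqP<-|s0]; first exact: powR_ge0.
  by apply: ger1_powR => //; rewrite s0.
have h1 : y / x * x `^ b <= y `^ b.
  rewrite -{2}[y](divfK xn); apply: sub.
  by rewrite divr_ge0//= ler_pdivrMr// mul1r.
have h2 : (x - y) / x * x `^ b <= (x - y) `^ b.
  rewrite -{2}[x - y](divfK xn); apply: sub.
  by rewrite divr_ge0 ?subr_ge0//= ler_pdivrMr// mul1r gerBl.
by move: h1 h2; rewrite mulrBl divff// mulrBl mul1r; lra.
Qed.

Lemma distX_le n a b : 0 <= a <= 1 -> 0 <= b <= 1 ->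
  `|a ^+ n - b ^+ n| <= n%:R * `|a - b|.
Proof.
move=> /andP[a0 a1] /andP[b0 b1]; elim: n => [|n IH]; first by rewrite subrr normr0 mul0r.
have -> : a ^+ n.+1 - b ^+ n.+1 = a * (a ^+ n - b ^+ n) + b ^+ n * (a - b).
  by rewrite !exprS; ring.
rewrite (le_trans (ler_normD _ _))// !normrM -natr1 mulrDl mul1r lerD//.
  by rewrite (ger0_norm a0) (le_trans _ IH)// ler_piMl.
by rewrite ger0_norm ?exprn_ge0// ler_piMl// exprn_ile1.
Qed.

(** Writing [al] as b n with 0 < b <= 1 makes x^al the n-th power of a Hoelder function with values
    in [0, 1], and the n-th power is Lipschitz there with constant n. *)
Lemma powR_approx_unit (al e : R) : 0 < al -> 0 < e ->
  exists q : {poly R}, forall x, 0 <= x <= 1 -> `|q.[x] - x `^ al| <= e.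
Proof.
move=> al0 e0.
pose n := (Num.truncn al).+1.
have n0 : 0 < n%:R :> R by rewrite ltr0n.
have [b [b0 b1 bn]] : exists b, [/\ 0 < b, b <= 1 & al = b * n%:R].
  exists (al / n%:R); split; first by rewrite divr_gt0.
    by rewrite ler_pdivrMr// mul1r ltW// truncnS_gt.
  by rewrite divfK ?lt0r_neq0.
clearbody n.
(* The Lipschitz constant n turns [d] into e / 2, and [del] is the distance at which the Hoelder
   bound equals [d]. *)
pose d := e / 2 / n%:R.
have d0 : 0 < d by rewrite !divr_gt0.
pose del := d `^ b^-1.
have del0 : 0 < del by rewrite powR_gt0.
have [|||q hq] := @bernstein_approx (fun x => x `^ al) (e / 2) (n%:R / del ^+ 2).
- by rewrite divr_gt0.
- by rewrite divr_ge0 ?sqr_ge0 ?ltW.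
- move=> x y /andP[x0 x1] /andP[y0 y1].
  have pow01 z : 0 <= z -> z <= 1 -> 0 <= z `^ b <= 1.
    move=> z0 z1; rewrite powR_ge0.
    have : z `^ b <= 1 `^ b by apply: ge0_ler_powR; rewrite ?nnegrE// ltW.
    by rewrite powR1.
  rewrite bn !powRrM !powR_mulrn ?powR_ge0//.
  apply: le_trans (distX_le _ (pow01 _ x0 x1) (pow01 _ y0 y1)) _.
  have -> : e / 2 = n%:R * d by rewrite [RHS]mulrC divfK// lt0r_neq0.
  rewrite -mulrA -mulrDr ler_pM2l//.
  rewrite (le_trans (powR_holder _ x0 y0)) ?b0//.
  have h0 : 0 <= del ^- 2 * (x - y) ^+ 2 by rewrite mulr_ge0 ?sqr_ge0// invr_ge0 sqr_ge0.
  have [xyd|xyd] := leP `|x - y| del.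
    rewrite -[leLHS]addr0 lerD//.
    have -> : d = del `^ b by rewrite -powRrM mulVf ?lt0r_neq0// powRr1// ltW.
    by apply: ge0_ler_powR; rewrite ?nnegrE// ltW.
  (* For points farther apart than [del], |x - y|^b is at most 1 while the quadratic term exceeds
     1. *)
  apply: (@le_trans _ _ 1).
    have /andP[_ ->//] : 0 <= `|x - y| `^ b <= 1.
    by apply: pow01 => //; rewrite ler_norml; apply/andP; split; lra.
  rewrite -[leLHS]add0r lerD ?ltW//.
  rewrite mulrC ltr_pdivlMr ?exprn_gt0// mul1r.
  by rewrite -[ltRHS]real_normK ?num_real// ltr_pXn2r ?nnegrE// ltW.
by exists q => x x01; rewrite (le_trans (hq _ x01))// mulrCA divff ?mulr1// pnatr_eq0.
Qed.

Lemma powR_approx (al M e : R) : 0 < al -> 0 <= M -> 0 < e ->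
  exists q : {poly R}, forall x, 0 <= x <= M -> `|q.[x] - x `^ al| <= e.
Proof.
move=> al0; rewrite le_eqVlt => /orP[/eqP<-|M0] e0.
  exists 0 => x; rewrite -eq_le => /eqP <-.
  by rewrite horner0 powR0 ?gt_eqF// subrr normr0 ltW.
have Ma : 0 < M `^ al by rewrite powR_gt0.
have [q hq] := powR_approx_unit al0 (divr_gt0 e0 Ma).
exists (M `^ al *: (q \Po (M^-1 *: 'X))) => x /andP[x0 xM].
rewrite hornerZ horner_comp hornerZ hornerX.
have -> : x `^ al = M `^ al * (M^-1 * x) `^ al.
  by rewrite -powRM ?(ltW M0) ?mulVKf ?gt_eqF// mulr_ge0 ?invr_ge0 ?(ltW M0).
rewrite -mulrBr normrM gtr0_norm// mulrC -ler_pdivlMr// hq//.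
by rewrite mulr_ge0 ?invr_ge0 ?(ltW M0)//= mulrC ler_pdivrMr// mul1r.
Qed.

End Bernstein.

(** * Polynomials in a positive compact operator *)

Section FunctionalCalculus.
Context (R : realType) (H : completeNormedModType R[i]).
Variable (dot : {dot H for Num.conj}).
Hypothesis Hdot : hilbert_inner_product dot.

Lemma op_normP (T : H -> H) (C : R) : 0 <= C -> (forall x, nm (T x) <= C * nm x) ->
  0 <= op_norm T /\ forall x, nm x <= 1 -> nm (T x) <= op_norm T.
Proof.
move=> C0 hC.
have ub : has_ubound [set complex.Re `|T x| | x in [set x | `|x| <= 1]].
  exists C => _ [x x1 <-]; rewrite (le_trans (hC x))// ler_piMr//.
  by rewrite -lecR nmE.
have le x : nm x <= 1 -> nm (T x) <= op_norm T.
  by move=> x1; apply: ub_le_sup => //; exists x => //=; rewrite -nmE lecR.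
by split => //; rewrite (le_trans (nm_ge0 (T 0)))// le// nm0.
Qed.

Variables (T T' : H -> H) (C : R).
Hypothesis TT' : adjoint_pair dot T T'.
Hypothesis C0 : 0 <= C.
Hypothesis hC : forall x, nm (T x) <= C * nm x.
Hypothesis sT : small_op dot T.

Let A := T' \o T.
Let lA c x y : A (c *: x + y) = c *: A x + A y.
Proof.
rewrite /A /= (adjoint_pair_linear Hdot TT').
exact: (adjoint_pair_linear Hdot (adjoint_pairC TT')).
Qed.
Let AA : adjoint_pair dot A A.
Proof. by move=> x y; rewrite /A /= (adjoint_pairC TT') TT'. Qed.

Lemma iter_linear k c x y : iter k A (c *: x + y) = c *: iter k A x + iter k A y.
Proof. by elim: k => //= k ->; rewrite lA. Qed.

Lemma iter_selfadjoint k x y : dot (iter k A x) y = dot x (iter k A y).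
Proof. by elim: k x y => //= k IH x y; rewrite AA IH -iterSr. Qed.

Lemma poly_op_wide (q : {poly R}) n x : (size q <= n)%N ->
  poly_op q A x = \sum_(k < n) (q`_k)%:C%C *: iter k A x.
Proof.
move=> qn; rewrite /poly_op (big_ord_widen n (fun k => (q`_k)%:C%C *: iter k A x))//.
rewrite [RHS](bigID (fun i : 'I_n => (i < size q)%N)) /= [X in _ + X]big1 ?addr0// => k.
by rewrite -leqNgt => /(nth_default 0) ->; rewrite scale0r.
Qed.

Lemma poly_opB (q q' : {poly R}) x :
  poly_op (q - q') A x = poly_op q A x - poly_op q' A x.
Proof.
pose n := maxn (size q) (size q').
rewrite !(@poly_op_wide _ n) ?leq_maxl ?leq_maxr//; last first.
  by rewrite (leq_trans (size_polyD _ _))// size_polyN.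
by rewrite -sumrB; apply: eq_bigr => k _; rewrite coefB rmorphB scalerBl.
Qed.

Lemma poly_op_linear (q : {poly R}) c x y :
  poly_op q A (c *: x + y) = c *: poly_op q A x + poly_op q A y.
Proof.
rewrite /poly_op scaler_sumr -big_split /=; apply: eq_bigr => k _.
by rewrite iter_linear scalerDr !scalerA mulrC.
Qed.

Lemma poly_op_selfadjoint (q : {poly R}) x y :
  dot (poly_op q A x) y = dot x (poly_op q A y).
Proof.
rewrite /poly_op dot_suml dot_sumr; apply: eq_bigr => k _.
rewrite dotZl dotZr iter_selfadjoint; congr (_ * _).
by apply/esym; exact: conjc_real.
Qed.

Lemma poly_op_eigen (q : {poly R}) (l : R) x : A x = l%:C%C *: x ->
  poly_op q A x = (q.[l])%:C%C *: x.
Proof.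
move=> Ax; rewrite /poly_op horner_coef rmorph_sum scaler_suml /=.
apply: eq_bigr => k _; rewrite rmorphM rmorphXn /= -scalerA; congr (_ *: _).
elim: (k : nat) => [|j IH] /=; first by rewrite expr0 scale1r.
by rewrite IH (lin_Z lA) Ax scalerA exprSr.
Qed.

(** The complement of the eigenvectors is invariant under [A], and [T] is small there. Smallness of
    [T'] is not at hand, so |A z|^2 is written as the inner product of [T z] and [T (A z)], both of
    which are small. *)
Lemma iter_small eps (I : finType) (e : I -> H) s : 0 <= eps ->
  eigen_family dot T T' eps e s ->
  (forall x, x != 0 -> (forall k, dot x (e k) = 0) -> nm (T x) < eps * nm x) ->
  forall j x, (forall k, dot x (e k) = 0) ->
  (forall k, dot (iter j A x) (e k) = 0) /\ nm (iter j A x) <= (eps ^+ 2) ^+ j * nm x.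
Proof.
move=> eps0 [oe es he] small.
have small' x : (forall k, dot x (e k) = 0) -> nm (T x) <= eps * nm x.
  have [->|x0 xe] := eqVneq x 0; last exact/ltW/small.
  by rewrite (lin_0 (adjoint_pair_linear Hdot TT')) nm0 mulr0.
move=> j x xe; elim: j => [|j [IH1 IH2]] /=; first by rewrite expr0 mul1r.
have Ae k : dot (A (iter j A x)) (e k) = 0.
  by rewrite AA /A /= he dotZr IH1 mulr0.
split => //.
rewrite exprS -mulrA; apply: (@le_trans _ _ (eps ^+ 2 * nm (iter j A x))); last first.
  by rewrite ler_wpM2l ?sqr_ge0.
set z := iter j A x in IH1 Ae *.
have [->|n0] := eqVneq (A z) 0; first by rewrite nm0 mulr_ge0 ?nm_ge0 ?sqr_ge0.
rewrite -(ler_pM2r (nm_gt0 n0)) -expr2 (nm_sq Hdot) {1}/A /= (adjoint_pairC TT').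
rewrite (le_trans (Re_le_cmod _))// (le_trans (cauchy_schwarz Hdot _ _))//.
have -> : eps ^+ 2 * nm z * nm (A z) = (eps * nm z) * (eps * nm (A z)) by ring.
by apply: ler_pM; rewrite ?nm_ge0// small'.
Qed.

(** Only the constant term survives at first order: every other monomial carries at least a factor
    eps^2, because eps <= 1. *)
Lemma poly_op_small (q : {poly R}) eps (I : finType) (e : I -> H) s :
  0 <= eps <= 1 -> eigen_family dot T T' eps e s ->
  (forall x, x != 0 -> (forall k, dot x (e k) = 0) -> nm (T x) < eps * nm x) ->
  forall x, (forall k, dot x (e k) = 0) ->
  (forall k, dot (poly_op q A x) (e k) = 0) /\ nm (poly_op q A x) <= (`|q.[0]| + eps ^+ 2 * \sum_(k < size q) `|q`_k|) * nm x.
Proof.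
move=> /andP[eps0 eps1] eig small x xe; split.
  move=> k; rewrite /poly_op dot_suml big1// => j _.
  by rewrite dotZl (iter_small eps0 eig small j xe).1 mulr0.
rewrite (@poly_op_wide _ (size q).+1)// big_ord_recl.
rewrite (le_trans (nmD _ _))// mulrDl lerD//.
  by rewrite nmZ cmod_real horner_coef0.
rewrite (le_trans (nm_sum _ _))// mulr_sumr mulr_suml.
apply: (@le_trans _ _ (\sum_(k < (size q).+1) eps ^+ 2 * `|q`_k| * nm x)).
  rewrite [leRHS]big_ord_recl; rewrite ler_wpDl ?mulr_ge0 ?nm_ge0 ?sqr_ge0//.
  apply: ler_sum => k _; rewrite nmZ cmod_real.
  have [_] := iter_small eps0 eig small (bump 0 k) xe => h.
  rewrite mulrAC mulrC ler_wpM2r// (le_trans h)// ler_wpM2r ?nm_ge0//.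
  by rewrite /bump /= add1n exprS ler_piMr ?sqr_ge0// exprn_ile1 ?sqr_ge0// expr_le1.
by rewrite big_ord_recr /= nth_default// normr0 mulr0 mul0r addr0.
Qed.

Lemma eigenvalue_bound l x : nm x = 1 -> A x = (l ^+ 2)%:C%C *: x ->
  0 <= l ^+ 2 <= op_norm T ^+ 2.
Proof.
move=> x1 Ax; rewrite sqr_ge0 /=.
have [opn0 ho] := op_normP C0 hC.
have <- : nm (T x) ^+ 2 = l ^+ 2.
  rewrite (nm_sq_op Hdot TT') -[T' (T x)]/(A x) Ax dotZl (dotxx Hdot) x1.
  by rewrite ReZ /= expr1n mulr1.
by rewrite ler_pXn2r ?nnegrE ?nm_ge0// ho// x1.
Qed.

Lemma nm_sq_decomp (B : H -> H) (I : finType) (e : I -> H) (b : I -> R) x :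
  orthonormal dot e -> (forall c x y, B (c *: x + y) = c *: B x + B y) ->
  (forall k, B (e k) = (b k)%:C%C *: e k) ->
  (forall x, (forall k, dot x (e k) = 0) -> forall k, dot (B x) (e k) = 0) ->
  nm (B x) ^+ 2 = \sum_k b k ^+ 2 * cmod (dot x (e k)) ^+ 2 +
    nm (B (x - proj_fam dot e x)) ^+ 2.
Proof.
move=> oe lB Be Bo.
have := lB 1 (proj_fam dot e x) (x - proj_fam dot e x).
rewrite !scale1r subrKC => ->.
have -> : B (proj_fam dot e x) = \sum_k (dot x (e k) * (b k)%:C%C) *: e k.
  by rewrite lin_sum//; apply: eq_bigr => k _; rewrite Be scalerA.
rewrite (nm_pythagoras Hdot); last first.
  rewrite dot_suml big1// => k _; rewrite dotZl (dot_eq0C (Bo _ _ k)) ?mulr0//.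
  by move=> j; exact: proj_fam_orth.
rewrite (orthonormal_nm_sum Hdot oe); congr (_ + _); apply: eq_bigr => k _.
by rewrite cmodM cmod_real exprMn real_normK ?num_real// mulrC.
Qed.

(** The eigenvectors above a small level [eps] diagonalize [poly_op q A], with values of [q] on
    [0, |T|^2]. On their complement the norm is at most |q(0)| + eps^2 Q, and 0 lies in the same
    interval. The choice of [eps] makes eps^2 Q at most an arbitrary [eta]. *)
Lemma poly_op_norm (q : {poly R}) c :
  (forall t, 0 <= t <= op_norm T ^+ 2 -> `|q.[t]| <= c) ->
  forall x, nm (poly_op q A x) <= c * nm x.
Proof.
move=> hq x; have [opn0 ho] := op_normP C0 hC.
have q0 : `|q.[0]| <= c by apply: hq; rewrite lexx sqr_ge0.
have c0 : 0 <= c by rewrite (le_trans _ q0).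
have [->|x0] := eqVneq x 0.
  have := poly_op_linear q (-1) 0 0; rewrite !scaleN1r !addNr => ->.
  by rewrite nm0 mulr0.
have nx := nm_gt0 x0.
rewrite -ler_pdivrMr//; apply/ler_addgt0Pr => eta eta0; rewrite ler_pdivrMr//.
pose Q := \sum_(k < size q) `|q`_k|.
have Q0 : 0 <= Q by apply: sumr_ge0.
pose eps := Num.min 1 (eta / (Q + 1)).
have Q1 : 0 < Q + 1 by rewrite ltr_wpDl.
have eps0 : 0 < eps by rewrite lt_min ltr01 divr_gt0.
have eps1 : eps <= 1 by rewrite ge_min lexx.
have epsQ : eps ^+ 2 * Q <= eta.
  have : eps * (Q + 1) <= eta by rewrite -ler_pdivlMr// ge_min lexx orbT.
  have : eps ^+ 2 <= eps by rewrite expr2 ler_piMl ?(ltW eps0).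
  nra.
have [n [e [s [eig small]]]] := eigen_threshold Hdot TT' C0 hC sT eps0.
have eps01 : 0 <= eps <= 1 by rewrite ltW.
have := poly_op_small q eps01 eig small.
have [oe es he] := eig => pos.
have decomp := @nm_sq_decomp (poly_op q A) _ e (fun k => q.[s k ^+ 2]) x oe
  (poly_op_linear q) (fun k => poly_op_eigen q (he k)) (fun z hz => (pos z hz).1).
rewrite -(ler_pXn2r (n:=2)) ?nnegrE ?nm_ge0 ?mulr_ge0 ?addr_ge0 ?(ltW eta0) ?(ltW nx)//.
rewrite decomp exprMn (proj_fam_pythagoras Hdot oe x) mulrDr lerD//.
  rewrite mulr_sumr; apply: ler_sum => k _; rewrite ler_wpM2r ?sqr_ge0//.
  rewrite -real_normK ?num_real// ler_pXn2r ?nnegrE ?addr_ge0 ?(ltW eta0)//.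
  rewrite (@le_trans _ _ c)// ?lerDl ?(ltW eta0)//; apply: hq.
  by apply: eigenvalue_bound (he k); exact: (orthonormal_nm Hdot oe).
rewrite -exprMn ler_pXn2r ?nnegrE ?nm_ge0 ?mulr_ge0 ?nm_ge0 ?addr_ge0 ?(ltW eta0)//.
have [_ h] := pos (x - proj_fam dot e x) (fun k => proj_fam_orth oe x k).
by rewrite (le_trans h)// ler_wpM2r ?nm_ge0// lerD.
Qed.

(** Polynomials within 1 / (n + 1) of t^(p/2) on [0, |T|^2] give operators that are Cauchy in norm
    by [poly_op_norm]; [B] is their limit. *)
Lemma abs_pow_exists (p : R) : 0 < p -> exists B, is_abs_pow dot T p B.
Proof.
move=> p0; have p2 : 0 < p / 2 by rewrite divr_gt0.
have [opn0 ho] := op_normP C0 hC.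
have [q hq] := choice (fun n : nat => @powR_approx R (p / 2) (op_norm T ^+ 2) (n.+1%:R^-1) p2 (sqr_ge0 _)
  (ltac:(by rewrite invr_gt0) : 0 < (n.+1%:R^-1 : R))).
have qq m n x : nm (poly_op (q m) A x - poly_op (q n) A x) <= (m.+1%:R^-1 + n.+1%:R^-1) * nm x.
  rewrite -poly_opB; apply: poly_op_norm => t ht.
  rewrite hornerD hornerN -(subrKA (t `^ (p / 2))) (le_trans (ler_normD _ _))//.
  by rewrite lerD ?hq// distrC hq.
have cau x : exists l, forall e : R, 0 < e ->
    exists n, forall m, (n <= m)%N -> nm (poly_op (q m) A x - l) <= e.
  apply: nm_complete => e e0.
  have nx1 : 0 < nm x + 1 by rewrite ltr_wpDl ?nm_ge0.
  have [n hn] : exists n, n.+1%:R^-1 < e / 2 / (nm x + 1).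
    by apply: exists_inv_lt; rewrite !divr_gt0.
  exists n => m nm'; rewrite (le_trans (qq _ _ _))//.
  have m1 : (m.+1%:R^-1 : R) <= n.+1%:R^-1 by rewrite lef_pV2 ?posrE// ler_nat.
  have : n.+1%:R^-1 * (nm x + 1) < e / 2 by rewrite -ltr_pdivlMr.
  have : 0 <= (m.+1%:R^-1 : R) by rewrite invr_ge0.
  have := nm_ge0 x.
  move: m1; set u := m.+1%:R^-1; set v := n.+1%:R^-1; nra.
have [B hB] := choice cau.
exists B => e e0.
have [n hn] : exists n, n.+1%:R^-1 < e / 2 by apply: exists_inv_lt; rewrite divr_gt0.
exists (q n); split.
  by move=> t ht; rewrite (le_trans (hq _ _ ht))//; move: hn; set u := _^-1; lra.
move=> x; rewrite (adjointE Hdot TT') -!nmE -rmorphM /= lecR.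
apply/ler_addgt0Pr => d d0.
have [m hm] := hB x d d0.
pose k := maxn m n.
have h1 := hm k (leq_maxl _ _).
have h2 : (k.+1%:R^-1 : R) <= n.+1%:R^-1 by rewrite lef_pV2 ?posrE// ler_nat ltnS leq_maxr.
rewrite (le_trans (nm_dist_tri (poly_op (q k) A x) _ _))// lerD//.
rewrite (le_trans (qq _ _ _))// ler_wpM2r ?nm_ge0//; move: h2 hn.
set u := k.+1%:R^-1; set v := n.+1%:R^-1; lra.
Qed.

End FunctionalCalculus.

(** * The power |T|^p and its singular values *)

Section AbsPow.
Context (R : realType) (H : completeNormedModType R[i]).
Variable (dot : {dot H for Num.conj}).
Hypothesis Hdot : hilbert_inner_product dot.
Variables (T T' : H -> H) (C : R).
Hypothesis TT' : adjoint_pair dot T T'.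
Hypothesis C0 : 0 <= C.
Hypothesis hC : forall x, nm (T x) <= C * nm x.
Hypothesis sT : small_op dot T.
Variables (p : R).
Hypothesis p0 : 0 < p.

Let B := abs_pow dot T p.
Let A := T' \o T.

(** [abs_pow] is picked by [xget], so its defining property becomes available only through
    [abs_pow_exists]. *)
Lemma abs_pow_spec (e : R) : 0 < e -> exists q : {poly R},
  (forall t : R, 0 <= t <= op_norm T ^+ 2 -> `|q.[t] - t `^ (p / 2)| <= e) /\
  (forall x, nm (poly_op q A x - B x) <= e * nm x).
Proof.
have hB : is_abs_pow dot T p B.
  have [B0 hB0] := abs_pow_exists Hdot TT' C0 hC sT p0.
  exact: (xgetPex (fun=> 0) (ex_intro _ B0 hB0)).
move=> e0; have [q [q1 q2]] := hB e e0.
exists q; split => // x; rewrite -lecR rmorphM /= !nmE.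
by rewrite /A -(adjointE Hdot TT').
Qed.

Lemma abs_pow_selfadjoint : adjoint_pair dot B B.
Proof.
move=> x y; apply/subr0_eq.
apply/cmod_eq0/eqP; rewrite eq_le cmod_ge0 andbT.
apply/ler_addgt0Pr => e e0; rewrite add0r.
have K0 : 0 < 2 * (nm x * nm y) + 1 by rewrite ltr_wpDl// mulr_ge0// mulr_ge0 ?nm_ge0.
have [q [_ hq]] := abs_pow_spec (divr_gt0 e0 K0).
have -> : dot (B x) y - dot x (B y) =
    dot x (poly_op q A y - B y) - dot (poly_op q A x - B x) y.
  by rewrite dotBr dotBl (poly_op_selfadjoint TT') opprB [RHS]addrC addrA subrK.
rewrite (le_trans (cmodD _ _))// -[cmod (- _)]cmodJ.
have -> : cmod ((- dot (poly_op q A x - B x) y)^*) = cmod (dot (poly_op q A x - B x) y).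
  by rewrite cmodJ /cmod normrN.
have h1 := cauchy_schwarz Hdot x (poly_op q A y - B y).
have h2 := cauchy_schwarz Hdot (poly_op q A x - B x) y.
have h3 := ler_wpM2l (nm_ge0 x) (hq y).
have h4 := ler_wpM2r (nm_ge0 y) (hq x).
have h5 : e / (2 * (nm x * nm y) + 1) * (2 * (nm x * nm y)) <= e.
  by rewrite mulrAC -mulrA ler_piMr ?(ltW e0)// ler_pdivrMr// mul1r lerDl.
move: h3 h4 h5; set w := e / _; lra.
Qed.

Lemma abs_pow_linear c x y : B (c *: x + y) = c *: B x + B y.
Proof. exact: (adjoint_pair_linear Hdot abs_pow_selfadjoint). Qed.

Lemma abs_pow_bounded : exists2 D, 0 <= D & forall x, nm (B x) <= D * nm x.
Proof.
have [q [q1 q2]] := abs_pow_spec ltr01.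
have [opn0 _] := op_normP C0 hC.
exists (1 + (1 + (op_norm T ^+ 2) `^ (p / 2))).
  by rewrite !addr_ge0 ?powR_ge0.
move=> x; have -> : B x = - (poly_op q A x - B x) + poly_op q A x by rewrite opprB subrK.
rewrite (le_trans (nmD _ _))// nmN mulrDl lerD//.
apply: (poly_op_norm Hdot TT' C0 hC sT) => t t01.
rewrite -[q.[t]](subrK (t `^ (p / 2))) (le_trans (ler_normD _ _))// lerD ?q1//.
rewrite ger0_norm ?powR_ge0// ge0_ler_powR ?nnegrE ?sqr_ge0//.
- by rewrite divr_ge0// ltW.
- by case/andP: t01.
- by case/andP: t01.
Qed.

Lemma abs_pow_eigen s x : 0 <= s -> nm x = 1 -> A x = (s ^+ 2)%:C%C *: x ->
  B x = (s `^ p)%:C%C *: x.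
Proof.
move=> s0 x1 Ax; apply/subr0_eq; apply: (@nm_small_eq0 _ _ _ 2) => e e0.
have [q [q1 q2]] := abs_pow_spec e0.
have s2 := eigenvalue_bound Hdot TT' C0 hC x1 Ax.
have sp : s `^ p = (s ^+ 2) `^ (p / 2).
  by rewrite -powR_mulrn// -powRrM mulrC divfK.
have -> : B x - (s `^ p)%:C%C *: x = - (poly_op q A x - B x)
    + (q.[s ^+ 2] - s `^ p)%:C%C *: x.
  by rewrite (poly_op_eigen Hdot TT' q Ax) rmorphB scalerBl opprB addrA subrK.
rewrite (le_trans (nmD _ _))// nmN nmZ cmod_real x1 mulr1 mulr2n mulrDl mul1r lerD//.
  by have := q2 x; rewrite x1 mulr1.
by rewrite sp q1.
Qed.

(** Since t^(p/2) vanishes at 0, an approximating polynomial has a small constant term, and |T|^p is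
    small wherever [T] is. The three thirds of [eta] pay for the approximation, for q(0) and for
    eps^2 Q; [eps0] depends on [eta] alone and not on the family. *)
Lemma abs_pow_vanishing (eta : R) : 0 < eta -> exists2 eps0 : R, 0 < eps0 <= 1 &
  forall eps (I : finType) (e : I -> H) s, 0 < eps <= eps0 ->
  eigen_family dot T T' eps e s ->
  (forall x, x != 0 -> (forall k, dot x (e k) = 0) -> nm (T x) < eps * nm x) ->
  forall x, (forall k, dot x (e k) = 0) -> nm (B x) <= eta * nm x.
Proof.
move=> eta0; have e3 : 0 < eta / 3 by rewrite divr_gt0.
have [q [q1 q2]] := abs_pow_spec e3.
pose Q := \sum_(k < size q) `|q`_k|.
have Q0 : 0 <= Q by apply: sumr_ge0.
have Q1 : 0 < Q + 1 by rewrite ltr_wpDl.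
exists (Num.min 1 (eta / 3 / (Q + 1))).
  by rewrite lt_min ltr01 divr_gt0//= ge_min lexx.
move=> eps I e s /andP[eps0]; rewrite le_min => /andP[eps1 epsQ] eig small x xe.
have eps01 : 0 <= eps <= 1 by rewrite (ltW eps0).
have [_ h] := poly_op_small Hdot TT' q eps01 eig small xe.
have h0 : `|q.[0]| <= eta / 3.
  have := q1 0; rewrite lexx sqr_ge0 powR0 ?subr0; last by rewrite gt_eqF// divr_gt0.
  exact.
have h1 : eps ^+ 2 * Q <= eta / 3.
  have : eps * (Q + 1) <= eta / 3 by rewrite -ler_pdivlMr.
  have : eps ^+ 2 <= eps by rewrite expr2 ler_piMl ?(ltW eps0).
  nra.
have -> : B x = - (poly_op q A x - B x) + poly_op q A x by rewrite opprB subrK.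
rewrite (le_trans (nmD _ _))// nmN.
have h2 := q2 x.
have : nm (poly_op q A x) <= (eta / 3 + eta / 3) * nm x.
  by rewrite (le_trans h)// ler_wpM2r ?nm_ge0// lerD.
have := nm_ge0 x; lra.
Qed.

Lemma abs_pow_small : small_op dot B.
Proof.
move=> eta eta0; have [eps0 /andP[eps00 _] h] := abs_pow_vanishing eta0.
have [n [e [s [eig small]]]] := eigen_threshold Hdot TT' C0 hC sT eps00.
exists [seq e k | k <- enum 'I_n] => x xe.
apply: (h eps0 _ e s) => //; first by rewrite eps00 lexx.
by move=> k; apply: xe; apply: map_f; rewrite mem_enum.
Qed.

Lemma abs_pow_compact : compact_op B.
Proof. exact: (small_op_compact Hdot abs_pow_linear abs_pow_small). Qed.

Lemma eigen_count_le S S' (t : R) m n : (n <= m)%N ->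
  eigen_count dot S S' t m -> eigen_count dot S S' t n.
Proof.
move=> nm' [e [s [oe ts he]]].
exists (e \o widen_ord nm'), (s \o widen_ord nm'); split => //= j k.
by rewrite oe; congr (_%:R); apply/eqP/eqP => [/(congr1 val)/= /val_inj|->].
Qed.

Lemma eigen_count_mono S S' (t t1 : R) n : t1 <= t ->
  eigen_count dot S S' t n -> eigen_count dot S S' t1 n.
Proof.
move=> tt [e [s [oe ts he]]]; exists e, s; split => // k.
exact: le_trans (ts k).
Qed.

(** From [T] to [B] the same eigenvectors serve. Conversely an eigenvector of B^2 is not known to be
    one of [T' T], so the claim is obtained by comparing dimensions. *)
Lemma eigen_count_abs_pow (t : R) n : 0 < t ->
  eigen_count dot B B (t `^ p) n <-> eigen_count dot T T' t n.
Proof.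
move=> t0; have tp0 : 0 < t `^ p by rewrite powR_gt0.
split; last first.
  move=> [e [s [oe ts he]]]; exists e, (fun k => s k `^ p); split => // k.
    have sk := ts k; rewrite ge0_ler_powR ?nnegrE ?(ltW p0) ?(ltW t0)//.
    by rewrite (le_trans _ sk)// ltW.
  have sk0 : 0 <= s k by rewrite (le_trans _ (ts k))// ltW.
  have Bek := abs_pow_eigen sk0 (orthonormal_nm Hdot oe k) (he k).
  rewrite Bek -[_ *: e k]addr0 abs_pow_linear Bek.
  rewrite (lin_0 (adjoint_pair_linear Hdot abs_pow_selfadjoint)) addr0 scalerA -rmorphM /=.
  by rewrite expr2.
move=> [f [sg [onf sgt hf]]].
have [eps0 /andP[eps00 eps01] hv] := abs_pow_vanishing (divr_gt0 tp0 (ltr0Sn R 1)).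
pose eps := Num.min t eps0.
have epsp : 0 < eps by rewrite lt_min t0.
have epst : eps <= t by rewrite ge_min lexx.
have epsb : 0 < eps <= eps0 by rewrite epsp ge_min lexx orbT.
have [m [e [s [eig small]]]] := eigen_threshold Hdot TT' C0 hC sT epsp.
have hB := hv _ _ _ _ epsb eig small.
have [oe es he] := eig.
(* Only eigenvectors at level [t] are counted. If there were fewer than [n], some nonzero
   combination [x] of the eigenvectors of [B] would be orthogonal to all of them. *)
pose J := {k : 'I_m | t <= s k}.
have eigJ : eigen_family dot T T' t (fun k : J => e (val k)) (fun k => s (val k)).
  by split=> [j k|k|k]; [rewrite oe (inj_eq val_inj)|case: k|rewrite he].
apply: eigen_count_le (eigen_family_count eigJ).
rewrite leqNgt; apply/negP => Jn.
have [|c [x0 xy]] := exists_orthogonal_combination onf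
  (ys := [seq e (val k) | k : J]).
  by rewrite size_map -cardE card_ord.
set x := \sum_j _ in x0 xy.
have xJ k : t <= s k -> dot x (e k) = 0.
  move=> tk; apply: (xy (e k)); apply/mapP; exists (exist _ k tk); rewrite ?mem_enum ?inE//.
have low : t `^ p * nm x <= nm (B x).
  exact: (eigen_family_lower Hdot abs_pow_selfadjoint c (ltW tp0) (And3 onf sgt hf)).
have s0 k : 0 <= s k by rewrite (le_trans _ (es k))// ltW.
have Be k := abs_pow_eigen (s0 k) (orthonormal_nm Hdot oe k) (he k).
have Bo z : (forall k, dot z (e k) = 0) -> forall k, dot (B z) (e k) = 0.
  by move=> hz k; rewrite abs_pow_selfadjoint Be dotZr hz mulr0.
have := nm_sq_decomp Hdot x oe abs_pow_linear Be Bo.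
have low2 : (t `^ p) ^+ 2 * nm x ^+ 2 <= nm (B x) ^+ 2.
  by rewrite -exprMn ler_pXn2r ?nnegrE ?mulr_ge0 ?nm_ge0 ?(ltW tp0).
have := proj_fam_pythagoras Hdot oe x.
set x' := x - _.
have hx' : nm (B x') <= t `^ p / 2 * nm x'.
  by apply: hB => k; exact: proj_fam_orth.
have hx2 : nm (B x') ^+ 2 <= (t `^ p) ^+ 2 / 4 * nm x' ^+ 2.
  have -> : (t `^ p) ^+ 2 / 4 * nm x' ^+ 2 = (t `^ p / 2 * nm x') ^+ 2 by field.
  by rewrite ler_pXn2r ?nnegrE ?mulr_ge0 ?divr_ge0 ?nm_ge0 ?(ltW tp0).
(* Subtracting the two Pythagorean decompositions turns the lower bound on |B x| into a sum of
   nonnegative terms that is at most 0. The factor 3 / 4 is 1 - (1 / 2)^2, as [B] is at most t^p / 2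
   on the remainder [x']. Hence all coefficients and [x'] vanish. *)
pose d k := ((t `^ p) ^+ 2 - (s k `^ p) ^+ 2) * cmod (dot x (e k)) ^+ 2.
have d0 k : 0 <= d k.
  have [tk|kt] := leP t (s k); first by rewrite /d xJ// /cmod normr0 expr0n mulr0.
  rewrite mulr_ge0 ?sqr_ge0// subr_ge0 ler_pXn2r ?nnegrE ?powR_ge0//.
  by rewrite ge0_ler_powR ?nnegrE ?(ltW p0) ?(ltW t0) ?(ltW kt).
have dk0 k : d k = 0 -> dot x (e k) = 0.
  have [tk|kt] := leP t (s k); first by rewrite xJ.
  move/eqP; rewrite mulf_eq0 => /orP[|].
    rewrite subr_eq0 gt_eqF// ltr_pXn2r ?nnegrE ?powR_ge0//.
    by rewrite gt0_ltr_powR// nnegrE// ltW.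
  by rewrite sqrf_eq0 => /eqP/cmod_eq0.
move=> e1 e2.
have sumd : \sum_k d k + 3 / 4 * (t `^ p) ^+ 2 * nm x' ^+ 2 <= 0.
  have -> : \sum_k d k = (t `^ p) ^+ 2 * (\sum_k cmod (dot x (e k)) ^+ 2)
      - \sum_k (s k `^ p) ^+ 2 * cmod (dot x (e k)) ^+ 2.
    by rewrite mulr_sumr -sumrB; apply: eq_bigr => k _; rewrite -mulrBl.
  move: low2 hx2; rewrite e2 e1; lra.
have sd0 : 0 <= \sum_k d k by apply: sumr_ge0.
have sq0 : 0 <= 3 / 4 * (t `^ p) ^+ 2 * nm x' ^+ 2.
  by rewrite -mulrA mulr_ge0 ?divr_ge0// mulr_ge0 ?sqr_ge0.
have dsum0 : \sum_k d k = 0 by apply/eqP; rewrite eq_le sd0 andbT; lra.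
have x'0 : nm x' = 0.
  have : (t `^ p) ^+ 2 * nm x' ^+ 2 = 0 by lra.
  by move/eqP; rewrite mulf_eq0 !sqrf_eq0 gt_eqF//= => /eqP.
have all0 k : dot x (e k) = 0.
  by apply: dk0; have := psumr_eq0P (fun k _ => d0 k) dsum0; apply.
move: x0; rewrite -[x](subrK (proj_fam dot e x)) -/x' (nm_eq0 x'0) add0r.
by rewrite /proj_fam big1 ?eqxx// => k _; rewrite all0 scale0r.
Qed.

Lemma adjoint_abs_pow : adjoint dot B = B.
Proof. exact: (adjointE Hdot abs_pow_selfadjoint). Qed.

Let sv_set n := [set t : R | t = 0 \/ 0 <= t /\ exists (e : 'I_n.+1 -> H) (s : 'I_n.+1 -> R),
    [/\ forall j k, dot (e j) (e k) = (j == k)%:R, forall k, t <= s k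
      & forall k, adjoint dot B (B (e k)) = (s k ^+ 2)%:C%C *: e k]].

Lemma sv_has_sup : exists D, 0 <= D /\ forall n, has_sup (sv_set n) /\ ubound (sv_set n) D.
Proof.
have [D D0 hD] := abs_pow_bounded; exists D; split => // n.
have ub : ubound (sv_set n) D.
  move=> t [->//|[t0 [e [s [oe ts]]]]]; rewrite adjoint_abs_pow => he.
  have e1 := orthonormal_nm Hdot oe ord0.
  rewrite (le_trans (ts ord0))//.
  have s0 : 0 <= s ord0 by rewrite (le_trans t0).
  rewrite -(ler_pXn2r (n:=2)) ?nnegrE//.
  have <- : nm (B (e ord0)) ^+ 2 = s ord0 ^+ 2.
    rewrite (nm_sq_op Hdot abs_pow_selfadjoint) he dotZl (dotxx Hdot) e1.
    by rewrite ReZ /= expr1n mulr1.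
  rewrite ler_pXn2r ?nnegrE ?nm_ge0//.
  by have := hD (e ord0); rewrite e1 mulr1.
by split => //; split; [exists 0; left|exists D].
Qed.

Lemma singular_value_ge0 n : 0 <= singular_value dot B n.
Proof.
have [D [_ /(_ n)[ss _]]] := sv_has_sup.
by apply: (sup_ubound ss.2); left.
Qed.

Lemma singular_value_bounded : exists D, forall n, singular_value dot B n <= D.
Proof.
have [D [_ hD]] := sv_has_sup; exists D => n; have [ss ub] := hD n.
exact: (sup_le_ub ss.1 ub).
Qed.

(** Indices start at 0, so the value of index [n] is witnessed by [n.+1] eigenvectors. *)
Lemma singular_value_ge n t : 0 < t -> eigen_count dot T T' t n.+1 ->
  t `^ p <= singular_value dot B n.
Proof.
move=> t0 /(eigen_count_abs_pow _ t0) [e [s [oe ts he]]].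
have [D [_ /(_ n)[ss _]]] := sv_has_sup.
apply: (sup_ubound ss.2); right; split; first exact: powR_ge0.
by exists e, s; split => // k; rewrite adjoint_abs_pow.
Qed.

(** A singular value is defined as a supremum, approached from below by witnesses; the strict
    hypothesis leaves room for one of them above t^p. *)
Lemma singular_value_lt n t : 0 < t -> t `^ p < singular_value dot B n ->
  eigen_count dot T T' t n.+1.
Proof.
move=> t0 tn; have [D [_ /(_ n)[ss _]]] := sv_has_sup.
have tp0 : 0 < t `^ p by rewrite powR_gt0.
have d0 : 0 < singular_value dot B n - t `^ p by rewrite subr_gt0.
have [u + hu] := sup_adherent d0 ss.
have {}hu : t `^ p < u by move: hu; rewrite -/(singular_value dot B n) opprB addrC subrK.
move=> [u0|[u0 [e [s [oe ts he]]]]].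
  by move: hu; rewrite u0 ltNge ltW.
apply/(eigen_count_abs_pow _ t0); apply: (eigen_count_mono (ltW hu)).
by exists e, s; split => // k; rewrite -[RHS]he adjoint_abs_pow.
Qed.

End AbsPow.

(** * Direct sums and Dixmier traces *)

Section DirectSum.
Context (R : realType) (H : completeNormedModType R[i]).
Variable (dot : {dot H for Num.conj}).
Hypothesis Hdot : hilbert_inner_product dot.
Variables (N : nat) (S V : 'I_N -> H -> H).
Hypothesis S_linear : forall i c x y, S i (c *: x + y) = c *: S i x + S i y.
Hypothesis dot_S : forall x y, dot x y = \sum_i dot (S i x) (S i y).
Hypothesis S_V : forall i j y, S j (V i y) = if j == i then y else 0.

Lemma nm_sq_S x : nm x ^+ 2 = \sum_i nm (S i x) ^+ 2.
Proof.
apply: (@complexI R); rewrite -(dotxx Hdot) dot_S rmorph_sum /=.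
by apply: eq_bigr => i _; rewrite (dotxx Hdot).
Qed.

Lemma nm_S_le i x : nm (S i x) <= nm x.
Proof.
rewrite -(ler_pXn2r (n:=2)) ?nnegrE ?nm_ge0// [leRHS]nm_sq_S (bigD1 i)//= lerDl.
by apply: sumr_ge0 => j _; exact: sqr_ge0.
Qed.

(** [V i] is the adjoint of [S i], so a constraint on the component [S i x] is a constraint on [x]
    itself. *)
Lemma dot_V i x y : dot x (V i y) = dot (S i x) y.
Proof.
rewrite dot_S (bigD1 i)//= S_V eqxx big1 ?addr0// => j ji.
by rewrite S_V (negPf ji) dot0r.
Qed.

Lemma S_sum i (I : finType) (c : I -> R[i]) (e : I -> H) :
  S i (\sum_j c j *: e j) = \sum_j c j *: S i (e j).
Proof. exact: lin_sum. Qed.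

Section Compare.
Variables (T : H -> H) (T_ : 'I_N -> H -> H) (Y : seq H).
Hypothesis nm_T : forall x, (forall y, y \in Y -> dot x y = 0) ->
  nm (T x) ^+ 2 = \sum_i nm (T_ i (S i x)) ^+ 2.

(** [small_op] at one fixed level. A single level is what propagates from the cells to [K] in the
    induction on the depth of the cells. *)
Definition small_at (eps : R) (A : H -> H) := exists ys : seq H, forall x,
  (forall y, y \in ys -> dot x y = 0) -> nm (A x) <= eps * nm x.

Lemma small_at_direct_sum (eps : R) : 0 <= eps ->
  (forall i, small_at eps (T_ i)) -> small_at eps T.
Proof.
move=> eps0 /choice[ys hys].
exists (Y ++ flatten [seq [seq V i y | y <- ys i] | i : 'I_N]) => x hx.
have xY y : y \in Y -> dot x y = 0 by move=> yY; apply: hx; rewrite mem_cat yY.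
rewrite -(ler_pXn2r (n:=2)) ?nnegrE ?nm_ge0 ?mulr_ge0 ?nm_ge0//.
rewrite nm_T// exprMn nm_sq_S mulr_sumr; apply: ler_sum => i _.
rewrite -exprMn ler_pXn2r ?nnegrE ?nm_ge0 ?mulr_ge0 ?nm_ge0//.
apply: hys => y yi; rewrite -dot_V; apply: hx; rewrite mem_cat; apply/orP; right.
apply/flattenP; exists [seq V i y | y <- ys i]; last exact: map_f.
by apply: map_f; rewrite mem_enum.
Qed.

Variables (T' : H -> H) (T_' : 'I_N -> H -> H) (C : R) (C_ : 'I_N -> R).
Hypothesis TT' : adjoint_pair dot T T'.
Hypothesis T_T' : forall i, adjoint_pair dot (T_ i) (T_' i).
Hypothesis C0 : 0 <= C.
Hypothesis C_0 : forall i, 0 <= C_ i.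
Hypothesis hC : forall x, nm (T x) <= C * nm x.
Hypothesis hC_ : forall i x, nm (T_ i x) <= C_ i * nm x.
Hypothesis sT : small_op dot T.
Hypothesis sT_ : forall i, small_op dot (T_ i).

(** With more than the stated number of eigenvectors, some combination [x] is orthogonal to [Y] and
    has every [S i x] orthogonal to a maximal family of [T_ i]. There each [T_ i] is strictly below
    [t], whereas [T] is at least [t] on [x]. *)
Lemma eigen_count_split t n : 0 < t -> eigen_count dot T T' t n ->
  exists m : 'I_N -> nat, (forall i, eigen_count dot (T_ i) (T_' i) t (m i)) /\
    (n <= \sum_i m i + size Y)%N.
Proof.
move=> t0 [e [s [oe ts he]]].
have [m hm] := choice (fun i => eigen_threshold Hdot (T_T' i) (C_0 i) (hC_ i) (sT_ i) t0).
exists m; split; first by move=> i; have [f [sf [ef _]]] := hm i; exists f, sf.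
rewrite leqNgt; apply/negP => mn.
have exl i : exists l : seq H, size l = m i /\
    forall x, x != 0 -> (forall y, y \in l -> dot x y = 0) -> nm (T_ i x) < t * nm x.
  have [f [sf [ef hf]]] := hm i.
  exists [seq f k | k : 'I_(m i)]; split.
    by rewrite size_map -cardE card_ord.
  move=> x x0 xf; apply: hf => // k; apply: xf.
  by apply: map_f; rewrite mem_enum.
have [ys hys] := choice exl.
pose zs := Y ++ flatten [seq [seq V i y | y <- ys i] | i : 'I_N].
have [|c [x0 xz]] := exists_orthogonal_combination oe (ys := zs).
  rewrite card_ord size_cat size_flatten /shape -map_comp addnC.
  rewrite sumnE big_map big_enum /=; apply: leq_ltn_trans mn.
  rewrite leq_add2r; apply: leq_sum => i _ /=.
  by rewrite size_map (hys i).1.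
set x := \sum_j _ in x0 xz.
have xY y : y \in Y -> dot x y = 0 by move=> yY; apply: xz; rewrite mem_cat yY.
have low : t * nm x <= nm (T x).
  exact: (eigen_family_lower Hdot TT' c (ltW t0) (And3 oe ts he)).
have low2 : t ^+ 2 * nm x ^+ 2 <= nm (T x) ^+ 2.
  by rewrite -exprMn ler_pXn2r ?nnegrE ?mulr_ge0 ?nm_ge0 ?(ltW t0).
rewrite nm_T// nm_sq_S mulr_sumr in low2.
have Sy i y : y \in ys i -> dot (S i x) y = 0.
  move=> yi; rewrite -dot_V; apply: xz; rewrite mem_cat; apply/orP; right.
  apply/flattenP; exists [seq V i y | y <- ys i]; last exact: map_f.
  by apply: map_f; rewrite mem_enum.
have le i : nm (T_ i (S i x)) ^+ 2 <= t ^+ 2 * nm (S i x) ^+ 2.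
  have [->|n0] := eqVneq (S i x) 0.
    by rewrite (lin_0 (adjoint_pair_linear Hdot (T_T' i))) nm0 expr0n mulr0.
  rewrite -exprMn ler_pXn2r ?nnegrE ?nm_ge0 ?mulr_ge0 ?nm_ge0 ?(ltW t0)// ltW//.
  by apply: (hys i).2 => // y; exact: Sy.
(* The gaps are nonnegative and their sum is at most 0, so all of them vanish; strictness in
   [eigen_threshold] then leaves only zero components. *)
have eq i : t ^+ 2 * nm (S i x) ^+ 2 - nm (T_ i (S i x)) ^+ 2 = 0.
  have d0 j : 0 <= t ^+ 2 * nm (S j x) ^+ 2 - nm (T_ j (S j x)) ^+ 2.
    by rewrite subr_ge0.
  have s0 : \sum_j (t ^+ 2 * nm (S j x) ^+ 2 - nm (T_ j (S j x)) ^+ 2) = 0.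
    by apply/eqP; rewrite eq_le sumr_ge0// andbT sumrB subr_le0.
  exact: (psumr_eq0P (fun j _ => d0 j) s0).
have Sx0 i : S i x = 0.
  apply/eqP/negP => /negP n0.
  have := (hys i).2 _ n0 (Sy i).
  rewrite ltNge => /negP; apply.
  rewrite -(ler_pXn2r (n:=2)) ?nnegrE ?nm_ge0 ?mulr_ge0 ?nm_ge0 ?(ltW t0)//.
  by rewrite exprMn -subr_le0 eq.
move: x0; have -> : x = 0; last by rewrite eqxx.
apply/nm_eq0/eqP; rewrite -sqrf_eq0 nm_sq_S big1// => i _.
by rewrite Sx0 nm0 expr0n.
Qed.

(** The images under the [V i] of the families on the cells are jointly orthonormal. If they
    outnumber a maximal family of [T] together with [Y], a combination orthogonal to both has |T x|
    >= t |x|, computed cell by cell. *)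
Lemma eigen_count_join t (m : 'I_N -> nat) : 0 < t ->
  (forall i, eigen_count dot (T_ i) (T_' i) t (m i)) ->
  exists n, eigen_count dot T T' t n /\ (\sum_i m i <= n + size Y)%N.
Proof.
move=> t0 hm.
have [n [e [s [eig small]]]] := eigen_threshold Hdot TT' C0 hC sT t0.
exists n; split; first by exists e, s.
rewrite leqNgt; apply/negP => nm'.
have hf i : exists f : 'I_(m i) -> H, exists s, eigen_family dot (T_ i) (T_' i) t f s.
  exact: hm.
pose f i := projT1 (cid (hf i)).
have hf' i : exists s, eigen_family dot (T_ i) (T_' i) t (f i) s.
  exact: (projT2 (cid (hf i))).
have onf i : orthonormal dot (f i) by have [s' []] := hf' i.
pose g (u : {i : 'I_N & 'I_(m i)}) := V (tag u) (f (tag u) (tagged u)).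
have og : orthonormal dot g.
  move=> [i j] [i' j']; rewrite /g /= dot_V S_V.
  have [ii'|ii'] := eqVneq i' i.
    by subst i'; rewrite onf -tag_eqE /tag_eq /= eqxx /= tagged_asE.
  by rewrite dot0l -tag_eqE /tag_eq /= eq_sym (negPf ii').
have [|c [x0 xz]] := exists_orthogonal_combination og (ys := Y ++ [seq e k | k : 'I_n]).
  rewrite size_cat size_map -cardE card_ord addnC card_tagged.
  rewrite sumnE big_map big_enum /=; apply: leq_trans nm' _.
  by apply: leq_sum => i _; rewrite card_ord.
set x := \sum_j _ in x0 xz.
have xY y : y \in Y -> dot x y = 0 by move=> yY; apply: xz; rewrite mem_cat yY.
have xe k : dot x (e k) = 0.
  by apply: xz; rewrite mem_cat; apply/orP; right; apply: map_f; rewrite mem_enum.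
have := small x x0 xe; rewrite ltNge => /negP; apply.
rewrite -(ler_pXn2r (n:=2)) ?nnegrE ?nm_ge0 ?mulr_ge0 ?nm_ge0 ?(ltW t0)//.
rewrite exprMn nm_T// nm_sq_S mulr_sumr; apply: ler_sum => i _.
rewrite -exprMn ler_pXn2r ?nnegrE ?nm_ge0 ?mulr_ge0 ?nm_ge0 ?(ltW t0)//.
have [s' eigi] := hf' i.
(* [S i] kills the blocks of the other cells and undoes [V i] on its own, so the lower bound for
   eigenvectors of [T_ i] applies to [S i x]. *)
have -> : S i x = \sum_(j < m i) c (Tagged (fun i => 'I_(m i)) j) *: f i j.
  rewrite /x S_sum /g.
  rewrite (eq_bigr (fun u : {i : 'I_N & 'I_(m i)} =>
      c (Tagged (fun i => 'I_(m i)) (tagged u)) *: S i (V (tag u) (f (tag u) (tagged u))))); last by case.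
  rewrite -(sig_big_dep (fun=> true) (fun i j => true) (fun i' (j : 'I_(m i')) =>
      c (Tagged (fun i => 'I_(m i)) j) *: S i (V i' (f i' j)))) /=.
  rewrite (bigD1 i)//= [X in _ + X]big1 ?addr0.
    by apply: eq_bigr => j _; rewrite S_V eqxx.
  move=> j ji; rewrite big1// => k _.
  by rewrite S_V eq_sym (negPf ji) scaler0.
exact: (eigen_family_lower Hdot (T_T' i) _ (ltW t0) eigi).
Qed.

End Compare.
End DirectSum.

(** * Comparing sums through counting functions *)

Section SumComparison.
Context (R : realType).
Implicit Types (a b : seq R).

Lemma seq_max a : a != [::] -> exists2 x, x \in a & forall z, z \in a -> z <= x.
Proof.
elim: a => // x a IH _; have [->|a0] := eqVneq a [::].
  by exists x; rewrite ?mem_head// => z; rewrite inE => /eqP->.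
have [y ya hy] := IH a0.
have [xy|yx] := leP x y.
  by exists y; rewrite ?inE ?ya ?orbT// => z /orP[/eqP->|/hy].
exists x; rewrite ?mem_head// => z; rewrite inE => /orP[/eqP->//|/hy zy].
exact: le_trans zy (ltW yx).
Qed.

(** A finite layer-cake principle, proved by removing the largest entry of each list. The strict
    count on the left and the weak one on the right match what [singular_value_lt] and
    [singular_value_ge] provide. *)
Lemma sum_le_of_count a b : (forall y, y \in b -> 0 <= y) ->
  (forall t, 0 < t -> (count (fun x => t < x)%R a <= count (fun y => t <= y)%R b)%N) ->
  \sum_(x <- a) x <= \sum_(y <- b) y.
Proof.
have [n] := ubnP (size a); elim: n a b => // n IH a b; rewrite ltnS => an b0 hab.
have sb0 : 0 <= \sum_(y <- b) y by rewrite big_seq sumr_ge0.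
have [->|a0] := eqVneq a [::]; first by rewrite big_nil.
have [x xa hx] := seq_max a0.
have [x0|x0] := leP x 0.
  rewrite (le_trans _ sb0)// big_seq -oppr_ge0 -sumrN sumr_ge0// => z /hx zx.
  by rewrite oppr_ge0 (le_trans zx).
have bn : b != [::].
  (* The count at x / 2 is positive on the left, so [b] cannot be empty. *)
  apply/eqP => b00; have := hab (x / 2); rewrite b00 /= leqn0 => /(_ _)/eqP.
  move=> /(_ (divr_gt0 x0 (ltr0Sn _ 1))) c0.
  have : has (fun z => x / 2 < z) a by apply/hasP; exists x => //; lra.
  by rewrite has_count c0.
have [y yb hy] := seq_max bn.
have xy : x <= y.
  apply/ler_addgt0Pr => e e0; rewrite -lerBlDr.
  have [xe|xe] := leP (x - e) 0; first by rewrite (le_trans xe)// b0.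
  have := hab _ xe.
  have ha : (0 < count (fun z => x - e < z)%R a)%N.
    by rewrite -has_count; apply/hasP; exists x => //; lra.
  move=> /(leq_trans ha); rewrite -has_count => /hasP[z zb]; rewrite /= => h.
  by rewrite (le_trans h)// hy.
have pa := perm_to_rem xa; have pb := perm_to_rem yb.
rewrite (perm_big _ pa) (perm_big _ pb) !big_cons /= lerD// IH//.
- by rewrite size_rem// (leq_trans _ an)// -[in X in (_ < X)%N](prednK (n := size a)) // lt0n size_eq0.
- by move=> z /mem_rem; exact: b0.
(* Both removed maxima exceed [t] when [t < x], so each count drops by one; otherwise nothing in [a]
   exceeds [t]. *)
move=> t t0; have := hab t t0; rewrite (permP pa) (permP pb) /=.
have [tx|xt] := ltP t x.
  by rewrite (le_trans (ltW tx) xy) !add1n ltnS.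
move=> _; rewrite [leqLHS](_ : _ = 0%N)//; apply/eqP.
rewrite -leqn0 leqNgt -has_count; apply/hasP => -[z /mem_rem/hx zx].
by rewrite ltNge (le_trans zx).
Qed.

(** An excess of [k] in the counts is paid for by appending [k] copies of [D] on the right. They are
    counted at every relevant threshold because no entry on the left exceeds [D]. *)
Lemma sum_le_of_count_fin (I J : finType) (a : I -> R) (b : J -> R) (k : nat) (D : R) :
  0 <= D -> (forall j, 0 <= b j) ->
  (forall t, 0 < t -> (exists i, t < a i) ->
     t <= D /\ (#|[pred i | (t < a i)%R]| <= #|[pred j | (t <= b j)%R]| + k)%N) ->
  \sum_i a i <= \sum_j b j + k%:R * D.
Proof.
move=> D0 b0 hab.
have -> : \sum_i a i = \sum_(x <- [seq a i | i : I]) x by rewrite big_map big_enum.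
have -> : \sum_j b j + k%:R * D = \sum_(x <- [seq b j | j : J] ++ nseq k D) x.
  rewrite big_cat big_map big_enum /= big_nseq; congr (_ + _).
  by elim: k {hab} => [|k IH]; rewrite ?mul0r// iterS -IH -natr1 mulrDl mul1r addrC.
apply: sum_le_of_count.
  move=> y; rewrite mem_cat => /orP[/mapP[j _ ->]//|/nseqP[-> _]//].
move=> t t0; rewrite count_cat !count_map count_nseq.
have cE (L : finType) (p : pred L) : count p (Finite.enum L) = #|p|.
  by rewrite cardE /enum_mem size_filter; apply: eq_count.
rewrite !cE.
have [[i ti]|no] := pselect (exists i, t < a i).
  have [-> h] := hab t t0 (ex_intro _ i ti).
  by rewrite mul1n.
rewrite [X in (X <= _)%N](_ : _ = 0%N)//.
by apply: eq_card0 => i; apply/negP => ti; apply: no; exists i.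
Qed.

End SumComparison.

(** * Integrals of step functions and logarithmic means *)

Section StepIntegral.
Context (R : realType).
Local Notation leb := (@lebesgue_measure R).
Variables (s : nat -> R) (D : R).
Hypothesis s0D : forall n, 0 <= s n <= D.

Definition step_integral (t : R) := \int[leb]_(x in `[0, t]) s (Num.truncn x).

Let s0 n : 0 <= s n. Proof. by case/andP: (s0D n). Qed.
Let sD n : s n <= D. Proof. by case/andP: (s0D n). Qed.
Let D0 : 0 <= D. Proof. exact: le_trans (s0 0) (sD 0). Qed.

Lemma step_integralE (t : R) : 0 <= t -> step_integral t =
  \sum_(n < Num.truncn t) s n + (t - (Num.truncn t)%:R) * s (Num.truncn t).
Proof.
move=> t0; set M := Num.truncn t.
have /andP[Mt tM] : M%:R <= t < M.+1%:R := truncn_itv t0.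
pose A n : set R := `[n%:R, n.+1%:R[%classic.
have mA n : measurable (A n) by exact: measurable_itv.
have mD : measurable (`[0, t]%classic : set R) by exact: measurable_itv.
rewrite /step_integral /Rintegral.
have -> : (\int[leb]_(x in `[0%R, t]%classic) (s (Num.truncn x))%:E =
   \int[leb]_(x in `[0%R, t]%classic) (\sum_(n < M.+1) ((s n)%:E * (\1_(A n) x)%:E)))%E.
  apply: eq_integral => x; rewrite inE /= in_itv /= => /andP[x0 xt].
  have /andP[kx xk] := truncn_itv x0; set k := Num.truncn x in kx xk *.
  have kM : (k < M.+1)%N by rewrite ltnS; exact: le_truncn.
  rewrite (bigD1 (Ordinal kM))//= big1 ?adde0.
    by rewrite indicE mem_set ?mule1// /A /= in_itv /= kx xk.
  move=> n nk; rewrite indicE memNset ?mule0// /A /= in_itv /= => /andP[nx xn].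
  move: nk => /eqP; apply; apply/val_inj/eqP; rewrite /= eqn_leq.
  apply/andP; split; rewrite -ltnS -(ltr_nat R).
    exact: le_lt_trans nx xk.
  exact: le_lt_trans kx xn.
rewrite ge0_integral_sum//; last 2 first.
- move=> n; apply/measurable_EFinP; apply: measurable_funM => //.
  by apply: measurable_indic; exact: mA.
- by move=> n x _; rewrite -EFinM lee_fin mulr_ge0.
have int n : (\int[leb]_(x in `[0%R, t]%classic) ((s n)%:E * (\1_(A n) x)%:E) =
    (s n)%:E * leb (A n `&` `[0%R, t]%classic))%E.
  rewrite ge0_integralZl_EFin//; last by apply/measurable_EFinP; apply: measurable_indic; exact: mA.
  by rewrite (integral_indic leb mD (mA n)).
rewrite (eq_bigr (fun n : 'I_M.+1 => (s n)%:E * leb (A n `&` `[0%R, t]%classic))%E); last first.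
  by move=> n _; exact: int.
rewrite big_ord_recr /=.
have -> : A M `&` `[0%R, t]%classic = `[M%:R, t]%classic.
  apply/seteqP; split => x; rewrite /A /= !in_itv /=.
    by move=> [/andP[-> _] /andP[_ ->]].
  by move=> /andP[Mx xt]; rewrite Mx (le_lt_trans xt tM) xt (le_trans _ Mx).
rewrite (eq_bigr (fun n : 'I_M => (s n)%:E)); last first.
  move=> n _.
  have -> : A n `&` `[0%R, t]%classic = A n.
    apply/setIidl => x; rewrite /A /= !in_itv /= => /andP[nx xn].
    rewrite (le_trans _ nx)//= (le_trans (ltW xn))// (le_trans _ Mt)//.
    by rewrite ler_nat.
  rewrite /A lebesgue_measure_itv /= lte_fin ltr_nat ltnSn -EFinB -natr1.
  by rewrite addrAC subrr add0r mule1.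
rewrite sumEFin lebesgue_measure_itv /= lte_fin.
have -> : ((if (M%:R < t)%R then t%:E - M%:R%:E else 0) = (t - M%:R)%:E)%E.
  by case: ltP => //= tM'; rewrite (@le_anti _ _ t M%:R) ?subrr// tM' Mt.
by rewrite -EFinM -EFinD /= mulrC.
Qed.

Lemma step_integral_neg (t : R) : t < 0 -> step_integral t = 0.
Proof.
move=> t0; rewrite /step_integral set_itv_ge ?Rintegral_set0//.
by rewrite bnd_simp -ltNge.
Qed.

Lemma step_integral_bounds (t : R) :
  \sum_(n < Num.truncn t) s n <= step_integral t <= \sum_(n < Num.truncn t) s n + D.
Proof.
have [t0|t0] := ltP t 0.
  rewrite step_integral_neg//.
  have -> : Num.truncn t = 0%N by apply/eqP; rewrite eqn0Ngt truncn_gt0 -ltNge (lt_trans t0).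
  by rewrite big_ord0 lexx add0r.
have /andP[Mt tM] := truncn_itv t0.
rewrite step_integralE// lerDl mulr_ge0 ?subr_ge0//= lerD2l.
apply: (@le_trans _ _ (1 * D)); last by rewrite mul1r.
by rewrite ler_pM ?subr_ge0//; move: tM; rewrite -natr1; lra.
Qed.

Lemma step_integral_le (t : R) : 0 <= t -> step_integral t <= t * D.
Proof.
move=> t0; have /andP[Mt tM] := truncn_itv t0.
rewrite step_integralE//; set M := Num.truncn t in Mt *.
have -> : t * D = M%:R * D + (t - M%:R) * D by rewrite mulrBl addrC subrK.
rewrite lerD ?ler_wpM2l ?subr_ge0//.
apply: (@le_trans _ _ (\sum_(n < M) D)); first by apply: ler_sum.
by rewrite sumr_const card_ord mulr_natl.
Qed.

Lemma step_integral_ge0 t : 0 <= step_integral t.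
Proof.
by have /andP[h _] := step_integral_bounds t; rewrite (le_trans _ h)// sumr_ge0.
Qed.

Lemma step_integral_nondecreasing : {homo step_integral : t t' / t <= t'}.
Proof.
move=> t t' tt; have [t0|t0] := ltP t 0.
  by rewrite step_integral_neg// step_integral_ge0.
have t'0 : 0 <= t' by rewrite (le_trans t0).
have /andP[Mt tM] := truncn_itv t0.
have := le_truncn tt; rewrite leq_eqVlt => /orP[/eqP MM|MM].
  by rewrite !step_integralE// -MM lerD2l ler_wpM2r// lerD2r.
have /andP[h _] := step_integral_bounds t'; rewrite (le_trans _ h)//.
rewrite step_integralE//; apply: (@le_trans _ _ (\sum_(n < (Num.truncn t).+1) s n)).
  rewrite big_ord_recr /= lerD2l ler_piMl//.
  by move: tM; rewrite -natr1; lra.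
rewrite (big_ord_widen (Num.truncn t') s MM).
by rewrite [leRHS](bigID (fun i : 'I_(Num.truncn t') => (i < (Num.truncn t).+1)%N)) /= lerDl sumr_ge0.
Qed.

Definition log_bounded := exists C : R, \forall M \near \oo,
  \sum_(n < M) s n <= C * ln M%:R.

Definition dixmier_mean (t : R) := (ln (1 + t))^-1 * step_integral t.

Lemma dixmier_mean_measurable : measurable_fun (`]0, +oo[ : set R) dixmier_mean.
Proof.
apply: measurable_funM.
  apply: open_continuous_measurable_fun; first exact: interval_open.
  move=> t; rewrite inE /= in_itv /= andbT => t0.
  apply: cvgV; first by rewrite gt_eqF// ln_gt0//; lra.
  apply: continuous_comp; last by apply: continuous_ln; lra.
  by apply: cvgD; [exact: cvg_cst|exact: cvg_id].
apply: nondecreasing_measurable => //; exact: step_integral_nondecreasing.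
Qed.

(** Near t = 0 the mean is a quotient of two quantities tending to 0; this lower bound for the
    denominator keeps it bounded there. *)
Lemma ln1D_ge (t : R) : 0 <= t -> t / (1 + t) <= ln (1 + t).
Proof.
move=> t0; have t1 : 0 < 1 + t by lra.
have h : -1 < - (t / (1 + t)) by rewrite ltrN2 ltr_pdivrMr//; lra.
have := le_ln1Dx h.
have -> : 1 + - (t / (1 + t)) = (1 + t)^-1 by field; rewrite gt_eqF.
by rewrite lnV ?posrE// lerN2.
Qed.

Lemma dixmier_mean_bounded : log_bounded ->
  exists B, forall t, 0 < t -> 0 <= dixmier_mean t <= B.
Proof.
move=> [C [M0 _ hC]].
(* The logarithmic bound holds from [M0] on, and 2 makes ln M1 positive. Below [M1] the trivial
   bound t D is used; above it the incomplete last step, at most [D], is absorbed by the term D / ln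
   M1. *)
pose M1 := maxn M0 2.
have M12 : (2 <= M1)%N by rewrite leq_maxr.
exists (`|C| + D / ln M1%:R + D * (1 + M1%:R)) => t t0.
have l0 : 0 < ln (1 + t) by rewrite ln_gt0//; lra.
have lM : 0 < ln (M1%:R : R) by rewrite ln_gt0// ltr1n.
rewrite /dixmier_mean mulr_ge0 ?invr_ge0 ?(ltW l0) ?step_integral_ge0//= mulrC ler_pdivrMr//.
have [tM|Mt] := ltP t M1%:R.
  apply: (@le_trans _ _ (D * (1 + M1%:R) * ln (1 + t))); last first.
    by rewrite ler_wpM2r ?(ltW l0)// lerDr addr_ge0// divr_ge0 ?(ltW lM).
  rewrite (le_trans (step_integral_le (ltW t0)))// mulrC -mulrA ler_wpM2l//.
  have := ln1D_ge (ltW t0); rewrite ler_pdivrMr; last lra.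
  move=> h; rewrite (le_trans h)// mulrC ler_wpM2r ?(ltW l0)//; lra.
have /andP[_ h] := step_integral_bounds t; rewrite (le_trans h)//.
have Mt' : (M1 <= Num.truncn t)%N by rewrite truncn_ge_nat// ltW.
have /andP[kt _] := truncn_itv (ltW t0).
have k0 : 0 < (Num.truncn t)%:R :> R by rewrite ltr0n (leq_trans _ Mt')// (leq_trans _ M12).
have lk : ln (Num.truncn t)%:R <= ln (1 + t) by rewrite ler_ln ?posrE//; lra.
have lk0 : 0 <= ln (Num.truncn t)%:R :> R.
  by rewrite ln_ge0// ler1n (leq_trans _ Mt')// (leq_trans _ M12).
apply: (@le_trans _ _ ((`|C| + D / ln M1%:R) * ln (1 + t))); last first.
  by rewrite ler_wpM2r ?(ltW l0)// lerDl mulr_ge0// addr_ge0.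
rewrite mulrDl lerD//.
  rewrite (le_trans (hC (Num.truncn t) _))//=; first by rewrite (leq_trans _ Mt')// leq_maxl.
  rewrite (le_trans (y := `|C| * ln (Num.truncn t)%:R))//.
    by rewrite ler_wpM2r// ler_norm.
  by rewrite ler_wpM2l.
rewrite mulrAC -mulrA ler_peMr// ler_pdivlMr// mul1r ler_ln ?posrE//; last by lra.
  by lra.
by rewrite ltr0n (leq_trans _ M12).
Qed.

End StepIntegral.

(** * Dixmier functionals of logarithmic means *)

Section DixmierFunctional.
Context (R : realType).
Local Notation leb := (@lebesgue_measure R).
Variable omega : (R -> R) -> R.
Hypothesis om : dixmier_functional omega.

(** [Linfty] with a bound at every point, so that sums and dilations involve no null sets. *)
Definition bounded_measurable (f : R -> R) :=
  measurable_fun (`]0, +oo[ : set R) f /\ exists B, forall t, 0 < t -> `|f t| <= B.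

Lemma bounded_measurable_Linfty f : bounded_measurable f -> Linfty f.
Proof. by move=> [mf [B hB]]; split => //; exists B; apply: aeW. Qed.

Lemma bounded_measurable_lin c f g : bounded_measurable f -> bounded_measurable g ->
  bounded_measurable (fun t => c * f t + g t).
Proof.
move=> [mf [B hB]] [mg [B' hB']]; split.
  by apply: measurable_funD => //; apply: measurable_funM.
exists (`|c| * B + B') => t t0; rewrite (le_trans (ler_normD _ _))//.
by rewrite normrM lerD ?ler_wpM2l ?hB ?hB'.
Qed.

Lemma bounded_measurable0 : bounded_measurable (fun=> 0).
Proof. by split => //; exists 0 => t _; rewrite normr0. Qed.

Lemma bounded_measurable_sum (I : Type) (l : seq I) (f : I -> R -> R) :
  (forall i, bounded_measurable (f i)) ->
  bounded_measurable (fun t => \sum_(i <- l) f i t).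
Proof.
move=> hf; elim: l => [|i l IH].
  by under eq_fun do rewrite big_nil; exact: bounded_measurable0.
have -> : (fun t => \sum_(j <- i :: l) f j t) = (fun t => 1 * f i t + \sum_(j <- l) f j t).
  by apply/funext => t; rewrite big_cons mul1r.
exact: bounded_measurable_lin.
Qed.

Lemma bounded_measurable_dilation f c : 0 < c -> bounded_measurable f ->
  bounded_measurable (fun t => f (c * t)).
Proof.
move=> c0 [mf [B hB]]; split.
  rewrite (_ : (fun t => f (c * t)) = f \o (fun t => c * t))//.
  apply: (@measurable_comp _ _ _ R R R (`]0, +oo[%classic : set R) f
    (`]0, +oo[%classic : set R) (fun t => c * t)) => //.
  - move=> _ [t + <-]; rewrite /= !in_itv /= !andbT => t0; exact: mulr_gt0.
  - by apply: measurable_funM.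
by exists B => t t0; apply: hB; exact: mulr_gt0.
Qed.

Lemma omega_lin c f g : bounded_measurable f -> bounded_measurable g ->
  omega (fun t => c * f t + g t) = c * omega f + omega g.
Proof.
have [[_ lin _ _] _ _ _] := om.
by move=> /bounded_measurable_Linfty bf /bounded_measurable_Linfty bg; exact: lin.
Qed.

Lemma omega0 : omega (fun=> 0) = 0.
Proof.
have := omega_lin 1 bounded_measurable0 bounded_measurable0.
have -> : (fun t : R => 1 * 0 + 0 : R) = (fun=> 0) by apply/funext => t; rewrite mul1r addr0.
by rewrite mul1r; lra.
Qed.

Lemma omega_sum (I : Type) (l : seq I) (f : I -> R -> R) :
  (forall i, bounded_measurable (f i)) ->
  omega (fun t => \sum_(i <- l) f i t) = \sum_(i <- l) omega (f i).
Proof.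
move=> hf; elim: l => [|i l IH].
  by under eq_fun do rewrite big_nil; rewrite big_nil omega0.
have -> : (fun t => \sum_(j <- i :: l) f j t) = (fun t => 1 * f i t + \sum_(j <- l) f j t).
  by apply/funext => t; rewrite big_cons mul1r.
by rewrite omega_lin ?IH ?big_cons ?mul1r//; exact: bounded_measurable_sum.
Qed.

(** The bound of [omega] by the essential limit inferior makes it see only the behaviour at
    infinity, here of g - f. *)
Lemma omega_le f g : bounded_measurable f -> bounded_measurable g ->
  (forall e : R, 0 < e -> exists t0, forall t, t0 < t -> f t <= g t + e) ->
  omega f <= omega g.
Proof.
move=> bf bg h; have bh := bounded_measurable_lin (-1) bf bg.
have [_ ess _ _] := om.
have /andP[e1 _] := ess _ (bounded_measurable_Linfty bh).
apply/ler_addgt0Pr => e e0; rewrite -lerBlDl.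
have [t0 ht] := h e e0.
suff : ((- e)%:E <= (omega (fun t => -1 * f t + g t)%R)%:E)%E.
  by rewrite lee_fin omega_lin// mulN1r; lra.
apply: le_trans e1; apply: ereal_sup_ubound; exists t0; apply: aeW => t tt.
by rewrite lee_fin; have := ht t tt; lra.
Qed.

Section Sequences.
Variables (N : nat) (s : nat -> R) (s_ : 'I_N -> nat -> R) (D : R) (k : nat).
Hypothesis N0 : (0 < N)%N.
Hypothesis sD : forall n, 0 <= s n <= D.
Hypothesis s_D : forall i n, 0 <= s_ i n <= D.
Hypothesis le1 : forall M, \sum_(n < M) s n <= \sum_i \sum_(n < M) s_ i n + k%:R * D.
Hypothesis le2 : forall M, \sum_i \sum_(n < M) s_ i n <= \sum_(n < N * M) s n + k%:R * D.

Let D0 : 0 <= D.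
Proof. by have /andP[a b] := sD 0; exact: le_trans a b. Qed.

(** Constants are absorbed into multiples of ln M; the range starts at 2 because ln 1 = 0. *)
Lemma ln_nat_ge (K : R) : 0 <= K -> exists C : R, 0 <= C /\
  forall M : nat, (2 <= M)%N -> K <= C * ln M%:R.
Proof.
move=> K0; have l2 : 0 < ln 2 :> R by rewrite ln_gt0// ltr1n.
exists (K / ln 2); split; first by rewrite divr_ge0// ltW.
move=> M M2; rewrite mulrAC -mulrA ler_peMr// ler_pdivlMr// mul1r.
by rewrite ler_ln ?posrE ?ltr0n ?ler_nat// (leq_trans _ M2).
Qed.

(** As ln (N M) = ln N + ln M, taking N times as many terms preserves logarithmic growth. *)
Lemma log_bounded_sum : log_bounded s <-> forall i, log_bounded (s_ i).
Proof.
have kD : 0 <= k%:R * D by rewrite mulr_ge0.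
have [C1 [C10 hC1]] := ln_nat_ge kD.
split=> [[C [M0 _ hC]] i|/choice[C hC]].
  have N1 : 0 <= ln N%:R :> R by rewrite ln_ge0// ler1n.
  have [C2 [C20 hC2]] := ln_nat_ge N1.
  exists (`|C| * (C2 + 1) + C1); exists (maxn M0 2) => // M /=.
  rewrite geq_max => /andP[M0M M2].
  have Mp : (0 < M)%N by rewrite (leq_trans _ M2).
  have lM : 0 <= ln M%:R :> R by rewrite ln_ge0// ler1n.
  apply: (@le_trans _ _ (\sum_i \sum_(n < M) s_ i n)).
    rewrite (bigD1 i)//= lerDl sumr_ge0// => j _; rewrite sumr_ge0// => n _.
    by case/andP: (s_D j n).
  rewrite (le_trans (le2 M))// mulrDl lerD ?hC1//.
  apply: (@le_trans _ _ (C * ln (N * M)%:R)).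
    by apply: hC => /=; rewrite (leq_trans M0M)// leq_pmull.
  rewrite natrM lnM ?posrE ?ltr0n// (le_trans (y := `|C| * (ln N%:R + ln M%:R)))//.
    by rewrite ler_wpM2r ?addr_ge0// ler_norm.
  by rewrite -mulrA ler_wpM2l// mulrDl mul1r lerD ?hC2.
exists (\sum_i C i + C1).
have : \forall M \near \oo, forall i, \sum_(n < M) s_ i n <= C i * ln M%:R.
  exact: filter_forall.
move=> [M0 _ h]; exists (maxn M0 2) => // M /=; rewrite geq_max => /andP[M0M M2].
rewrite (le_trans (le1 M))// mulrDl lerD ?hC1// mulr_suml.
by apply: ler_sum => i _; exact: h.
Qed.

Lemma ln1D_unbounded (K : R) : exists t0, 0 < t0 /\ forall t, t0 < t -> K < ln (1 + t).
Proof.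
exists (expR `|K|); split; first exact: expR_gt0.
move=> t ht; rewrite (le_lt_trans (ler_norm K))// -[X in X < _]expRK.
have e0 := expR_gt0 `|K|.
by rewrite ltr_ln ?posrE//; lra.
Qed.

Lemma dixmier_mean_bm (u : nat -> R) : (forall n, 0 <= u n <= D) -> log_bounded u ->
  bounded_measurable (dixmier_mean u).
Proof.
move=> uD lu; split; first exact: dixmier_mean_measurable uD.
have [B hB] := dixmier_mean_bounded uD lu.
by exists B => t /hB/andP[t0 tB]; rewrite ger0_norm.
Qed.

Lemma omega_mean_sum : log_bounded s ->
  omega (dixmier_mean s) = \sum_i omega (dixmier_mean (s_ i)).
Proof.
move=> ls; have ls_ := log_bounded_sum.1 ls.
have bs := dixmier_mean_bm sD ls.
have bs_ i := dixmier_mean_bm (s_D i) (ls_ i).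
rewrite -omega_sum//.
have bsum := bounded_measurable_sum (index_enum 'I_N) bs_.
have N0' : 0 < N%:R :> R by rewrite ltr0n.
have N1' : 1 <= N%:R :> R by rewrite ler1n.
have kD : 0 <= k%:R * D by rewrite mulr_ge0.
apply/eqP; rewrite eq_le; apply/andP; split.
  apply: omega_le => // e e0.
  have [t0 [t00 ht0]] := ln1D_unbounded ((k%:R * D + D) / e).
  exists t0 => t tt; have l := ht0 t tt.
  have tp : 0 < t by lra.
  have l0 : 0 < ln (1 + t) by rewrite ln_gt0//; lra.
  rewrite /dixmier_mean -mulr_sumr -ler_pdivlMl ?invr_gt0// invrK mulrDr.
  rewrite mulVKf ?gt_eqF//.
  have /andP[_ h1] := step_integral_bounds sD t.
  rewrite (le_trans h1)//.
  have h2 := le1 (Num.truncn t).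
  have h3 : \sum_i \sum_(n < Num.truncn t) s_ i n <= \sum_i step_integral (s_ i) t.
    by apply: ler_sum => i _; have /andP[] := step_integral_bounds (s_D i) t.
  have h4 : k%:R * D + D <= ln (1 + t) * e by rewrite -ler_pdivrMr// ltW.
  lra.
(* [le2] compares M terms of each [s_ i] with N M terms of [s], so the mean of [s] is first dilated
   by [N]. *)
have <- : omega (fun t => dixmier_mean s (N%:R * t)) = omega (dixmier_mean s).
  have [_ _ dil _] := om; apply: dil => //; exact: bounded_measurable_Linfty.
apply: omega_le => //; first exact: bounded_measurable_dilation.
move=> e e0.
have [B hB] := dixmier_mean_bounded sD ls.
(* The three errors: the excess in [le2], the incomplete last steps of the N integrals, and the
   replacement of ln (1 + N t) by ln (1 + t), which costs at most ln N times the bound on the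
   mean. *)
pose K := k%:R * D + N%:R * D + `|B| * ln N%:R.
have [t0 [t00 ht0]] := ln1D_unbounded (K / e).
exists t0 => t tt; have l := ht0 t tt.
have tp : 0 < t by lra.
have Ntp : 0 < N%:R * t by rewrite mulr_gt0.
have l0 : 0 < ln (1 + t) by rewrite ln_gt0//; lra.
have lN0 : 0 < ln (1 + N%:R * t) by rewrite ln_gt0//; lra.
have lN1 : 0 <= ln N%:R :> R by rewrite ln_ge0.
have lN : ln (1 + N%:R * t) <= ln N%:R + ln (1 + t).
  rewrite -lnM ?posrE//; last lra.
  by rewrite ler_ln ?posrE ?mulr_gt0//; lra.
have /andP[m0 mB] := hB _ Ntp.
have hS : step_integral s (N%:R * t) = ln (1 + N%:R * t) * dixmier_mean s (N%:R * t).
  by rewrite /dixmier_mean mulVKf ?gt_eqF.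
rewrite {1}/dixmier_mean -mulr_sumr -ler_pdivlMl ?invr_gt0// invrK.
have h1 : \sum_i step_integral (s_ i) t <= \sum_i (\sum_(n < Num.truncn t) s_ i n + D).
  by apply: ler_sum => i _; have /andP[] := step_integral_bounds (s_D i) t.
rewrite big_split /= sumr_const card_ord -[D *+ N]mulr_natl in h1.
have h2 := le2 (Num.truncn t).
have /andP[h3 _] := step_integral_bounds sD (N%:R * t).
have h4 : \sum_(n < N * Num.truncn t) s n <= \sum_(n < Num.truncn (N%:R * t)) s n.
  have le : (N * Num.truncn t <= Num.truncn (N%:R * t))%N.
    rewrite truncn_ge_nat ?(ltW Ntp)// natrM ler_pM2l//.
    by have /andP[] := truncn_itv (ltW tp).
  rewrite (big_ord_widen _ s le).
  rewrite [leRHS](bigID (fun i : 'I_(Num.truncn (N%:R * t)) => (i < N * Num.truncn t)%N)) /=.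
  by rewrite lerDl sumr_ge0// => i _; case/andP: (sD i).
have h5 : ln (1 + N%:R * t) * dixmier_mean s (N%:R * t) <=
    ln (1 + t) * dixmier_mean s (N%:R * t) + `|B| * ln N%:R.
  apply: (@le_trans _ _ ((ln N%:R + ln (1 + t)) * dixmier_mean s (N%:R * t))).
    by rewrite ler_wpM2r.
  by rewrite mulrDl addrC lerD2l mulrC ler_wpM2r// (le_trans mB)// ler_norm.
have h6 : K <= ln (1 + t) * e by rewrite -ler_pdivrMr// ltW.
rewrite mulrDr; move: h6; rewrite /K; lra.
Qed.

End Sequences.
End DixmierFunctional.

(** * The trace of an operator close to a direct sum *)

Section TraceDirectSum.
Context (R : realType) (H : completeNormedModType R[i]).
Variable (dot : {dot H for Num.conj}).
Hypothesis Hdot : hilbert_inner_product dot.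

Lemma card_lt_ord (M k : nat) : #|[pred n : 'I_M | (n < k)%N]| = minn k M.
Proof.
have [kM|Mk] := leqP k M; rewrite -sum1_card.
  by rewrite (big_ord_narrow kM) sum1_card card_ord.
rewrite (eq_bigl xpredT) ?sum1_card ?card_ord// => n.
by rewrite inE (ltn_trans (ltn_ord n) Mk).
Qed.

Lemma card_pair_pred (I J : finType) (P : I -> J -> bool) :
  #|[pred x : I * J | P x.1 x.2]| = \sum_i #|[pred j | P i j]|.
Proof.
rewrite -sum1_card -(pair_big_dep xpredT P (fun _ _ => 1%N)) /=.
by apply: eq_bigr => i _; rewrite sum1_card.
Qed.

Lemma dixmier_trace_fin (omega : (R -> R) -> R) (B : H -> H) :
  dixmier_traceable dot B ->
  dixmier_trace dot omega B = (omega (dixmier_mean (singular_value dot B)))%:E.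
Proof. by rewrite /dixmier_trace; case: ifPn => // /asboolPn. Qed.

Lemma dixmier_trace_infty (omega : (R -> R) -> R) (B : H -> H) :
  ~ dixmier_traceable dot B -> dixmier_trace dot omega B = +oo%E.
Proof. by rewrite /dixmier_trace; case: ifPn => // /asboolP. Qed.

Section OneOperator.
Variables (T T' : H -> H) (C : R) (p : R).
Hypothesis TT' : adjoint_pair dot T T'.
Hypothesis C0 : 0 <= C.
Hypothesis hC : forall x, nm (T x) <= C * nm x.
Hypothesis sT : small_op dot T.
Hypothesis p0 : 0 < p.

Let s n := singular_value dot (abs_pow dot T p) n.

(** The largest index below [M] whose value exceeds [t] decides the count, so monotonicity of the
    singular values is not called for. The level t^(1/p) undoes the power in [abs_pow]. *)
Lemma card_gt_singular_value (M : nat) (t : R) : 0 < t ->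
  exists m, (#|[pred n : 'I_M | (t < s n)%R]| <= m)%N /\
    eigen_count dot T T' (t `^ p^-1) m.
Proof.
move=> t0; have [[n tn]|no] := pselect (exists n : 'I_M, t < s n); last first.
  exists 0%N; split; last by exists (fun=> 0), (fun=> 0); split => // -[].
  rewrite leqn0; apply/eqP/eq_card0 => n; apply/negP => tn; apply: no; by exists n.
have [m tm hm] : exists2 m : 'I_M, t < s m & forall n : 'I_M, t < s n -> (n <= m)%N.
  by case: (@arg_maxnP _ n (fun n : 'I_M => t < s n) (fun n => n : nat) tn) => m tm hm; exists m.
exists m.+1; split.
  rewrite (leq_trans (n := #|[pred n : 'I_M | (n < m.+1)%N]|))//.
    by apply: subset_leq_card; apply/fintype.subsetP => j; rewrite !inE ltnS; exact: hm.
  by rewrite card_lt_ord geq_minl.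
apply: (singular_value_lt Hdot TT' C0 hC sT p0); first by rewrite powR_gt0.
by rewrite -powRrM mulVf ?gt_eqF// powRr1// ltW.
Qed.

Lemma card_ge_singular_value (M m : nat) (t : R) : 0 < t ->
  eigen_count dot T T' (t `^ p^-1) m -> (minn m M <= #|[pred n : 'I_M | (t <= s n)%R]|)%N.
Proof.
move=> t0 hm; rewrite -card_lt_ord; apply: subset_leq_card; apply/fintype.subsetP => j.
rewrite !inE => jm.
have := singular_value_ge Hdot TT' C0 hC sT p0 (n := j) (powR_gt0 p^-1 t0) (eigen_count_le jm hm).
by rewrite -powRrM mulVf ?gt_eqF// powRr1// ltW.
Qed.

Lemma dixmier_traceableE :
  dixmier_traceable dot (abs_pow dot T p) <-> log_bounded s.
Proof.
by split=> [[_ //]|ls]; split => //; exact: (abs_pow_compact Hdot TT' C0 hC sT p0).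
Qed.

End OneOperator.

Variables (N : nat) (S V : 'I_N -> H -> H).
Hypothesis N0 : (0 < N)%N.
Hypothesis S_linear : forall i c x y, S i (c *: x + y) = c *: S i x + S i y.
Hypothesis dot_S : forall x y, dot x y = \sum_i dot (S i x) (S i y).
Hypothesis S_V : forall i j y, S j (V i y) = if j == i then y else 0.
Variables (T : H -> H) (T_ : 'I_N -> H -> H) (Y : seq H).
Hypothesis nm_T : forall x, (forall y, y \in Y -> dot x y = 0) ->
  nm (T x) ^+ 2 = \sum_i nm (T_ i (S i x)) ^+ 2.
Variables (T' : H -> H) (T_' : 'I_N -> H -> H) (C : R) (C_ : 'I_N -> R).
Hypothesis TT' : adjoint_pair dot T T'.
Hypothesis T_T' : forall i, adjoint_pair dot (T_ i) (T_' i).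
Hypothesis C0 : 0 <= C.
Hypothesis C_0 : forall i, 0 <= C_ i.
Hypothesis hC : forall x, nm (T x) <= C * nm x.
Hypothesis hC_ : forall i x, nm (T_ i x) <= C_ i * nm x.
Hypothesis sT : small_op dot T.
Hypothesis sT_ : forall i, small_op dot (T_ i).
Variables (p : R) (omega : (R -> R) -> R).
Hypothesis p0 : 0 < p.
Hypothesis om : dixmier_functional omega.

Let s n := singular_value dot (abs_pow dot T p) n.
Let s_ i n := singular_value dot (abs_pow dot (T_ i) p) n.

Lemma singular_values_common_bound :
  exists D : R, (forall n, 0 <= s n <= D) /\ (forall i n, 0 <= s_ i n <= D).
Proof.
have [D hD] := singular_value_bounded Hdot TT' C0 hC sT p0.
have [D_ hD_] := choice (fun i => singular_value_bounded Hdot (T_T' i) (C_0 i) (hC_ i) (sT_ i) p0).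
exists (`|D| + \sum_i `|D_ i|); split => [n|i n].
  rewrite (singular_value_ge0 Hdot TT' C0 hC sT p0)/=.
  by rewrite (le_trans (hD n))// (le_trans (ler_norm _))// lerDl sumr_ge0.
rewrite (singular_value_ge0 Hdot (T_T' i) (C_0 i) (hC_ i) (sT_ i) p0)/=.
rewrite (le_trans (hD_ i n))// (le_trans (ler_norm _))// (bigD1 i)//=.
by rewrite addrCA lerDl addr_ge0 ?sumr_ge0.
Qed.

Section Bound.
Variable D : R.
Hypothesis sD : forall n, 0 <= s n <= D.
Hypothesis s_D : forall i n, 0 <= s_ i n <= D.

Lemma singular_sum_le M :
  \sum_(n < M) s n <= \sum_i \sum_(n < M) s_ i n + (size Y)%:R * D.
Proof.
rewrite (pair_big xpredT xpredT (fun i (n : 'I_M) => s_ i n)) /=.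
apply: (@sum_le_of_count_fin R _ _ _ (fun x : 'I_N * 'I_M => s_ x.1 x.2)).
- by have /andP[a b] := sD 0; exact: le_trans b.
- by move=> j; case/andP: (s_D j.1 j.2).
move=> t t0 [n tn]; split; first by have /andP[_] := sD n; exact/le_trans/ltW.
have [m [hm em]] := card_gt_singular_value TT' C0 hC sT p0 M t0.
have [m_ [em_ mm]] := eigen_count_split Hdot dot_S S_V nm_T TT' T_T' C_0 hC_ sT_
  (powR_gt0 _ t0) em.
rewrite (card_pair_pred (fun i (n : 'I_M) => t <= s_ i n)).
have h i := card_ge_singular_value (T_T' i) (C_0 i) (hC_ i) (sT_ i) p0 M t0 (em_ i).
have hcM : (#|[pred n : 'I_M | (t < s n)%R]| <= M)%N by rewrite -[leqRHS]card_ord max_card.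
(* The left count is at most [M]. If one cell has [M] eigenvalues it suffices by itself; otherwise
   truncating at [M] loses nothing on any cell. *)
have [[i Mi]|allM] := pselect (exists i, (M <= m_ i)%N).
  rewrite (leq_trans hcM)// (bigD1 i)//= -addnA (leq_trans _ (leq_addr _ _))//.
  by have := h i; rewrite (minn_idPr Mi).
apply: leq_trans hm (leq_trans mm _); rewrite leq_add2r; apply: leq_sum => i _.
have := h i; rewrite (minn_idPl _)//.
by rewrite leqNgt; apply/negP => /ltnW Mm; apply: allM; exists i.
Qed.

Lemma singular_sum_ge M :
  \sum_i \sum_(n < M) s_ i n <= \sum_(n < N * M) s n + (size Y)%:R * D.
Proof.
rewrite (pair_big xpredT xpredT (fun i (n : 'I_M) => s_ i n)) /=.
apply: (@sum_le_of_count_fin R _ _ (fun x : 'I_N * 'I_M => s_ x.1 x.2)).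
- by have /andP[a b] := sD 0; exact: le_trans b.
- by move=> j; case/andP: (sD j).
move=> t t0 [x tx]; split; first by have /andP[_] := s_D x.1 x.2; exact/le_trans/ltW.
rewrite (card_pair_pred (fun i (n : 'I_M) => t < s_ i n)).
have [m hm] := choice (fun i => card_gt_singular_value (T_T' i) (C_0 i) (hC_ i) (sT_ i) p0 M t0).
have [n [en mn]] := eigen_count_join Hdot S_linear dot_S S_V nm_T TT' T_T' C0 hC sT
  (powR_gt0 _ t0) (fun i => (hm i).2).
have h := card_ge_singular_value TT' C0 hC sT p0 (N * M) t0 en.
have h1 : (\sum_i #|[pred j : 'I_M | (t < s_ i j)%R]| <= n + size Y)%N.
  by rewrite (leq_trans _ mn)//; apply: leq_sum => i _; exact: (hm i).1.
have h2 : (\sum_i #|[pred j : 'I_M | (t < s_ i j)%R]| <= N * M)%N.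
  rewrite (leq_trans (n := (\sum_(i < N) M)%N))//.
    by apply: leq_sum => i _; rewrite -[leqRHS]card_ord max_card.
  by rewrite sum_nat_const card_ord.
(* Truncation at N M is harmless, because at most N M values are counted on the left. *)
have [nM|Mn] := leqP n (N * M).
  by rewrite (leq_trans h1)// leq_add2r -{1}(minn_idPl nM).
rewrite (leq_trans h2)// (leq_trans _ (leq_addr _ _))//.
by rewrite -{1}(minn_idPr (ltnW Mn)).
Qed.

End Bound.

Lemma dixmier_trace_direct_sum :
  dixmier_trace dot omega (abs_pow dot T p) =
  (\sum_i dixmier_trace dot omega (abs_pow dot (T_ i) p))%E.
Proof.
have [D [sD s_D]] := singular_values_common_bound.
have lb := log_bounded_sum N0 sD s_D (singular_sum_le sD s_D) (singular_sum_ge sD s_D).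
have trE := dixmier_traceableE TT' C0 hC sT p0.
have tr_E i := dixmier_traceableE (T_T' i) (C_0 i) (hC_ i) (sT_ i) p0.
have [/[dup] tr /trE ls|nt] := pselect (dixmier_traceable dot (abs_pow dot T p)).
  rewrite dixmier_trace_fin//.
  have ls_ := lb.1 ls.
  rewrite (eq_bigr (fun i => (omega (dixmier_mean (s_ i)))%:E)); last first.
    by move=> i _; exact: (dixmier_trace_fin _ ((tr_E i).2 (ls_ i))).
  rewrite sumEFin; congr (_%:E).
  exact: (omega_mean_sum om N0 sD s_D (singular_sum_le sD s_D) (singular_sum_ge sD s_D) ls).
(* Failure of logarithmic growth passes to some cell. The extended sum is then +oo, since no term is
   -oo. *)
have [i ni] : exists i, ~ dixmier_traceable dot (abs_pow dot (T_ i) p).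
  apply/existsNP => h; apply: nt; apply: trE.2; apply: lb.2 => i.
  exact: ((tr_E i).1 (h i)).
rewrite dixmier_trace_infty//; apply/esym/eqP; rewrite esum_eqy.
  by apply/existsP; exists i; rewrite /= dixmier_trace_infty.
move=> j _; have [tr|ntr] := pselect (dixmier_traceable dot (abs_pow dot (T_ j) p)).
  by rewrite dixmier_trace_fin.
by rewrite dixmier_trace_infty.
Qed.

End TraceDirectSum.

(** * Self-similar structures *)

Section ShiftTopology.
Context (N : nat).
Implicit Types w : shift_space N.

Definition agree (m : nat) w w' := forall k, (k < m)%N -> w k = w' k.

Lemma shift_compact : compact [set: shift_space N].
Proof.
have fc (i : nat) : compact [set: discrete_topology 'I_N].
  by apply: finite_compact; exact: finite_finset.
have := tychonoff fc.
by congr (compact _); rewrite eqEsubset.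
Qed.

Lemma agree_nbhs m w : nbhs w [set w' | agree m w w'].
Proof.
elim: m => [|m IH]; first by apply: filterS filterT => w' _ [].
have h : nbhs w [set w' : shift_space N | w' m = w m].
  have := @proj_continuous nat (fun=> discrete_topology 'I_N) m w.
  by move=> /(_ [set w m]) h; apply: h; exact: discrete_set1.
apply: filterS (filterI IH h) => w' [/= h1 h2] k.
by rewrite ltnS leq_eqVlt => /orP[/eqP->//|]; exact: h1.
Qed.

Lemma nbhs_agree w (A : set (shift_space N)) : nbhs w A ->
  exists m, forall w', agree m w w' -> A w'.
Proof.
pose FF := filter_from [set: nat] (fun m => [set w' | agree m w w']).
have FFf : Filter FF.
  apply: filter_from_filter; first by exists 0%N.
  move=> i j _ _; exists (maxn i j) => // w' h; split=> k kk; apply: h.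
    by rewrite leq_max kk.
  by rewrite leq_max kk orbT.
have : FF --> w.
  apply/pointwise_cvgP => t A' hA'.
  exists t.+1 => // w' /(_ t (ltnSn t)) /= <-.
  exact: nbhs_singleton.
by move=> h /h[m _ hm]; exists m.
Qed.

End ShiftTopology.

(** * Cells, boundary points and gluing *)

Section Structure.
Context (R : realType) (K : pseudoPMetricType R) (N : nat).
Variables (F : 'I_N -> K -> K) (pi : shift_space N -> K).
Hypothesis Kss : self_similar_structure F pi.
Implicit Types w : shift_space N.

Let K_compact : compact [set: K]. Proof. by case: Kss => -[]. Qed.
Let K_haus : hausdorff_space K. Proof. by case: Kss => -[]. Qed.
Let F_cont i : continuous (F i). Proof. by case: Kss => _ _ /(_ i)[]. Qed.
Let F_inj i : injective (F i). Proof. by case: Kss => _ _ /(_ i)[]. Qed.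
Let pi_cont : continuous pi. Proof. by case: Kss => _ _ _ []. Qed.
Let F_pi i w : F i (pi w) = pi (push_word i w). Proof. by case: Kss. Qed.

Lemma pi_surj x : exists w, pi w = x.
Proof. by case: Kss => _ _ _ [_ s] _; have [w _ <-] := s x I; exists w. Qed.

Lemma push_shift w : push_word (w 0%N) (shift_word w) = w.
Proof. by apply/funext => -[]. Qed.

Lemma pi_shift w : pi w = F (w 0%N) (pi (shift_word w)).
Proof. by rewrite F_pi push_shift. Qed.

Lemma cell_cover x : exists i y, x = F i y.
Proof.
by have [w <-] := pi_surj x; exists (w 0%N), (pi (shift_word w)); rewrite pi_shift.
Qed.

(** Closed sets of words are compact, so their images in the Hausdorff space [K] are closed and [pi]
    is a quotient map. *)
Lemma quotient_continuous (T : topologicalType) (u : K -> T) :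
  continuous (u \o pi) -> continuous u.
Proof.
move=> /continuous_closedP cu; apply/continuous_closedP => A cA.
have -> : u @^-1` A = pi @` ((u \o pi) @^-1` A).
  apply/seteqP; split => [x ux|_ [w uw <-]//].
  by have [w wx] := pi_surj x; exists w => //=; rewrite wx.
apply: compact_closed => //; apply: continuous_compact.
  exact: continuous_subspaceT.
exact: subclosed_compact (cu A cA) (@shift_compact N) _.
Qed.

Lemma glue_continuous (T : topologicalType) (u : K -> T) :
  (forall i, continuous (u \o F i)) -> continuous u.
Proof.
move=> cu; apply/continuous_closedP => A cA.
have -> : u @^-1` A = \bigcup_(i in [set: 'I_N]) (F i @` ((u \o F i) @^-1` A)).
  apply/seteqP; split => [x ux|_ [i _ [y uy <-]]//].
  by have [i [y xy]] := cell_cover x; exists i => //; exists y => //=; rewrite -xy.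
apply: closed_bigcup; first exact: finite_finset.
move=> i _; apply: compact_closed => //; apply: continuous_compact.
  exact: continuous_subspaceT.
apply: subclosed_compact K_compact _ => //.
by have /continuous_closedP := cu i; exact.
Qed.

(** All the functions [a \o Fword w] with [w] of length [m] satisfy [P]; the recursion peels off the
    outermost map, as the gluing lemmas do. *)
Fixpoint on_cells (V : Type) (P : (K -> V) -> Prop) (m : nat) (a : K -> V) : Prop :=
  if m is m'.+1 then forall i, on_cells P m' (a \o F i) else P a.

(** Near each word finitely many letters determine the value up to eps / 2, and compactness of the
    shift space makes their number uniform. The distance is a parameter in order to serve real and
    complex values. *)
Lemma small_cells (V : Type) (dist : V -> V -> R) (a : K -> V) (eps : R) :
  (forall x y, dist x y = dist y x) ->
  (forall x y z, dist x z <= dist x y + dist y z) ->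
  (forall x (e : R), 0 < e -> \forall y \near x, dist (a x) (a y) <= e) ->
  0 < eps -> exists m, on_cells (fun b => forall x y, dist (b x) (b y) <= eps) m a.
Proof.
move=> sym tri ca eps0.
have e2 : 0 < eps / 2 by rewrite divr_gt0.
have loc w : exists m, forall w', agree m w w' -> dist (a (pi w)) (a (pi w')) <= eps / 2.
  apply: nbhs_agree; exact: (pi_cont (ca (pi w) _ e2)).
have := (compact_near_coveringP _).1 (@shift_compact N) nat \oo
  (fun m w => forall w', agree m w w' -> dist (a (pi w)) (a (pi w')) <= eps).
case.
  move=> w _; have [m hm] := loc w.
  exists ([set w' | agree m w w'], [set n | (m <= n)%N]); first split => /=.
  - exact: agree_nbhs.
  - by exists m.
  move=> [w1 n] [/= h1 h2] w2 h3.
  rewrite (le_trans (tri _ (a (pi w)) _))// [leRHS]splitr lerD//.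
    by rewrite sym; exact: hm.
  by apply: hm => k km; rewrite h1// h3// (leq_trans km).
move=> m _ /(_ m (leqnn m)) hm; exists m.
have {}hm w w' : agree m w w' -> dist (a (pi w)) (a (pi w')) <= eps by exact: hm.
elim: m a {ca loc} hm => [|m IH] a hm /=.
  move=> x y; have [w <-] := pi_surj x; have [w' <-] := pi_surj y; exact: hm.
move=> i; apply: IH => w w' ww'; rewrite /= !F_pi; apply: hm => -[//|k] /=.
exact: ww'.
Qed.

Local Notation V0 := (V0 F pi).
Local Notation V := (V F pi).

Lemma critical_shift w : critical_set F pi w -> post_critical_set F pi (shift_word w).
Proof. by move=> cw; exists 1%N => //; exists w. Qed.

Lemma post_critical_shift w :
  post_critical_set F pi w -> post_critical_set F pi (shift_word w).
Proof. by move=> [n n1 [w' cw' <-]]; exists n.+1 => //; exists w'. Qed.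

Lemma V0_cells x : V0 x -> exists i y, V0 y /\ x = F i y.
Proof.
move=> [w pw <-]; exists (w 0%N), (pi (shift_word w)); split; last exact: pi_shift.
by exists (shift_word w) => //; exact: post_critical_shift.
Qed.

(** A word of [x] preceded by the letter [i] is critical, and deleting that letter makes it
    post-critical. *)
Lemma cell_intersection i j x y : F i x = F j y -> i <> j -> V0 x.
Proof.
move=> xy ij; have [w wx] := pi_surj x.
exists w => //; have -> : w = shift_word (push_word i w) by [].
apply: critical_shift; exists i, j; split => //; split.
  by exists x; rewrite // -F_pi wx.
by exists y; rewrite // -F_pi wx.
Qed.

Lemma V_0 : V 0 = V0.
Proof.
apply/seteqP; split => [_ [w _ [y V0y <-]]|x V0x]; first by rewrite tuple0.
by exists [tuple] => //; exists x.
Qed.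

Section Glue.
Variables (T : Type) (u : 'I_N -> K -> T).
Hypothesis compat : forall i j x y, V0 x -> V0 y -> F i x = F j y -> u i x = u j y.

(** Distinct cells meet only in images of [V0], so agreement of the pieces has to be checked at
    boundary points alone. *)
Lemma glue_exists : exists v : K -> T, forall i x, v (F i x) = u i x.
Proof.
have h z : exists t, forall i x, z = F i x -> t = u i x.
  have [i [x zx]] := cell_cover z; exists (u i x) => j y zy.
  have xy : F i x = F j y by rewrite -zx.
  have [ij|ij] := pselect (i = j); first by move: xy; rewrite -ij => /F_inj->.
  apply: compat => //; first exact: cell_intersection xy ij.
  exact: (cell_intersection (esym xy) (nesym ij)).
by have [v hv] := choice h; exists v => i x; apply: hv.
Qed.

End Glue.
End Structure.

(** * The energy form *)

Lemma continuous_at_dist (R : realType) (T : topologicalType) (f : T -> R) x :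
  (forall e, 0 < e -> \forall y \near x, `|f x - f y| <= e) -> {for x, continuous f}.
Proof. by move=> h; apply/cvgrPdist_le => e; exact: h. Qed.

Section Energy.
Context (R : realType) (K : pseudoPMetricType R) (N : nat).
Variables (F : 'I_N -> K -> K) (pi : shift_space N -> K).
Hypothesis Kss : self_similar_structure F pi.
Hypothesis Kpcf : pcf F pi.
Variables (D : K -> K -> R) (r : 'I_N -> R).
Hypothesis Dr : harmonic_structure F pi D r.
Hypothesis reg : regular_structure r.

Local Notation V0 := (V0 F pi).
Local Notation V := (V F pi).
Local Notation eD := (energyD F pi D).
Local Notation em := (energy_m F pi D r).

Let D_lap : is_laplacian F pi D. Proof. by case: Dr. Qed.
Let r0 i : 0 < r i. Proof. by case: Dr. Qed.

Lemma V0_finite : finite_set V0.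
Proof. exact: finite_image. Qed.

Let v0 : seq K := finmap.enum_fset (fset_set V0).

Lemma mem_v0 p : (p \in v0) = (p \in V0).
Proof. by rewrite /v0 in_fset_set//; exact: V0_finite. Qed.

Lemma mem_v0P p : p \in v0 <-> V0 p.
Proof. by rewrite mem_v0 in_setE. Qed.

Lemma sum_V0 (f : K -> R) : \sum_(p \in V0) f p = \sum_(p <- v0) f p.
Proof. by rewrite fsbig_finite//; exact: V0_finite. Qed.

(** Zero row and column sums eliminate the diagonal of [D] and leave squares of increments with
    nonnegative weights. *)
Lemma energyD_sq (u : K -> R) : eD u =
  2^-1 * \sum_(p <- v0) \sum_(q <- v0) (- D p q) * (u p - u q) ^+ 2.
Proof.
have [sym _ col _ _] := D_lap.
have col0 q : q \in v0 -> \sum_(p <- v0) D p q = 0.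
  by rewrite mem_v0 => qV; rewrite -sum_V0; exact: col.
have row0 p : p \in v0 -> \sum_(q <- v0) D p q = 0.
  move=> pv; transitivity (\sum_(q <- v0) D q p); last exact: col0.
  rewrite big_seq [RHS]big_seq; apply: eq_bigr => q qv.
  by apply: sym; rewrite -mem_v0.
have e1 : \sum_(p <- v0) \sum_(q <- v0) D p q * u p ^+ 2 = 0.
  rewrite big_seq big1// => p pv.
  by rewrite -mulr_suml row0 ?mul0r.
have e2 : \sum_(p <- v0) \sum_(q <- v0) D p q * u q ^+ 2 = 0.
  rewrite exchange_big big_seq big1//= => q qv.
  by rewrite -mulr_suml col0 ?mul0r.
transitivity (\sum_(p <- v0) \sum_(q <- v0) D p q * u q * u p).
  rewrite /energyD sum_V0; apply: eq_bigr => p _.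
  by rewrite /laplacian sum_V0 mulr_suml.
transitivity (2^-1 * (2 * (\sum_(p <- v0) \sum_(q <- v0) D p q * u q * u p)
   - \sum_(p <- v0) \sum_(q <- v0) D p q * u p ^+ 2
   - \sum_(p <- v0) \sum_(q <- v0) D p q * u q ^+ 2)).
  by rewrite e1 e2 !subr0 mulKf// pnatr_eq0.
congr (_ * _); rewrite mulr_sumr -!sumrB; apply: eq_bigr => p _.
rewrite mulr_sumr -!sumrB; apply: eq_bigr => q _; ring.
Qed.

Lemma D_offdiag p q : p \in v0 -> q \in v0 -> p != q -> 0 <= - D p q.
Proof.
have [_ off _ _ _] := D_lap.
by rewrite !mem_v0 oppr_ge0 => pv qv pq; exact: off.
Qed.

Lemma energyD_ge0 u : 0 <= eD u.
Proof. by have [_ _ _ h _] := D_lap; exact: h. Qed.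

(** A comparison of increments becomes one of energies because the off-diagonal weights are
    nonnegative. Truncations, linear combinations and products are all instances. *)
Lemma energyD_le (a b : R) (w u v : K -> R) :
  (forall p q, V0 p -> V0 q ->
    (w p - w q) ^+ 2 <= a * (u p - u q) ^+ 2 + b * (v p - v q) ^+ 2) ->
  eD w <= a * eD u + b * eD v.
Proof.
move=> h; rewrite !energyD_sq mulrCA [b * _]mulrCA -mulrDr ler_wpM2l ?invr_ge0//.
rewrite !mulr_sumr -big_split /= big_seq [leRHS]big_seq; apply: ler_sum => p pv.
rewrite !mulr_sumr -big_split /= big_seq [leRHS]big_seq; apply: ler_sum => q qv.
have [->|pq] := eqVneq p q; first by rewrite !subrr expr0n !mulr0 addr0.
rewrite [a * _]mulrCA [b * _]mulrCA -mulrDr ler_wpM2l ?D_offdiag// h//; exact/mem_v0P.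
Qed.

Lemma energyD_ext u v : (forall p, V0 p -> u p = v p) -> eD u = eD v.
Proof.
move=> uv; rewrite !energyD_sq; congr (_ * _).
rewrite big_seq [RHS]big_seq; apply: eq_bigr => p /mem_v0P pv.
rewrite big_seq [RHS]big_seq; apply: eq_bigr => q /mem_v0P qv.
by rewrite !uv.
Qed.

Lemma energyD_osc_edge p q : V0 p -> V0 q -> D p q < 0 ->
  forall u, (u p - u q) ^+ 2 <= 2 / (- D p q) * eD u.
Proof.
move=> /mem_v0P pv /mem_v0P qv Dpq u.
have Dn : 0 < - D p q by rewrite oppr_gt0.
rewrite energyD_sq mulrAC mulrA mulfV ?pnatr_eq0// mul1r ler_pdivlMr// mulrC.
have unq : uniq v0 by exact: finmap.fset_uniq.
rewrite (bigD1_seq p)//= (bigD1_seq q)//= -addrA lerDl addr_ge0//.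
  rewrite big_seq_cond sumr_ge0// => q' /andP[q'v _].
  have [->|pq] := eqVneq p q'; first by rewrite subrr expr0n mulr0.
  by rewrite mulr_ge0 ?sqr_ge0 ?D_offdiag.
rewrite big_seq_cond sumr_ge0// => p' /andP[p'v _].
rewrite big_seq_cond sumr_ge0// => q' /andP[q'v _].
have [->|pq] := eqVneq p' q'; first by rewrite subrr expr0n mulr0.
by rewrite mulr_ge0 ?sqr_ge0 ?D_offdiag.
Qed.

(* The set of points reachable from p through negative entries of D has an
   indicator function in the kernel of D, so it is all of V0. *)
Lemma energyD_osc_pair p q : V0 p -> V0 q ->
  exists C : R, forall u, (u p - u q) ^+ 2 <= C * eD u.
Proof.
move=> pV qV; have [sym _ _ _ ker] := D_lap.
pose S := [set x | V0 x /\ exists C : R, forall u, (u p - u x) ^+ 2 <= C * eD u].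
pose ind : K -> R := fun x => if `[< S x >] then 1 else 0.
have Sp : S p.
  by split => //; exists 0 => u; rewrite subrr expr0n mul0r.
have edge x y : S x -> V0 y -> D x y < 0 -> S y.
  move=> [Vx [C hC]] Vy Dxy; split => //.
  exists (2 * C + 2 * (2 / (- D x y))) => u.
  have h1 := hC u; have h2 := energyD_osc_edge Vx Vy Dxy u.
  have h3 : (u p - u y) ^+ 2 <= 2 * (u p - u x) ^+ 2 + 2 * (u x - u y) ^+ 2.
    have := sqr_ge0 ((u p - u x) - (u x - u y)).
    have -> : u p - u y = (u p - u x) + (u x - u y) by rewrite addrA subrK.
    by move: (u p - u x) (u x - u y) => a b; rewrite !expr2; lra.
  rewrite mulrDl -!mulrA.
  by move: h1 h2 h3; rewrite -!mulrA; lra.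
have lap0 : {in V0, forall x, laplacian F pi D ind x = 0}.
  move=> x xV; rewrite /laplacian sum_V0.
  have [_ _ col _ _] := D_lap.
  have row0 : \sum_(y <- v0) D x y = 0.
    transitivity (\sum_(y <- v0) D y x); last by rewrite -sum_V0 col.
    rewrite big_seq [RHS]big_seq; apply: eq_bigr => y yv.
    by apply: sym => //; rewrite -mem_v0.
  have -> : \sum_(y <- v0) D x y * ind y = \sum_(y <- v0) D x y * ind x.
    rewrite big_seq [RHS]big_seq; apply: eq_bigr => y yv.
    have yV : V0 y by exact/mem_v0P.
    have xV' : V0 x by rewrite -in_setE.
    have [<-//|xy] := eqVneq x y.
    have Dxy : 0 <= - D x y by apply: D_offdiag => //; rewrite mem_v0.
    have [D0|Dn] := eqVneq (D x y) 0; first by rewrite D0 !mul0r.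
    have Dneg : D x y < 0 by rewrite lt_neqAle Dn -oppr_ge0.
    congr (_ * _); rewrite /ind; case: asboolP => Sy; case: asboolP => Sx //.
      case: Sx; apply: edge Sy xV' _.
      by rewrite -(sym x y)// in_setE.
    by case: Sy; exact: edge Sx yV Dneg.
  by rewrite -mulr_suml row0 mul0r.
have [c hc] := (ker ind).1 lap0.
have cp : c = 1 by rewrite -(hc p) ?in_setE// /ind asboolT.
have : ind q = 1 by rewrite hc ?in_setE.
by rewrite /ind; case: asboolP => [[_]//|_ /esym/eqP]; rewrite oner_eq0.
Qed.

Lemma energyD_osc : exists2 C : R, 0 <= C & forall u p q, V0 p -> V0 q ->
  (u p - u q) ^+ 2 <= C * eD u.
Proof.
have h (x : K * K) : exists C : R, x.1 \in v0 -> x.2 \in v0 ->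
    forall u, (u x.1 - u x.2) ^+ 2 <= C * eD u.
  have [xv|xv] := pselect (x.1 \in v0 /\ x.2 \in v0).
    have [C hC] := energyD_osc_pair ((mem_v0P _).1 xv.1) ((mem_v0P _).1 xv.2).
    by exists C.
  by exists 0 => x1 x2; case: xv.
have [C hC] := choice h.
exists (\sum_(p <- v0) \sum_(q <- v0) `|C (p, q)|).
  by rewrite sumr_ge0// => p _; rewrite sumr_ge0.
move=> u p q /mem_v0P pv /mem_v0P qv.
have unq : uniq v0 by exact: finmap.fset_uniq.
rewrite (le_trans (hC (p, q) pv qv u))// ler_wpM2r ?energyD_ge0//.
rewrite (le_trans (ler_norm _))//.
rewrite (bigD1_seq p)//= (bigD1_seq q)//= -addrA lerDl addr_ge0 ?sumr_ge0//.
by move=> p' _; rewrite sumr_ge0.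
Qed.

Lemma energy_0 u : em 0 u = eD u.
Proof.
rewrite /energy_m (big_pred1 [tuple]) ?big_nil ?invr1 ?mul1r//.
by move=> w; apply/esym/eqP; exact: tuple0.
Qed.

Lemma energy_succ m u : em m.+1 u = \sum_i (r i)^-1 * em m (u \o F i).
Proof.
rewrite /energy_m.
under [RHS]eq_bigr do rewrite mulr_sumr.
rewrite pair_bigA /=.
rewrite (reindex (fun x : 'I_N * m.-tuple 'I_N => [tuple of x.1 :: x.2])) /=.
  apply: eq_bigr => -[i w] _ /=; rewrite big_cons invfM mulrA.
  by congr (_ * _).
exists (fun w : m.+1.-tuple 'I_N => (thead w, [tuple of behead w])).
  by move=> [i w] _ /=; congr (_, _); apply: val_inj.
by move=> w _; rewrite [RHS]tuple_eta.
Qed.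

Lemma energy_ge0 m u : 0 <= em m u.
Proof.
elim: m u => [|m IH] u; first by rewrite energy_0 energyD_ge0.
by rewrite energy_succ sumr_ge0// => i _; rewrite mulr_ge0// invr_ge0 ltW.
Qed.

Lemma energy_le m (a b : R) (w u v : K -> R) :
  (forall x y, (w x - w y) ^+ 2 <= a * (u x - u y) ^+ 2 + b * (v x - v y) ^+ 2) ->
  em m w <= a * em m u + b * em m v.
Proof.
elim: m w u v => [|m IH] w u v h; first by rewrite !energy_0; apply: energyD_le.
rewrite !energy_succ !mulr_sumr -big_split /=; apply: ler_sum => i _.
rewrite [a * _]mulrCA [b * _]mulrCA -mulrDr ler_wpM2l ?invr_ge0 ?(ltW (r0 i))//.
by apply: IH => x y /=.
Qed.

Lemma energy_nondecreasing u : nondecreasing_seq (em^~ u).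
Proof.
apply/nondecreasing_seqP => m.
have [_ _ /(_ m u)[h _]] := Dr.
by apply: h.
Qed.

Lemma clip_contract (lo hi a b : R) :
  (Num.max lo (Num.min hi a) - Num.max lo (Num.min hi b)) ^+ 2 <= (a - b) ^+ 2.
Proof.
suff h : `|Num.max lo (Num.min hi a) - Num.max lo (Num.min hi b)| <= `|a - b|.
  by rewrite -(real_normK (num_real (a - b))) -[leLHS]real_normK ?num_real// ler_pXn2r ?nnegrE.
have hmax (c x y : R) : `|Num.max c x - Num.max c y| <= `|x - y|.
  have := ler_norm (x - y); have := ler_norm (y - x); rewrite (distrC y x) ler_norml.
  by case: (leP c x) => *; case: (leP c y) => *; lra.
apply: le_trans (hmax _ _ _) _.
have := ler_norm (a - b); have := ler_norm (b - a); rewrite (distrC b a) ler_norml.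
by case: (leP hi a) => *; case: (leP hi b) => *; lra.
Qed.

(** * Continuous harmonic extension *)

Section HarmonicExtension.
Hypothesis V0_neq0 : V0 !=set0.

Lemma seq_min (s : seq K) (u : K -> R) : s != [::] ->
  exists2 p, p \in s & forall q, q \in s -> u p <= u q.
Proof.
elim: s => // x s IH _; have [->|s0] := eqVneq s [::].
  by exists x; rewrite ?mem_head// => q; rewrite inE => /eqP->.
have [p ps hp] := IH s0.
have [xp|px] := leP (u x) (u p).
  exists x; rewrite ?mem_head// => q; rewrite inE => /orP[/eqP->//|/hp].
  exact: le_trans.
exists p; rewrite ?inE ?ps ?orbT// => q /orP[/eqP->|/hp//].
exact: ltW.
Qed.

Lemma V0_min (u : K -> R) : exists2 p, V0 p & forall q, V0 q -> u p <= u q.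
Proof.
have v0n : v0 != [::].
  by have [p /mem_v0P] := V0_neq0; case: v0.
have [p pv hp] := seq_min u v0n.
by exists p => [|q /mem_v0P]; [exact/mem_v0P|exact: hp].
Qed.

(** Clipping a minimizer to the range of [u] on [V0] keeps its boundary values and does not raise
    its energy. The maximum principle is thus built into the choice of a minimizer, without
    uniqueness. *)
Lemma one_step_extension u : exists v : K -> R,
  [/\ forall p, V0 p -> v p = u p, em 1 v = eD u
    & forall lo hi, (forall p, V0 p -> lo <= u p <= hi) -> forall x, lo <= v x <= hi].
Proof.
have [_ _ /(_ 0 u)[hmin [v vu hv]]] := Dr.
have vu' p : V0 p -> v p = u p by move=> Vp; apply: vu; rewrite in_setE V_0.
have [p1 V1 h1] := V0_min u; have [p2 V2 h2] := V0_min (fun x => - u x).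
pose w x := Num.max (u p1) (Num.min (u p2) (v x)).
have wu p : V0 p -> w p = u p.
  move=> Vp; have := h2 p Vp; rewrite lerN2 => h2p.
  by rewrite /w vu'// (min_idPr h2p) (max_idPr (h1 p Vp)).
exists w; split => //.
  have wl : em 1 w <= em 1 v.
    have := @energy_le 1 1 0 w v v; rewrite !mul1r !mul0r !addr0; apply => x y.
    by rewrite mul1r mul0r addr0 clip_contract.
  have ul : em 0 u <= em 1 w by apply: hmin => x; rewrite in_setE V_0; exact: wu.
  by apply/eqP; rewrite -energy_0 eq_le ul andbT -hv.
move=> lo hi hlh x; have /andP[a1 b1] := hlh _ V1; have /andP[a2 b2] := hlh _ V2.
by rewrite /w le_max a1 /= ge_max b1 /= ge_min b2.
Qed.

Let h u := projT1 (cid (one_step_extension u)).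
Let hE u : [/\ forall p, V0 p -> h u p = u p, em 1 (h u) = eD u
    & forall lo hi, (forall p, V0 p -> lo <= u p <= hi) -> forall x, lo <= h u x <= hi].
Proof. exact: projT2 (cid (one_step_extension u)). Qed.

(** The m-fold harmonic extension of [u], read on the cell addressed by the first [m] letters of
    [w]; only its values on [V0] are meaningful. *)
Fixpoint descend (m : nat) (w : shift_space N) (u : K -> R) : K -> R :=
  if m is m'.+1 then descend m' (shift_word w) (h u \o F (w 0%N)) else u.

Lemma descend_range m w u lo hi : (forall p, V0 p -> lo <= u p <= hi) ->
  forall p, V0 p -> lo <= descend m w u p <= hi.
Proof.
elim: m w u => //= m IH w u hu; apply: IH => p _ /=.
by have [_ _] := hE u; exact.
Qed.

Lemma descend_add m n w u :
  descend (m + n) w u = descend n (iter m (@shift_word N) w) (descend m w u).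
Proof. by elim: m w u => //= m IH w u; rewrite IH -iterSr. Qed.

Lemma descend_agree m w w' u : agree m w w' -> descend m w u = descend m w' u.
Proof.
elim: m w w' u => //= m IH w w' u ww'; rewrite (ww' 0%N)//.
by apply: IH => k km; exact: ww'.
Qed.

Lemma r_lt1 : exists2 rho : R, 0 <= rho < 1 & forall i, r i <= rho.
Proof.
have [N0|] := posnP N.
  by exists 0 => [|i]; [rewrite lexx ltr01|case: i => i iN; have := iN; rewrite {1}N0].
move=> N0; pose i0 := Ordinal N0.
have := @arg_maxP _ R _ i0 xpredT r isT; case: arg_maxP => // i _ hi _.
by exists (r i) => [|j]; [rewrite (ltW (r0 i)) reg|exact: hi].
Qed.

Lemma energyD_step i u : eD (h u \o F i) <= r i * eD u.
Proof.
have [_ e1 _] := hE u; rewrite -e1 energy_succ (bigD1 i)//= mulrDr.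
rewrite mulVKf ?gt_eqF// energy_0 lerDl mulr_ge0 ?(ltW (r0 i))// sumr_ge0// => j _.
by rewrite mulr_ge0 ?energy_ge0// invr_ge0 ltW.
Qed.

(** Each letter multiplies the energy by at most [r i], hence by at most some rho < 1, and the
    squared oscillation on [V0] is at most a constant times the energy. *)
Lemma descend_osc (e : R) u : 0 < e -> exists m, forall w p q, V0 p -> V0 q ->
  `|descend m w u p - descend m w u q| <= e.
Proof.
move=> e0; have [rho /andP[rho0 rho1] hr] := r_lt1.
have [C C0 hC] := energyD_osc.
have dec m w : eD (descend m w u) <= rho ^+ m * eD u.
  elim: m w u => [|m IH] w u' /=; first by rewrite expr0 mul1r.
  rewrite (le_trans (IH _ _))// exprSr -mulrA ler_wpM2l ?exprn_ge0//.
  rewrite (le_trans (energyD_step _ _))// ler_wpM2r ?energyD_ge0//.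
have [m hm] : exists m, rho ^+ m * (C * eD u) <= e ^+ 2.
  have : (fun m => rho ^+ m * (C * eD u)) @ \oo --> 0 * (C * eD u).
    by apply: cvgM; [apply: cvg_expr; rewrite ger0_norm|exact: cvg_cst].
  rewrite mul0r => /cvgrPdist_le/(_ (e ^+ 2)).
  rewrite exprn_gt0// => /(_ isT)[m _ /(_ m (leqnn m))].
  rewrite sub0r normrN => hm; exists m; exact: le_trans (ler_norm _) hm.
exists m => w p q Vp Vq.
rewrite -(ler_pXn2r (n:=2)) ?nnegrE ?(ltW e0)// real_normK ?num_real//.
rewrite (le_trans (hC _ _ _ Vp Vq))// (le_trans _ hm)// mulrCA ler_wpM2l//.
Qed.

(** The ranges of [descend m w u] on [V0] lie in nested intervals whose lengths tend to 0; the
    supremum of their lower bounds is the common point. *)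
Definition word_value u w : R :=
  sup [set x | exists m, forall p, V0 p -> x <= descend m w u p].

Lemma word_value_range m u w lo hi : (forall p, V0 p -> lo <= descend m w u p <= hi) ->
  lo <= word_value u w <= hi.
Proof.
move=> hlh; have ub : ubound [set x | exists m, forall p, V0 p -> x <= descend m w u p] hi.
  (* A lower bound found at depth [n] and the upper bound at depth [m] both persist to depth n + m,
     where they can be compared at one boundary point. *)
  move=> x [n hn]; have [p Vp] := V0_neq0.
  have rn y : (forall p, V0 p -> x <= descend n w u p <= y) ->
      forall p, V0 p -> x <= descend (n + m) w u p <= y.
    by move=> hy; rewrite descend_add; exact: descend_range.
  have rm : forall p, V0 p -> lo <= descend (m + n) w u p <= hi.
    by rewrite descend_add; exact: descend_range.
  have [p2 V2 h2] := V0_min (fun x => - descend n w u x).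
  have /andP[a _] := rn (descend n w u p2) (fun p Vp => ltac:(apply/andP; split; [exact: hn|by rewrite -lerN2 h2])) p Vp.
  by have /andP[_] := rm p Vp; rewrite addnC; exact: le_trans.
apply/andP; split.
  apply: ub_le_sup; first by exists hi.
  by exists m => p Vp; case/andP: (hlh p Vp).
by apply: sup_le_ub => //; exists lo, m => p Vp; case/andP: (hlh p Vp).
Qed.

Lemma word_value_near m u w (e : R) p :
  (forall p q, V0 p -> V0 q -> `|descend m w u p - descend m w u q| <= e) ->
  V0 p -> `|word_value u w - descend m w u p| <= e.
Proof.
move=> he Vp; rewrite ler_distl; apply: (word_value_range (m := m)) => q Vq.
by rewrite -ler_distl; exact: he.
Qed.

Lemma word_value_unique u w y :
  (forall m lo hi, (forall p, V0 p -> lo <= descend m w u p <= hi) -> lo <= y <= hi) ->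
  y = word_value u w.
Proof.
move=> hy; apply/eqP; rewrite -subr_eq0 -normr_eq0 eq_le normr_ge0 andbT.
apply/ler_addgt0Pr => e e0; rewrite add0r.
have e2 : 0 < e / 2 by rewrite divr_gt0.
have [m hm] := descend_osc u e2; have [p Vp] := V0_neq0.
have h1 := word_value_near (hm w) Vp.
have h2 : `|y - descend m w u p| <= e / 2.
  rewrite ler_distl; apply: (hy m) => q Vq; rewrite -ler_distl; exact: hm.
rewrite [y - _](_ : _ = (y - descend m w u p) - (word_value u w - descend m w u p)).
  by rewrite (le_trans (ler_normB _ _))//; lra.
by rewrite opprB addrA subrK.
Qed.

Lemma word_value_shift u w : word_value u w = word_value (h u \o F (w 0%N)) (shift_word w).
Proof.
apply/esym/word_value_unique => -[|m] lo hi hlh.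
  apply: (word_value_range (m := 0%N)) => p _ /=; have [_ _] := hE u; exact.
exact: (word_value_range (m := m)).
Qed.

(** Shifts of a post-critical word are post-critical, so the point is a boundary point of every cell
    on the way down, and [h] never changes boundary values. *)
Lemma word_value_V0 u w : post_critical_set F pi w -> word_value u w = u (pi w).
Proof.
move=> pw; apply/esym/word_value_unique => m lo hi hlh.
have [q Vq ->] : exists2 q, V0 q & u (pi w) = descend m w u q.
  elim: m w u pw {lo hi hlh} => [|m IH] w u pw /=; first by exists (pi w) => //; exists w.
  have [q Vq e] := IH (shift_word w) (h u \o F (w 0%N)) (post_critical_shift pw).
  exists q => //; rewrite -e /= -(pi_shift Kss); have [->//] := hE u.
  by exists w.
exact: hlh.
Qed.

(** Equal first letters are removed by injectivity of the [F i]. At the first difference both words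
    are critical, their shifts are post-critical, and both values equal the one-step extension at
    the common point. *)
Lemma word_value_pi u w w' : pi w = pi w' -> word_value u w = word_value u w'.
Proof.
move=> ww'; have [->//|wn] := pselect (w = w').
have [k hk] : exists k, w k <> w' k by apply/existsNP => e; apply: wn; apply/funext.
have val v v' : pi v = pi v' -> v 0%N <> v' 0%N -> forall u, word_value u v = h u (pi v).
  move=> vv ne u'; rewrite word_value_shift word_value_V0 /= -?(pi_shift Kss)//.
  apply: critical_shift; exists (v 0%N), (v' 0%N); split => //; split.
    by exists (pi (shift_word v)) => //; rewrite -(pi_shift Kss).
  by exists (pi (shift_word v')) => //; rewrite -(pi_shift Kss).
have F_inj i : injective (F i) by case: Kss => _ _ /(_ i)[].
elim: k w w' u ww' hk {wn} => [|k IH] w w' u ww' hk.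
  by rewrite (val w w')// (val w' w) ?ww'//; exact: nesym.
have [w0|w0] := pselect (w 0%N = w' 0%N).
  rewrite word_value_shift (word_value_shift u w') w0; apply: IH => //.
  by apply: (F_inj (w' 0%N)); rewrite -{1}w0 -!(pi_shift Kss).
by rewrite (val w w')// (val w' w) ?ww'//; exact: nesym.
Qed.

(** The value of any word of a point defines [U], continuous because [pi] is a quotient map. Its
    restriction to a cell is again of this form, [U] of [h u \o F i], so the energies stay constant
    by induction on the depth. *)
Lemma harmonic_extension_neq0 u : exists U : K -> R,
  [/\ continuous U, forall p, V0 p -> U p = u p,
      forall lo hi, (forall p, V0 p -> lo <= u p <= hi) -> forall x, lo <= U x <= hi
    & forall m, em m U = eD u].
Proof.
have [c hc] := choice (pi_surj Kss).
pose U u x := word_value u (c x).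
have Upi v w : U v (pi w) = word_value v w by apply: word_value_pi; rewrite hc.
have UV0 v p : V0 p -> U v p = v p by move=> [w pw <-]; rewrite Upi word_value_V0.
have UF v i : U v \o F i = U (h v \o F i).
  apply/funext => x /=; have [w <-] := pi_surj Kss x.
  have [_ _ _ _ Fpi] := Kss.
  by rewrite Fpi !Upi word_value_shift.
exists (U u); split => //.
- apply: (@quotient_continuous _ _ _ _ _ Kss R) => w.
  apply: continuous_at_dist => e e0 /=.
  have e2 : 0 < e / 2 by rewrite divr_gt0.
  have [m hm] := descend_osc u e2; have [p Vp] := V0_neq0.
  apply: filterS (agree_nbhs m w) => w' /= ww'.
  have h1 := word_value_near (hm w) Vp.
  have h2 := word_value_near (hm w') Vp.
  rewrite !Upi; rewrite -(descend_agree u ww') in h2.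
  rewrite [X in `|X|](_ : _ = (word_value u w - descend m w u p) - (word_value u w' - descend m w u p)).
    by rewrite (le_trans (ler_normB _ _))//; lra.
  by rewrite opprB addrA subrK.
- exact: UV0.
- by move=> lo hi hlh x; apply: (word_value_range (m := 0%N)).
- move=> m; elim: m u => [|m IH] v; first by rewrite energy_0; exact/energyD_ext/UV0.
  rewrite energy_succ; have [_ <- _] := hE v; rewrite energy_succ.
  by apply: eq_bigr => i _; rewrite UF IH energy_0.
Qed.

End HarmonicExtension.

Lemma harmonic_extension u lo hi : lo <= hi -> (forall p, V0 p -> lo <= u p <= hi) ->
  exists U : K -> R,
  [/\ continuous U, forall p, V0 p -> U p = u p, forall x, lo <= U x <= hi
    & forall m, em m U = eD u].
Proof.
(* Without boundary points there is no energy, and a constant in the given range will do. *)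
move=> lohi hlh; have [V00|/set0P V0n] := eqVneq V0 set0.
  have eD0 v : eD v = 0.
    by rewrite energyD_sq /v0 V00 fset_set0 finmap.big_seq_fset0 mulr0.
  exists (fun=> lo); split => //.
  - exact: cst_continuous.
  - by rewrite V00.
  - by rewrite lexx.
  - move=> m; rewrite eD0; elim: m => [|m IH]; first by rewrite energy_0 eD0.
    by rewrite energy_succ big1// => i _; rewrite -[_ \o _]/(fun=> lo) IH mulr0.
have [U [U1 U2 U3 U4]] := harmonic_extension_neq0 V0n u.
by exists U; split => //; exact: U3.
Qed.

Definition real_domain (u : K -> R) := continuous u /\ cvgn (em^~ u).

Local Notation lim_energy u := (limn (em^~ u)).

Lemma cvg_energyP u : cvgn (em^~ u) <-> exists B : R, forall m, em m u <= B.
Proof.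
split=> [cu|[B hB]].
  exists (lim_energy u) => m.
  exact: (nondecreasing_cvgn_le (@energy_nondecreasing u) cu m).
apply: nondecreasing_is_cvgn; first exact: energy_nondecreasing.
by exists B => _ [m _ <-].
Qed.

Lemma energy_le_lim u m : cvgn (em^~ u) -> em m u <= lim_energy u.
Proof.
by move=> cu; exact: (nondecreasing_cvgn_le (@energy_nondecreasing u) cu m).
Qed.

Lemma lim_energy_ge0 u : cvgn (em^~ u) -> 0 <= lim_energy u.
Proof. by move=> cu; rewrite (le_trans (energy_ge0 0 u))// energy_le_lim. Qed.

Lemma cvg_energy_cells u : cvgn (em^~ u) <-> forall i, cvgn (em^~ (u \o F i)).
Proof.
split=> [/cvg_energyP[B hB] i|hu].
  apply/cvg_energyP; exists (r i * B) => m.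
  have := hB m.+1; rewrite energy_succ (bigD1 i)//= => h.
  rewrite -ler_pdivrMl//; apply: le_trans h; rewrite lerDl sumr_ge0// => j _.
  by rewrite mulr_ge0 ?energy_ge0// invr_ge0 ltW.
have [B hB] := choice (fun i => (cvg_energyP _).1 (hu i)).
apply/cvg_energyP; exists (\sum_i (r i)^-1 * B i) => m.
apply: le_trans (energy_nondecreasing u (leqnSn m)) _.
rewrite energy_succ; apply: ler_sum => i _.
by rewrite ler_wpM2l ?invr_ge0 ?(ltW (r0 i)).
Qed.

Lemma lim_energy_cells u : cvgn (em^~ u) ->
  lim_energy u = \sum_i (r i)^-1 * lim_energy (u \o F i).
Proof.
move=> cu; have cui := (cvg_energy_cells u).1 cu.
apply: cvg_lim => //.
have : (fun m => em m.+1 u) @ \oo --> \sum_i (r i)^-1 * lim_energy (u \o F i).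
  have -> : (fun m => em m.+1 u) = (fun m => \sum_i (r i)^-1 * em m (u \o F i)).
    by apply/funext => m; rewrite energy_succ.
  apply: cvg_big => [|i _]; first exact: add_continuous.
  by apply: cvgM; [exact: cvg_cst|exact: cui].
by rewrite (cvg_shiftS (em^~ u)).
Qed.

Lemma real_domain_cells u : real_domain u <-> forall i, real_domain (u \o F i).
Proof.
split=> [[cu eu] i|hu].
  split; last exact: (cvg_energy_cells u).1.
  have F_cont : continuous (F i) by case: Kss => _ _ /(_ i)[].
  by move=> x; apply: continuous_comp; [exact: F_cont|exact: cu].
split; first by apply: (glue_continuous Kss) => i; case: (hu i).
by apply/cvg_energy_cells => i; case: (hu i).
Qed.

Lemma real_domain_comb (a b : R) (w u v : K -> R) : continuous w -> real_domain u ->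
  real_domain v -> 0 <= a -> 0 <= b ->
  (forall x y, (w x - w y) ^+ 2 <= a * (u x - u y) ^+ 2 + b * (v x - v y) ^+ 2) ->
  real_domain w.
Proof.
move=> cw [_ /cvg_energyP[B hB]] [_ /cvg_energyP[B' hB']] a0 b0 h; split => //.
apply/cvg_energyP; exists (a * B + b * B') => m.
by rewrite (le_trans (energy_le m h))// lerD// ler_wpM2l.
Qed.

Lemma real_domain_cst c : real_domain (fun=> c).
Proof.
split; first exact: cst_continuous.
apply/cvg_energyP; exists 0 => m.
have h := @energy_le m 0 0 (fun=> c) (fun=> c) (fun=> c).
rewrite !mul0r addr0 in h; apply: h => x y.
by rewrite subrr expr0n.
Qed.

Lemma real_domain_lin c u v : real_domain u -> real_domain v ->
  real_domain (fun x => c * u x + v x).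
Proof.
move=> du dv; apply: (@real_domain_comb (2 * c ^+ 2) 2 _ u v) => //.
- move=> x; apply: cvgD; last by case: dv => + _; apply.
  by apply: cvgM; [exact: cvg_cst|case: du => + _; apply].
- by rewrite mulr_ge0// sqr_ge0.
move=> x y; have := sqr_ge0 (c * (u x - u y) - (v x - v y)).
have -> : c * u x + v x - (c * u y + v y) = c * (u x - u y) + (v x - v y) by ring.
by move: (u x - u y) (v x - v y) => p q; rewrite !expr2; lra.
Qed.

Lemma continuous_bounded (u : K -> R) : continuous u ->
  exists2 A : R, 0 <= A & forall x, `|u x| <= A.
Proof.
move=> cu; have [[cK _] _ _ _ _] := Kss.
have : compact (u @` [set: K]).
  by apply: continuous_compact => //; exact: continuous_subspaceT.
move=> /compact_bounded[M [_ hM]].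
exists (`|M| + 1); first by rewrite addr_ge0.
move=> x; apply: (hM (`|M| + 1)); last by exists x.
by rewrite (le_lt_trans (ler_norm M))// ltrDl.
Qed.

Lemma real_domain_mul u v : real_domain u -> real_domain v ->
  real_domain (fun x => u x * v x).
Proof.
move=> du dv.
have [A A0 hA] := continuous_bounded du.1; have [B B0 hB] := continuous_bounded dv.1.
apply: (@real_domain_comb (2 * B ^+ 2) (2 * A ^+ 2) _ u v) => //.
- by move=> x; apply: cvgM; [apply: du.1|apply: dv.1].
- by rewrite mulr_ge0// sqr_ge0.
- by rewrite mulr_ge0// sqr_ge0.
move=> x y.
have -> : u x * v x - u y * v y = (u x - u y) * v x + u y * (v x - v y) by ring.
have h1 : ((u x - u y) * v x) ^+ 2 <= B ^+ 2 * (u x - u y) ^+ 2.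
  rewrite exprMn mulrC ler_wpM2r ?sqr_ge0// -(real_normK (num_real (v x))).
  by rewrite ler_pXn2r ?nnegrE.
have h2 : (u y * (v x - v y)) ^+ 2 <= A ^+ 2 * (v x - v y) ^+ 2.
  rewrite exprMn ler_wpM2r ?sqr_ge0// -(real_normK (num_real (u y))).
  by rewrite ler_pXn2r ?nnegrE.
have := sqr_ge0 ((u x - u y) * v x - u y * (v x - v y)).
move: h1 h2; move: ((u x - u y) * v x) (u y * (v x - v y)) => p q.
by rewrite !expr2; lra.
Qed.

Lemma real_domain_harmonic (u : K -> R) lo hi : lo <= hi ->
  (forall p, V0 p -> lo <= u p <= hi) ->
  exists U, [/\ real_domain U, forall p, V0 p -> U p = u p & forall x, lo <= U x <= hi].
Proof.
move=> lohi hu; have [U [U1 U2 U3 U4]] := harmonic_extension lohi hu.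
exists U; split => //; split => //.
by apply/cvg_energyP; exists (eD u) => m; rewrite U4.
Qed.

Lemma real_domain_interpolate (u : K -> R) :
  exists2 U, real_domain U & forall p, V0 p -> U p = u p.
Proof.
pose A := \sum_(p <- v0) `|u p|.
have A0 : 0 <= A by apply: sumr_ge0.
have [|p /mem_v0P pv|U [U1 U2 _]] := @real_domain_harmonic u (- A) A; [lra| |by exists U].
rewrite -ler_norml /A (bigD1_seq p) ?finmap.fset_uniq//= lerDl.
exact: sumr_ge0.
Qed.

(** Prescribing the boundary values through a single function [f] on [K] makes the pieces agree
    wherever cells meet. *)
Lemma real_domain_glue (u : 'I_N -> K -> R) (f : K -> R) :
  (forall i, real_domain (u i)) -> (forall i p, V0 p -> u i p = f (F i p)) ->
  exists2 v, real_domain v & forall i, v \o F i = u i.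
Proof.
move=> du uf.
have [v hv] : exists v : K -> R, forall i x, v (F i x) = u i x.
  by apply: (glue_exists Kss) => i j x y Vx Vy xy; rewrite !uf// xy.
have vF i : v \o F i = u i by apply/funext => x; rewrite /= hv.
by exists v => //; apply/real_domain_cells => i; rewrite vF.
Qed.

(** At depth 0 the harmonic function with the boundary values of [a] stays, like [a], within [e] of
    [a point]. Matching [a] on [V0] exactly is what lets the pieces be glued at the next depth. *)
Lemma real_domain_density_cells m (e : R) (a : K -> R) : 0 < e -> continuous a ->
  on_cells F (fun b => forall x y, `|b x - b y| <= e) m a ->
  exists v, [/\ real_domain v, forall p, V0 p -> v p = a p & forall x, `|v x - a x| <= 2 * e].
Proof.
move=> e0; elim: m a => [|m IH] a ca /= ha.
  have [||U [U1 U2 U3]] := @real_domain_harmonic a (a point - e) (a point + e); first by lra.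
    by move=> p _; rewrite -ler_distl.
  exists U; split => // x; have := U3 x; have := ha x point.
  rewrite ler_distl => /andP[h1 h2] /andP[h3 h4].
  by rewrite ler_distl; apply/andP; split; lra.
have IH' i : exists v, [/\ real_domain v, forall p, V0 p -> v p = a (F i p)
    & forall x, `|v x - a (F i x)| <= 2 * e].
  apply: (IH (a \o F i)) => // x; apply: continuous_comp; last exact: ca.
  by case: Kss => _ _ /(_ i)[+ _] _ _; apply.
have [v hv] := choice IH'.
have [w dw wF] := @real_domain_glue v a (fun i => let: And3 h _ _ := hv i in h)
  (fun i => let: And3 _ h _ := hv i in h).
exists w; split => // [p Vp|x].
  have [i [q [Vq ->]]] := V0_cells Kss Vp.
  by have [_ h _] := hv i; rewrite -h// -wF.
have [i [y ->]] := cell_cover Kss x.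
by have [_ _ h] := hv i; rewrite -[w _]/((w \o F i) y) wF.
Qed.

Lemma real_domain_dense (a : K -> R) (e : R) : continuous a -> 0 < e ->
  exists2 v, real_domain v & forall x, `|v x - a x| <= e.
Proof.
move=> ca e0; have e2 : 0 < e / 2 by rewrite divr_gt0.
have [||x d d0|m hm] := small_cells Kss (dist := fun x y => `|x - y|) (a := a) _ _ _ e2.
- exact: distrC.
- by move=> x y z; rewrite -[x - z](subrKA y) ler_normD.
- by have /cvgrPdist_le := ca x; apply.
have [v [dv _ hv]] := real_domain_density_cells e2 ca hm.
by exists v => // x; rewrite (le_trans (hv x))// mulrCA divff ?mulr1// pnatr_eq0.
Qed.

(** On the other cells any interpolant of the boundary values works; the auxiliary [f] carries [a]
    over to the chosen cell and is 0 elsewhere. *)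
Lemma real_domain_extend i (a : K -> R) : real_domain a ->
  exists2 u, real_domain u & u \o F i = a.
Proof.
move=> da; have [[cK hK] _ Fci _ _] := Kss.
have [f hf] : exists f : K -> R, forall y, f (F i y) = a y.
  have h z : exists t : R, forall y, z = F i y -> t = a y.
    have [[y zy]|no] := pselect (exists y, z = F i y).
      by exists (a y) => y' zy'; congr a; apply: (Fci i).2; rewrite -zy.
    by exists 0 => y zy; case: no; exists y.
  by have [f hf] := choice h; exists f => y; exact: hf.
have hU j : exists U, [/\ real_domain U, forall p, V0 p -> U p = f (F j p) & j = i -> U = a].
  have [->|ji] := pselect (j = i); first by exists a; split.
  by have [U dU hU] := real_domain_interpolate (f \o F j); exists U; split.
have [U h] := choice hU.
have [v dv vF] := @real_domain_glue U f (fun j => let: And3 h _ _ := h j in h)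
  (fun j => let: And3 _ h _ := h j in h).
by exists v => //; rewrite vF; have [_ _ ->] := h i.
Qed.

Lemma real_domain_extend0 i (a : K -> R) : real_domain a -> (forall p, V0 p -> a p = 0) ->
  exists2 u, real_domain u & forall j, u \o F j = if j == i then a else fun=> 0.
Proof.
move=> da a0.
apply: (@real_domain_glue (fun j => if j == i then a else fun=> 0) (fun=> 0)).
  by move=> j; case: ifP => // _; exact: real_domain_cst.
by move=> j p Vp; case: ifP => // _; exact: a0.
Qed.

(** [P] is twice the bilinear form at [u] and [v]; only its existence as the coefficient of [s]
    matters. *)
Lemma energy_polar m (u v : K -> R) : exists P : R, forall s,
  em m (fun x => u x + s * v x) = em m u + s * P + s ^+ 2 * em m v.
Proof.
elim: m u v => [|m IH] u v.
  exists (\sum_(p <- v0) \sum_(q <- v0) (- D p q) * ((u p - u q) * (v p - v q))) => s.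
  rewrite !energy_0 !energyD_sq.
  transitivity (2^-1 * (\sum_(p <- v0) \sum_(q <- v0) (- D p q) * (u p - u q) ^+ 2
     + s * 2 * \sum_(p <- v0) \sum_(q <- v0) (- D p q) * ((u p - u q) * (v p - v q))
     + s ^+ 2 * \sum_(p <- v0) \sum_(q <- v0) (- D p q) * (v p - v q) ^+ 2)).
    congr (_ * _); rewrite !mulr_sumr -!big_split /=; apply: eq_bigr => p _.
    rewrite !mulr_sumr -!big_split /=; apply: eq_bigr => q _; ring.
  by rewrite !mulrDr; congr (_ + _ + _); field.
have [P hP] := choice (fun i => IH (u \o F i) (v \o F i)).
exists (\sum_i (r i)^-1 * P i) => s.
rewrite !energy_succ !mulr_sumr -!big_split /=; apply: eq_bigr => i _.
rewrite -[(fun x => u x + s * v x) \o F i]/(fun x => (u \o F i) x + s * (v \o F i) x) hP.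
by ring.
Qed.

Lemma lim_energy_polar (u v : K -> R) : real_domain u -> real_domain v ->
  exists P : R, forall s,
  lim_energy (fun x => u x + s * v x) = lim_energy u + s * P + s ^+ 2 * lim_energy v.
Proof.
move=> du dv.
have ds s : real_domain (fun x => u x + s * v x).
  have -> : (fun x => u x + s * v x) = (fun x => s * v x + u x) by apply/funext => x; rewrite addrC.
  exact: real_domain_lin.
have [P hP] := choice (fun m => energy_polar m u v).
exists (lim_energy (fun x => u x + 1 * v x) - lim_energy u - lim_energy v) => s.
have cP : P @ \oo --> lim_energy (fun x => u x + 1 * v x) - lim_energy u - lim_energy v.
  have -> : P = (fun m => em m (fun x => u x + 1 * v x) - em m u - em m v).
    by apply/funext => m; rewrite hP; ring.
  by apply: cvgB; [apply: cvgB; [exact: (ds 1).2|exact: du.2]|exact: dv.2].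
apply: cvg_lim => //.
have -> : (em^~ (fun x => u x + s * v x)) = (fun m => em m u + s * P m + s ^+ 2 * em m v).
  by apply/funext => m; rewrite hP.
apply: cvgD; last by apply: cvgM; [exact: cvg_cst|exact: dv.2].
by apply: cvgD; [exact: du.2|apply: cvgM; [exact: cvg_cst|exact: cP]].
Qed.

Lemma energy_sup_bound m : exists2 L : R, 0 <= L &
  forall u c, (forall x, `|u x| <= c) -> em m u <= L * c ^+ 2.
Proof.
elim: m => [|m [L L0 hL]].
  exists (2^-1 * \sum_(p <- v0) \sum_(q <- v0) `|D p q| * 4).
    by rewrite mulr_ge0// sumr_ge0// => p _; rewrite sumr_ge0// => q _; rewrite mulr_ge0.
  move=> u c hu; rewrite energy_0 energyD_sq -mulrA ler_wpM2l// mulr_suml.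
  apply: ler_sum => p _; rewrite mulr_suml; apply: ler_sum => q _.
  rewrite (le_trans (y := `|D p q| * (u p - u q) ^+ 2))//.
    by rewrite ler_wpM2r ?sqr_ge0// -normrN ler_norm.
  rewrite -mulrA ler_wpM2l//.
  have /andP[a1 a2] : - c <= u p <= c by rewrite -ler_norml.
  have /andP[b1 b2] : - c <= u q <= c by rewrite -ler_norml.
  have -> : 4 * c ^+ 2 = (2 * c) ^+ 2 by ring.
  have c0 : 0 <= 2 * c by lra.
  by rewrite -(real_normK (num_real (_ - _))) ler_pXn2r ?nnegrE// ler_norml; apply/andP; split; lra.
exists (\sum_i (r i)^-1 * L).
  by rewrite sumr_ge0// => i _; rewrite mulr_ge0// invr_ge0 ltW.
move=> u c hu; rewrite energy_succ mulr_suml; apply: ler_sum => i _.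
by rewrite -mulrA ler_wpM2l ?invr_ge0 ?(ltW (r0 i))//; apply: hL => x /=.
Qed.

(* The form minus its m-th approximation is nonnegative, so it obeys the
   Cauchy-Schwarz inequality; the approximation itself is continuous for
   uniform convergence. *)
Lemma energy_weak_null (u : nat -> K -> R) (v : K -> R) (B : R) :
  (forall n, real_domain (u n)) -> real_domain v ->
  (forall n, lim_energy (u n) <= B) ->
  (forall e : R, 0 < e -> exists n0, forall n x, (n0 <= n)%N -> `|u n x| <= e) ->
  forall e : R, 0 < e -> exists n0, forall n, (n0 <= n)%N ->
    `|lim_energy (fun x => u n x + v x) - lim_energy (u n) - lim_energy v| <= e.
Proof.
move=> du dv uB u0 e e0.
have B0 : 0 <= B by rewrite (le_trans (lim_energy_ge0 (du 0%N).2)).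
(* Two quadratic inequalities will be evaluated at opposite points. At t and -t they give |P - Pm|
   <= B / t + t (E(v) - E_m(v)), and at s and -s they give |Pm| <= E_m(u_n) / s + s E_m(v). The
   choices of [t], [m], [s] and [c2] make each of the four terms at most e / 4. *)
pose t := 4 * (B + 1) / e.
have t0 : 0 < t by rewrite divr_gt0//; lra.
have tB : B <= t * (e / 4).
  have -> : t * (e / 4) = B + 1 by rewrite /t; field; rewrite gt_eqF.
  by lra.
have [m hm] : exists m, t * (lim_energy v - em m v) <= e / 4.
  have d0 : 0 < e / 4 / t by rewrite divr_gt0// divr_gt0.
  have /cvgrPdist_le/(_ _ d0)[m _ /(_ m (leqnn m)) hm] := dv.2.
  exists m; rewrite -ler_pdivlMl// mulrC; exact: le_trans (ler_norm _) hm.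
have [L L0 hL] := energy_sup_bound m.
have Ev0 := energy_ge0 m v.
pose s := e / 4 / (em m v + 1).
have s0 : 0 < s by rewrite divr_gt0 ?divr_gt0// ltr_wpDl.
have sv : s * em m v <= e / 4.
  rewrite /s mulrAC -mulrA ler_piMr ?divr_ge0 ?(ltW e0)// ler_pdivrMr ?ltr_wpDl//.
  by rewrite mul1r lerDl.
pose c2 := s * (e / 4) / (L + 1).
have c20 : 0 < c2 by rewrite divr_gt0 ?ltr_wpDl// mulr_gt0// divr_gt0.
have [n0 hn0] := u0 (Num.sqrt c2) (ltac:(by rewrite sqrtr_gt0)).
exists n0 => n n0n.
have [P hP] := lim_energy_polar (du n) dv.
have [Pm hPm] := energy_polar m (u n) v.
have un_v : (fun x => u n x + v x) = (fun x => u n x + 1 * v x).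
  by apply/funext => x; rewrite mul1r.
rewrite un_v hP.
have -> : lim_energy (u n) + 1 * P + 1 ^+ 2 * lim_energy v - lim_energy (u n) - lim_energy v = P by ring.
have ds z : real_domain (fun x => u n x + z * v x).
  have -> : (fun x => u n x + z * v x) = (fun x => z * v x + u n x) by apply/funext => x; rewrite addrC.
  exact: real_domain_lin.
have cs z : em m (u n) + z * Pm + z ^+ 2 * em m v <= lim_energy (u n) + z * P + z ^+ 2 * lim_energy v.
  by rewrite -hPm -hP; exact: energy_le_lim (ds z).2.
have un0 := energy_ge0 m (u n).
have unB := uB n.
have dP : `|P - Pm| <= e / 2.
  have h1 := cs t; have h2 := cs (- t); rewrite sqrrN in h2.
  have h3 : t * (t * (lim_energy v - em m v)) <= t * (e / 4) by rewrite ler_wpM2l// ltW.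
  have h4 : t * (P - Pm) <= t * (e / 2) by move: h2 h3 tB; rewrite !expr2; lra.
  have h5 : t * (Pm - P) <= t * (e / 2) by move: h1 h3 tB; rewrite !expr2; lra.
  rewrite ler_pM2l// in h4; rewrite ler_pM2l// in h5.
  by rewrite ler_norml; apply/andP; split; lra.
have unc : em m (u n) <= s * (e / 4).
  rewrite (le_trans (hL _ (Num.sqrt c2) (fun x => hn0 n x n0n)))// sqr_sqrtr ?(ltW c20)//.
  have q0 : 0 <= s * (e / 4) by rewrite mulr_ge0// ?(ltW s0)// divr_ge0// ltW.
  rewrite /c2 mulrCA ler_piMr//.
  by rewrite ler_pdivrMr ?ltr_wpDl// mul1r lerDl.
have dPm : `|Pm| <= e / 2.
  have pos z : 0 <= em m (u n) + z * Pm + z ^+ 2 * em m v by rewrite -hPm energy_ge0.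
  have h1 := pos s; have h2 := pos (- s); rewrite sqrrN in h2.
  have h3 : s * (s * em m v) <= s * (e / 4) by rewrite ler_wpM2l// ltW.
  have h4 : s * Pm <= s * (e / 2) by move: h2 h3 unc; rewrite !expr2; lra.
  have h5 : s * (- Pm) <= s * (e / 2) by move: h1 h3 unc; rewrite !expr2; lra.
  rewrite ler_pM2l// in h4; rewrite ler_pM2l// in h5.
  by rewrite ler_norml; apply/andP; split; lra.
by rewrite -[P](subrK Pm) (le_trans (ler_normD _ _))//; lra.
Qed.

End Energy.

(** * The complex form domain *)

Section ComplexFunctions.
Context (R : realType) (K : pseudoPMetricType R).
Local Notation C := R[i].
Implicit Types (a b : K -> C).

Definition ii : C := Complex 0 1.

Lemma complexRI (z : C) : z = (complex.Re z)%:C%C + ii * (complex.Im z)%:C%C.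
Proof. by case: z => x y; apply/eqP; rewrite eq_complex /=; apply/andP; split; apply/eqP; ring. Qed.

Lemma CK_near a : CK a -> forall x (e : R), 0 < e -> \forall y \near x, cmod (a x - a y) <= e.
Proof.
move=> ca x e e0; have e0' : 0 < e%:C%C :> C by rewrite ltcR.
have /cvgrPdist_le/(_ _ e0') := ca x.
by apply: filterS => y; rewrite -[`|_|]cmodE lecR.
Qed.

Lemma CKP a : CK a <-> continuous (fun x => complex.Re (a x)) /\
  continuous (fun x => complex.Im (a x)).
Proof.
split=> [ca|[cr ci] x].
  split=> x; apply: continuous_at_dist => e /(CK_near ca x); apply: filterS => y.
    by apply: le_trans; rewrite -ReB Re_abs_le_cmod.
  by apply: le_trans; rewrite -ImB Im_le_cmod.
apply/cvgrPdist_le => e e0.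
have [d0 ed] : 0 < complex.Re e /\ e = (complex.Re e)%:C%C.
  move: e0; rewrite ltcE; case: (e) => p q /= /andP[/eqP -> p0].
  by split.
rewrite ed; move: (complex.Re e) d0 => d d0 {e e0 ed}.
have d2 : 0 < d / 2 by rewrite divr_gt0.
have /cvgrPdist_le/(_ _ d2) h1 := cr x; have /cvgrPdist_le/(_ _ d2) h2 := ci x.
apply: filterS2 h1 h2 => y h1 h2.
rewrite -[`|_|]cmodE lecR (le_trans (cmod_le_ReIm _))//.
by rewrite ReB ImB [leRHS](splitr d) lerD.
Qed.

Lemma CK_real (u : K -> R) : continuous u -> CK (fun x => (u x)%:C%C).
Proof. by move=> cu; apply/CKP; split => //=; exact: cst_continuous. Qed.

Lemma CK_cst (c : C) : CK (fun _ : K => c).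
Proof. by apply/CKP; split; exact: cst_continuous. Qed.

Lemma CKD a b : CK a -> CK b -> CK (fun x => a x + b x).
Proof. by move=> ca cb x; apply: cvgD; [exact: ca|exact: cb]. Qed.

Lemma CKM a b : CK a -> CK b -> CK (fun x => a x * b x).
Proof. by move=> ca cb x; apply: cvgM; [exact: ca|exact: cb]. Qed.

Lemma CKJ a : CK a -> CK (conj_fun a).
Proof.
move=> /CKP[cr ci]; apply/CKP; split.
  by under [X in continuous X]eq_fun do rewrite ReJ.
by under [X in continuous X]eq_fun do rewrite ImJ; move=> x; apply: cvgN; exact: ci.
Qed.

Lemma CK_comp a (f : K -> K) : continuous f -> CK a -> CK (a \o f).
Proof. by move=> cf ca x; apply: continuous_comp; [exact: cf|exact: ca]. Qed.

End ComplexFunctions.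

Section ComplexDomain.
Context (R : realType) (K : pseudoPMetricType R) (N : nat).
Variables (F : 'I_N -> K -> K) (pi : shift_space N -> K).
Hypothesis Kss : self_similar_structure F pi.
Hypothesis Kpcf : pcf F pi.
Variables (D : K -> K -> R) (r : 'I_N -> R).
Hypothesis Dr : harmonic_structure F pi D r.
Hypothesis reg : regular_structure r.
Local Notation C := R[i].
Local Notation rd := (real_domain F pi D r).
Local Notation FD := (form_domain F pi D r).
Local Notation lim_energy u := (limn (energy_m F pi D r ^~ u)).
Implicit Types (a b : K -> C).

Lemma CK_bounded a : CK a -> exists2 M : R, 0 <= M & forall x, cmod (a x) <= M.
Proof.
move=> /CKP[/(continuous_bounded Kss)[A A0 hA] /(continuous_bounded Kss)[B B0 hB]].
exists (A + B); first exact: addr_ge0.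
by move=> x; rewrite (le_trans (cmod_le_ReIm _))// lerD.
Qed.

Lemma form_domainP a : FD a <-> rd (fun x => complex.Re (a x)) /\ rd (fun x => complex.Im (a x)).
Proof.
split=> [[/CKP[cr ci] er ei]//|[[cr er] [ci ei]]].
by split => //; apply/CKP.
Qed.

Lemma form_domain_CK a : FD a -> CK a. Proof. by case. Qed.

Lemma form_domain_real u : rd u -> FD (fun x => (u x)%:C%C).
Proof.
by move=> du; apply/form_domainP; split => //=; exact: (real_domain_cst Kpcf Dr).
Qed.

Lemma form_domain_lin c a b : FD a -> FD b -> FD (fun x => c * a x + b x).
Proof.
move=> /form_domainP[ar ai] /form_domainP[br bi]; apply/form_domainP.
split.
  have -> : (fun x => complex.Re (c * a x + b x)) = (fun x => complex.Re c * complex.Re (a x) +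
      (- complex.Im c * complex.Im (a x) + complex.Re (b x))).
    by apply/funext => x; case: c (a x) (b x) => ? ? [? ?] [? ?] /=; ring.
  by apply: (real_domain_lin Kpcf Dr) => //; exact: (real_domain_lin Kpcf Dr).
have -> : (fun x => complex.Im (c * a x + b x)) = (fun x => complex.Re c * complex.Im (a x) +
    (complex.Im c * complex.Re (a x) + complex.Im (b x))).
  by apply/funext => x; case: c (a x) (b x) => ? ? [? ?] [? ?] /=; ring.
by apply: (real_domain_lin Kpcf Dr) => //; exact: (real_domain_lin Kpcf Dr).
Qed.

Lemma form_domain_cst c : FD (fun=> c).
Proof. by apply/form_domainP; split; exact: (real_domain_cst Kpcf Dr). Qed.

Lemma form_domainD a b : FD a -> FD b -> FD (fun x => a x + b x).
Proof.
move=> da db; have -> : (fun x => a x + b x) = (fun x => 1 * a x + b x).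
  by apply/funext => x; rewrite mul1r.
exact: form_domain_lin.
Qed.

Lemma form_domainZ c a : FD a -> FD (fun x => c * a x).
Proof.
move=> da; have -> : (fun x => c * a x) = (fun x => c * a x + 0).
  by apply/funext => x; rewrite addr0.
by apply: form_domain_lin => //; exact: form_domain_cst.
Qed.

Lemma form_domainM a b : FD a -> FD b -> FD (fun x => a x * b x).
Proof.
move=> /form_domainP[ar ai] /form_domainP[br bi]; apply/form_domainP.
split.
  have -> : (fun x => complex.Re (a x * b x)) = (fun x => - 1 * (complex.Im (a x) * complex.Im (b x)) +
      complex.Re (a x) * complex.Re (b x)).
    by apply/funext => x; case: (a x) (b x) => ? ? [? ?] /=; ring.
  by apply: (real_domain_lin Kpcf Dr); exact: (real_domain_mul Kss Kpcf Dr).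
have -> : (fun x => complex.Im (a x * b x)) = (fun x => 1 * (complex.Im (a x) * complex.Re (b x)) +
    complex.Re (a x) * complex.Im (b x)).
  by apply/funext => x; case: (a x) (b x) => ? ? [? ?] /=; ring.
by apply: (real_domain_lin Kpcf Dr); exact: (real_domain_mul Kss Kpcf Dr).
Qed.

Lemma form_domain_cells a : FD a <-> forall i, FD (a \o F i).
Proof.
split=> [/form_domainP[ar ai] i|h].
  apply/form_domainP; split; first exact: ((real_domain_cells Kss Dr _).1 ar i).
  exact: ((real_domain_cells Kss Dr _).1 ai i).
apply/form_domainP; split.
  by apply/(real_domain_cells Kss Dr) => i; case/form_domainP: (h i).
by apply/(real_domain_cells Kss Dr) => i; case/form_domainP: (h i).
Qed.

Lemma energy_cells a : FD a ->
  energy F pi D r a = \sum_i (r i)^-1 * energy F pi D r (a \o F i).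
Proof.
move=> [_ er ei]; rewrite /energy (lim_energy_cells Dr er) (lim_energy_cells Dr ei).
by rewrite -big_split /=; apply: eq_bigr => i _; rewrite mulrDr.
Qed.

Lemma form_domain_dense a (e : R) : CK a -> 0 < e ->
  exists2 b, FD b & forall x, cmod (b x - a x) <= e.
Proof.
move=> /CKP[cr ci] e0; have e2 : 0 < e / 2 by rewrite divr_gt0.
have [u du hu] := real_domain_dense Kss Kpcf Dr reg cr e2.
have [v dv hv] := real_domain_dense Kss Kpcf Dr reg ci e2.
exists (fun x => Complex (u x) (v x)); first exact/form_domainP.
by move=> x; rewrite (le_trans (cmod_le_ReIm _))// ReB ImB/= [leRHS](splitr e) lerD// ?hu ?hv.
Qed.

Lemma form_domain_interpolate (p : K) : exists2 u, rd u &
  forall q, V0 F pi q -> u q = (q == p)%:R.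
Proof.
exact: (real_domain_interpolate Kss Kpcf Dr reg (fun q => (q == p)%:R)).
Qed.

Lemma form_domain_extend i a : FD a -> exists2 u, FD u & u \o F i = a.
Proof.
move=> /form_domainP[/(real_domain_extend Kss Kpcf Dr reg i)[u du ui]
  /(real_domain_extend Kss Kpcf Dr reg i)[v dv vi]].
exists (fun x => Complex (u x) (v x)); first exact/form_domainP.
apply/funext => x /=; have := congr1 (@^~ x) ui; have := congr1 (@^~ x) vi => /= -> ->.
by case: (a x).
Qed.

Lemma form_domain_extend0 i a : FD a -> (forall p, V0 F pi p -> a p = 0) ->
  exists2 u, FD u & forall j, u \o F j = if j == i then a else fun=> 0.
Proof.
move=> /form_domainP[da_r da_i] a0.
have [|u du hu] := real_domain_extend0 Kss Kpcf Dr i da_r; first by move=> p Vp; rewrite a0.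
have [|v dv hv] := real_domain_extend0 Kss Kpcf Dr i da_i; first by move=> p Vp; rewrite a0.
exists (fun x => Complex (u x) (v x)); first exact/form_domainP.
move=> j; apply/funext => x /=.
have := congr1 (@^~ x) (hu j); have := congr1 (@^~ x) (hv j) => /= -> ->.
by case: ifP => // _; case: (a x).
Qed.

Lemma CK_extend0 i b : CK b -> (forall p, V0 F pi p -> b p = 0) ->
  exists2 u, CK u & forall j, u \o F j = if j == i then b else fun=> 0.
Proof.
move=> cb b0.
have [|v hv] := @glue_exists _ _ _ _ _ Kss _ (fun j => if j == i then b else fun=> 0).
  by move=> j k x y Vx Vy _; case: ifP; case: ifP => _ _ //; rewrite ?b0.
have vF j : v \o F j = if j == i then b else fun=> 0 by apply/funext => x; rewrite /= hv.
exists v; last exact: vF.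
have cv j : CK (v \o F j).
  by rewrite vF; case: ifP => _; [exact: cb|exact: CK_cst].
apply/CKP; split; apply: (@glue_continuous _ _ _ _ _ Kss R) => j; by case/CKP: (cv j).
Qed.

Lemma lim_energy_cst (l : R) : lim_energy (fun=> l) = 0.
Proof.
have [_ e0] := real_domain_cst Kpcf Dr l.
apply/eqP; rewrite eq_le (lim_energy_ge0 Dr e0) andbT.
apply: limr_le => //; apply: nearW => m.
have h := @energy_le _ _ _ _ _ Kpcf _ _ Dr m 0 0 (fun=> l) (fun=> l) (fun=> l).
rewrite !mul0r addr0 in h; apply: h => x y.
by rewrite subrr expr0n.
Qed.

Lemma energy_real u : energy F pi D r (fun x => (u x)%:C%C) = lim_energy u.
Proof. by rewrite /energy /= lim_energy_cst addr0. Qed.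

End ComplexDomain.

(** * The Hilbert module of the derivation *)

(** The values 1 and i of [l] separate the linear from the antilinear part. This is the polarization
    step for sesquilinear forms that vanish on the diagonal. *)
Lemma sesquilinear_zero (R : realType) (p q : R[i]) : (forall l : R[i], l * p + l^* * q = 0) -> p = 0.
Proof.
move=> h; have h1 := h 1; have h2 := h (ii R).
have pq : q = - p by move: h1; rewrite rmorph1 !mul1r => /eqP; rewrite addrC addr_eq0 => /eqP.
move: h2; rewrite pq.
have -> : (ii R)^* = - ii R by apply/eqP; rewrite eq_complex /= oppr0 !eqxx.
rewrite mulrNN -mulr2n -mulr_natl => /eqP; rewrite !mulf_eq0 pnatr_eq0 /=.
rewrite /ii eq_complex /= oner_eq0 andbF /= => /eqP; exact.
Qed.

(** * Extension of a densely defined isometric relation *)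

Section IsometricExtension.
Context (R : realType) (H : completeNormedModType R[i]).
Variable (dot : {dot H for Num.conj}).
Hypothesis Hdot : hilbert_inner_product dot.
Variables (N : nat) (M : H -> ('I_N -> H) -> Prop).
Hypothesis M_lin : forall c x y f g, M x f -> M y g ->
  M (c *: x + y) (fun i => c *: f i + g i).
Hypothesis M_dot : forall x y f g, M x f -> M y g -> dot x y = \sum_i dot (f i) (g i).
Hypothesis M_dense : forall x (e : R), 0 < e -> exists y f, M y f /\ nm (x - y) <= e.

(** The closure of the graph [M]. Inner products pass to it, so it is single-valued: the difference
    of two images of one vector is an image of 0, hence has norm 0. *)
Let cl x f := forall e : R, 0 < e ->
  exists y g, [/\ M y g, nm (x - y) <= e & forall i, nm (f i - g i) <= e].

Let M_nm x f i : M x f -> nm (f i) <= nm x.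
Proof.
move=> xf; rewrite -(ler_pXn2r (n:=2)) ?nnegrE ?nm_ge0//.
rewrite !(nm_sq Hdot) (M_dot xf xf) raddf_sum (bigD1 i)//= lerDl sumr_ge0// => j _.
by rewrite -(nm_sq Hdot) sqr_ge0.
Qed.

Let M_cl x f : M x f -> cl x f.
Proof.
move=> xf e e0; exists x, f; split => //; first by rewrite subrr nm0 ltW.
by move=> i; rewrite subrr nm0 ltW.
Qed.

Let cl_lin c x y f g : cl x f -> cl y g -> cl (c *: x + y) (fun i => c *: f i + g i).
Proof.
move=> cx cy e e0.
have c0 : 0 < cmod c + 1 by rewrite ltr_wpDl// cmod_ge0.
have e1 : 0 < e / (cmod c + 1) by rewrite divr_gt0.
have [x' [f' [M1 n1 h1]]] := cx _ e1; have [y' [g' [M2 n2 h2]]] := cy _ e1.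
have est (u u' v v' : H) : nm (u - u') <= e / (cmod c + 1) -> nm (v - v') <= e / (cmod c + 1) ->
    nm (c *: u + v - (c *: u' + v')) <= e.
  move=> uu vv; have -> : c *: u + v - (c *: u' + v') = c *: (u - u') + (v - v').
    by rewrite scalerBr opprD addrACA.
  rewrite (le_trans (nmD _ _))// nmZ.
  have -> : e = cmod c * (e / (cmod c + 1)) + e / (cmod c + 1).
    by field; rewrite gt_eqF.
  by rewrite lerD// ler_wpM2l// cmod_ge0.
exists (c *: x' + y'), (fun i => c *: f' i + g' i); split; first exact: M_lin.
  exact: est.
by move=> i; exact: est.
Qed.

Let cl_dot1 x y f g : cl x f -> M y g -> dot x y = \sum_i dot (f i) (g i).
Proof.
move=> cx yg; apply/subr0_eq.
apply: (@cmod_small_eq0 _ _ (nm y + \sum_i nm (g i))) => e /cx[x' [f' [xf' n1 h1]]].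
have -> : dot x y - \sum_i dot (f i) (g i) = dot (x - x') y - \sum_i dot (f i - f' i) (g i).
  rewrite dotBl (M_dot xf' yg) -addrA -opprD; congr (_ - _).
  by rewrite -big_split /=; apply: eq_bigr => i _; rewrite dotBl addrC subrK.
rewrite (le_trans (cmodD _ _))// mulrDl lerD//.
  by rewrite (le_trans (cauchy_schwarz Hdot _ _))// mulrC ler_wpM2l// nm_ge0.
rewrite cmodN mulr_suml (le_trans (cmod_sum _ _))//; apply: ler_sum => i _.
by rewrite (le_trans (cauchy_schwarz Hdot _ _))// mulrC ler_wpM2l// nm_ge0.
Qed.

Let cl_dot x y f g : cl x f -> cl y g -> dot x y = \sum_i dot (f i) (g i).
Proof.
move=> cx cy; apply/subr0_eq.
apply: (@cmod_small_eq0 _ _ (nm x + \sum_i nm (f i))) => e /cy[y' [g' [yg' n1 h1]]].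
have -> : dot x y - \sum_i dot (f i) (g i) = dot x (y - y') - \sum_i dot (f i) (g i - g' i).
  rewrite dotBr (cl_dot1 cx yg') -addrA -opprD; congr (_ - _).
  by rewrite -big_split /=; apply: eq_bigr => i _; rewrite dotBr addrC subrK.
rewrite (le_trans (cmodD _ _))// mulrDl lerD//.
  by rewrite (le_trans (cauchy_schwarz Hdot _ _))// ler_wpM2l// nm_ge0.
rewrite cmodN mulr_suml (le_trans (cmod_sum _ _))//; apply: ler_sum => i _.
by rewrite (le_trans (cauchy_schwarz Hdot _ _))// ler_wpM2l// nm_ge0.
Qed.

Let cl_unique x f g : cl x f -> cl x g -> f = g.
Proof.
move=> xf xg; apply/funext => i; apply/subr0_eq/nm_eq0/eqP.
have := cl_lin (-1) xg xf; rewrite scaleN1r addNr => h0.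
rewrite -sqrf_eq0 eq_le sqr_ge0 andbT.
have := nm_sq Hdot 0; rewrite (cl_dot h0 h0) nm0 expr0n/= raddf_sum (bigD1 i)//=.
rewrite -(nm_sq Hdot) scaleN1r [- g i + _]addrC => /esym/eqP.
rewrite addr_eq0 => /eqP ->; rewrite oppr_le0 sumr_ge0// => j _.
by rewrite -(nm_sq Hdot) sqr_ge0.
Qed.

Let cl_exists x : exists f, cl x f.
Proof.
have /choice[yf hyf] : forall n : nat, exists p : H * ('I_N -> H),
    M p.1 p.2 /\ nm (x - p.1) <= n.+1%:R^-1.
  move=> n; have [|y [f [Mf h]]] := M_dense x (e := n.+1%:R^-1); first by rewrite invr_gt0.
  by exists (y, f).
have inv_le m n : (n <= m)%N -> m.+1%:R^-1 <= n.+1%:R^-1 :> R.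
  by move=> nm; rewrite lef_pV2 ?posrE// ler_nat.
have cauchy i (e : R) : 0 < e -> exists n, forall m, (n <= m)%N ->
    nm ((yf m).2 i - (yf n).2 i) <= e.
  move=> e0; have [|n hn] := @exists_inv_lt _ (e / 2); first by rewrite divr_gt0.
  exists n => m nm'; have := M_lin (-1) (hyf n).1 (hyf m).1.
  move=> /(M_nm i); rewrite !scaleN1r addrC => /le_trans; apply.
  rewrite addrC (le_trans (nm_dist_tri x _ _))// [leRHS](splitr e) lerD//.
    by rewrite nm_distrC (le_trans (hyf m).2)// (le_trans (inv_le _ _ nm'))// ltW.
  by rewrite (le_trans (hyf n).2)// ltW.
have /choice[f hf] : forall i, exists l, forall e : R, 0 < e ->
    exists n, forall m, (n <= m)%N -> nm ((yf m).2 i - l) <= e.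
  by move=> i; exact: nm_complete (cauchy i).
exists f => e e0.
have /choice[n hn] : forall i, exists n, forall m, (n <= m)%N -> nm ((yf m).2 i - f i) <= e.
  by move=> i; exact: hf.
have [n0 hn0] := exists_inv_lt e0.
pose m := (n0 + \sum_i n i)%N.
exists (yf m).1, (yf m).2; split; first exact: (hyf m).1.
  by rewrite (le_trans (hyf m).2)// (le_trans (inv_le m n0 _)) ?leq_addr// ltW.
move=> i; rewrite nm_distrC; apply: hn; rewrite /m (bigD1 i)//= addnCA leq_addr//.
Qed.

Lemma isometric_extension : exists S : 'I_N -> H -> H,
  [/\ forall i c x y, S i (c *: x + y) = c *: S i x + S i y,
      forall x y, dot x y = \sum_i dot (S i x) (S i y)
    & forall x f, M x f -> forall i, S i x = f i].
Proof.
have [S hS] := choice cl_exists.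
exists (fun i x => S x i); split.
- move=> i c x y; exact: (congr1 (@^~ i) (cl_unique (hS _) (cl_lin c (hS x) (hS y)))).
- by move=> x y; exact: cl_dot.
- by move=> x f /M_cl xf i; rewrite (cl_unique (hS x) xf).
Qed.

End IsometricExtension.

(** * Splitting the module over the cells *)

Section Module.
Context (R : realType) (K : pseudoPMetricType R) (N : nat).
Variables (F : 'I_N -> K -> K) (pi : shift_space N -> K).
Hypothesis Kss : self_similar_structure F pi.
Hypothesis Kpcf : pcf F pi.
Variables (D : K -> K -> R) (r : 'I_N -> R).
Hypothesis Dr : harmonic_structure F pi D r.
Hypothesis reg : regular_structure r.
Context (H : completeNormedModType R[i]) (dot : {dot H for Num.conj}).
Hypothesis Hdot : hilbert_inner_product dot.
Variables (act : (K -> R[i]) -> H -> H) (d : (K -> R[i]) -> H) (J : H -> H).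
Hypothesis act_rep : star_representation dot act.
Hypothesis d_der : derivation F pi D r act d.
Hypothesis J_inv : antilinear_involution F pi D r act d J.

Local Notation C := R[i].
Local Notation rd := (real_domain F pi D r).
Local Notation FD := (form_domain F pi D r).
Local Notation lim_energy u := (limn (energy_m F pi D r ^~ u)).
Implicit Types (a b c : K -> C) (u v : K -> R) (x y z : H).

Let r0 i : 0 < r i. Proof. by case: Dr. Qed.

Let F_cont i : continuous (F i). Proof. by case: Kss => _ _ /(_ i)[]. Qed.

Lemma act_lin a l x y : CK a -> act a (l *: x + y) = l *: act a x + act a y.
Proof. by move=> ca; case: act_rep => /(_ a ca)[_ h] _ _ _; exact: h. Qed.

Lemma act_D a x y : CK a -> act a (x + y) = act a x + act a y.
Proof. by move=> ca; rewrite -[x]scale1r act_lin// !scale1r. Qed.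

Lemma act_0 a : CK a -> act a 0 = 0.
Proof. by move=> ca; apply: lin_0 => l x y; exact: act_lin. Qed.

Lemma act_Z a l x : CK a -> act a (l *: x) = l *: act a x.
Proof. by move=> ca; apply: lin_Z => k y z; exact: act_lin. Qed.

Lemma act_B a x y : CK a -> act a (x - y) = act a x - act a y.
Proof. by move=> ca; apply: lin_B => k z t; exact: act_lin. Qed.

Lemma act_comb a b l x : CK a -> CK b ->
  act (fun t => l * a t + b t) x = l *: act a x + act b x.
Proof. by move=> ca cb; case: act_rep => _ h _ _; exact: h. Qed.

Lemma act_zero x : act (fun=> 0) x = 0.
Proof.
have := @act_comb (fun=> 0) (fun=> 0) (-1) x (@CK_cst _ K 0) (@CK_cst _ K 0).
rewrite scaleN1r addNr => <-; congr act; apply/funext => t; by rewrite mulr0 addr0.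
Qed.

Lemma act_scale a l x : CK a -> act (fun t => l * a t) x = l *: act a x.
Proof.
move=> ca; rewrite -[RHS]addr0 -(act_zero x) -(act_comb l x ca (@CK_cst _ K 0)).
by congr act; apply/funext => t; rewrite addr0.
Qed.

Lemma act_M a b x : CK a -> CK b -> act (fun t => a t * b t) x = act a (act b x).
Proof. by move=> ca cb; case: act_rep => _ _ h _; exact: h. Qed.

Lemma act_adj a x y : CK a -> dot (act a x) y = dot x (act (conj_fun a) y).
Proof. by move=> ca; case: act_rep => _ _ _; exact. Qed.

Lemma d_lin a b l : FD a -> FD b -> d (fun t => l * a t + b t) = l *: d a + d b.
Proof. by move=> da db; case: d_der => h _ _ _; exact: h. Qed.

Lemma d_leibniz a b : FD a -> FD b -> d (fun t => a t * b t) = act b (d a) + act a (d b).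
Proof. by move=> da db; case: d_der => _ h _ _; exact: h. Qed.

Lemma nm_d a : FD a -> nm (d a) ^+ 2 = energy F pi D r a.
Proof.
move=> da; case: d_der => _ _ h _; apply: (@complexI R).
by rewrite -h// rmorphXn /= nmE.
Qed.

Lemma d_cst l : d (fun=> l) = 0.
Proof.
have dl := form_domain_cst Kpcf Dr l; have d0 := form_domain_cst Kpcf Dr 0.
have d00 : d (fun=> 0) = 0.
  have := d_lin (-1) d0 d0; rewrite scaleN1r addNr => <-; congr d.
  by apply/funext => t; rewrite mulr0 addr0.
have d1 := form_domain_cst Kpcf Dr 1.
have d11 : d (fun=> 1) = 0.
  apply/nm_eq0/eqP; rewrite -sqrf_eq0 nm_d//.
  have -> : (fun=> 1) = (fun _ : K => ((1 : R)%:C)%C :> C) by [].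
  by rewrite (energy_real Kpcf Dr) (lim_energy_cst Kpcf Dr).
have := d_lin l d1 d0; rewrite d11 d00 scaler0 [RHS]addr0 => <-; congr d.
by apply/funext => t; rewrite mulr1 addr0.
Qed.

Lemma d_Z a l : FD a -> d (fun t => l * a t) = l *: d a.
Proof.
move=> da; have := d_lin l da (form_domain_cst Kpcf Dr 0); rewrite d_cst addr0 => <-.
by congr d; apply/funext => t; rewrite addr0.
Qed.

Lemma d_D a b : FD a -> FD b -> d (fun t => a t + b t) = d a + d b.
Proof.
move=> da db; have := d_lin 1 da db; rewrite scale1r => <-.
by congr d; apply/funext => t; rewrite mul1r.
Qed.

Lemma module_dense (e : R) x : 0 < e -> exists n (a b : 'I_n -> K -> C),
  [/\ forall k, FD (a k), forall k, CK (b k) & nm (x - \sum_k act (b k) (d (a k))) <= e].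
Proof.
move=> e0; case: d_der => _ _ _ cl; have : closure (module_span F pi D r act d) x by rewrite cl.
by move=> /closure_nmP/(_ e e0)[y [n [a [b [ha hb ->]]]] xy]; exists n, a, b; split => //; exact: ltW.
Qed.

Lemma module_total z : (forall a b, FD a -> CK b -> dot (act b (d a)) z = 0) -> z = 0.
Proof.
move=> h; apply/nm_eq0/eqP; rewrite -sqrf_eq0 (nm_sq Hdot).
rewrite (@dot_closure _ _ _ Hdot (module_span F pi D r act d))//; last by case: d_der => _ _ _ ->.
move=> y [n [a [b [ha hb ->]]]]; rewrite dot_suml big1// => k _; exact: h.
Qed.

(** The unit acts as the identity because it does so against the total vectors [act b (d a)], where
    it is absorbed by [b]. *)
Lemma act_1 x : act (fun=> 1) x = x.
Proof.
have c1 := @CK_cst _ K 1.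
apply/esym/subr0_eq/module_total => a b da cb.
rewrite dotBr; apply/eqP; rewrite subr_eq0; apply/eqP.
have -> : dot (act b (d a)) (act (fun=> 1) x) = dot (act b (d a)) (act (conj_fun (fun=> 1)) x).
  by congr (dot _ (act _ _)); apply/funext => t; rewrite /conj_fun rmorph1.
rewrite -act_adj// -act_M//; congr (dot (act _ _) _).
by apply/funext => t; rewrite mul1r.
Qed.

Lemma act_cst l x : act (fun=> l) x = l *: x.
Proof.
rewrite -[in RHS](act_1 x) -(act_scale l x (@CK_cst _ K 1)).
by congr act; apply/funext => t; rewrite mulr1.
Qed.

Lemma nm_act a (m : R) x : CK a -> 0 <= m -> (forall t, cmod (a t) <= m) ->
  nm (act a x) <= m * nm x.
Proof.
move=> ca m0 hm.
pose b t : C := (Num.sqrt (m ^+ 2 - cmod (a t) ^+ 2))%:C%C.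
have cb : CK b.
  apply: CK_real => t; apply: continuous_comp; last exact: sqrt_continuous.
  have -> : (fun t => m ^+ 2 - cmod (a t) ^+ 2) =
      (fun t => m ^+ 2 - (complex.Re (a t) ^+ 2 + complex.Im (a t) ^+ 2)).
    by apply/funext => s; rewrite cmod_sq.
  have [cr ci] := (CKP a).1 ca.
  apply: cvgB; first exact: cvg_cst.
  by apply: cvgD; apply: cvgM; solve [exact: cr|exact: ci].
have cJa := CKJ ca; have cJb := CKJ cb.
have : dot (act a x) (act a x) + dot (act b x) (act b x) = (m ^+ 2)%:C%C * dot x x.
  rewrite !act_adj// -!act_M// -dotDr -[in LHS]/(act _ x + act _ x).
  have -> : act (fun t => conj_fun a t * a t) x + act (fun t => conj_fun b t * b t) x =
      (m ^+ 2)%:C%C *: x.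
    rewrite -[X in X + _ = _]scale1r -(act_comb 1 x (CKM cJa ca) (CKM cJb cb)).
    rewrite -act_cst; congr act; apply/funext => t.
    rewrite mul1r /conj_fun mulrC mulJ_cmod mulrC mulJ_cmod -rmorphD /=; congr (_%:C)%C.
    rewrite cmod_real ger0_norm ?sqrtr_ge0// sqr_sqrtr ?subrKC//.
    by rewrite subr_ge0 ler_pXn2r// nnegrE ?cmod_ge0.
  by rewrite dotZr; congr (_ * _); apply/eqP; rewrite eq_complex /= oppr0 !eqxx.
rewrite !(dotxx Hdot) -rmorphM -rmorphD /= => /complexI h.
rewrite -(ler_pXn2r (n:=2)) ?nnegrE ?nm_ge0 ?mulr_ge0 ?nm_ge0// exprMn -h.
by rewrite lerDl sqr_ge0.
Qed.

Local Notation dF i a := (d (a \o F i)).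
Local Notation cell_dot x y := (\sum_i ((r i)^-1)%:C%C * dot (x i) (y i)).

Lemma comp_comb (l : C) a b i :
  (fun t => l * a t + b t) \o F i = (fun t => l * (a \o F i) t + (b \o F i) t).
Proof. by []. Qed.

Let FDF a i : FD a -> FD (a \o F i).
Proof. by move=> da; exact: ((form_domain_cells Kss Dr a).1 da i). Qed.

Let CKF a i : CK a -> CK (a \o F i).
Proof. by move=> ca; exact: (CK_comp (@F_cont i) ca). Qed.

(** Self-similarity of the energy is the diagonal case; polarization extends it to pairs. *)
Lemma dot_d_cells a c : FD a -> FD c ->
  dot (d a) (d c) = cell_dot (fun i => dF i a) (fun i => dF i c).
Proof.
pose B a c := dot (d a) (d c) - cell_dot (fun i => dF i a) (fun i => dF i c).
have Bl l a1 b c1 : FD a1 -> FD b -> FD c1 ->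
    B (fun t => l * a1 t + b t) c1 = l * B a1 c1 + B b c1.
  move=> da1 db dc1; rewrite /B d_lin// dotDl dotZl mulrBr -addrACA -opprD mulr_sumr -big_split /=.
  congr (_ - _); apply: eq_bigr => i _; rewrite comp_comb d_lin; [|exact: FDF..].
  rewrite dotDl dotZl mulrDr; congr (_ + _); exact: mulrCA.
have Br l a1 b c1 : FD a1 -> FD b -> FD c1 ->
    B c1 (fun t => l * a1 t + b t) = l^* * B c1 a1 + B c1 b.
  move=> da1 db dc1; rewrite /B d_lin// dotDr dotZr mulrBr -addrACA -opprD mulr_sumr -big_split /=.
  congr (_ - _); apply: eq_bigr => i _; rewrite comp_comb d_lin; [|exact: FDF..].
  rewrite dotDr dotZr mulrDr; congr (_ + _); exact: mulrCA.
have B0 b : FD b -> B b b = 0.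
  move=> db; apply/eqP; rewrite subr_eq0 (dotxx Hdot) nm_d// (energy_cells Dr db) rmorph_sum.
  apply/eqP/eq_bigr => i _; rewrite (dotxx Hdot) nm_d; last exact: FDF.
  by rewrite rmorphM.
move=> da dc; apply/subr0_eq; rewrite -[LHS]/(B a c); apply: (@sesquilinear_zero _ _ (B c a)) => l.
have dl := form_domainZ Kpcf Dr l da.
have := B0 _ (form_domain_lin Kpcf Dr l da dc).
have dac := form_domain_lin Kpcf Dr l da dc.
by rewrite Bl// !Br// !B0// mulr0 !add0r addr0.
Qed.

Lemma dot_J x y : dot (J x) (J y) = dot y x.
Proof.
case: J_inv => Jl Jn _ _ _.
pose B x y := dot (J y) (J x) - dot x y.
have Bl l x1 x2 y1 : B (l *: x1 + x2) y1 = l * B x1 y1 + B x2 y1.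
  by rewrite /B Jl dotDr dotZr conjCK dotDl dotZl mulrBr opprD addrACA.
have Br l x1 x2 y1 : B y1 (l *: x1 + x2) = l^* * B y1 x1 + B y1 x2.
  by rewrite /B Jl dotDl dotZl dotDr dotZr mulrBr opprD addrACA.
have B0 z : B z z = 0 by rewrite /B !(dotxx Hdot) /nm Jn subrr.
suff : B y x = 0 by move=> /subr0_eq.
apply: (@sesquilinear_zero _ _ (B x y)) => l.
by have := B0 (l *: y + x); rewrite Bl !Br !B0 mulr0 add0r addr0.
Qed.

Local Notation cst u := (fun t : K => (u t)%:C%C : C).

Let conj_real u : conj_fun (cst u) = cst u.
Proof. by apply/funext => t; apply/eqP; rewrite eq_complex /= oppr0 !eqxx. Qed.

(** [J] fixes derivatives of real functions and commutes with real multipliers while reversing inner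
    products. So this inner product is real, and [module_dot_d] can be solved for it. *)
Lemma real_dotC u v w : rd u -> rd v -> rd w ->
  dot (act (cst u) (d (cst v))) (d (cst w)) = dot (d (cst w)) (act (cst u) (d (cst v))).
Proof.
move=> du dv dw; case: J_inv => _ _ _ Jact Jd.
have fu := form_domain_real Kpcf Dr du; have fv := form_domain_real Kpcf Dr dv.
have fw := form_domain_real Kpcf Dr dw.
by rewrite -dot_J (Jact _ (form_domain_CK fu)) (Jd _ fv) (Jd _ fw) !conj_real.
Qed.

(* The module inner product is a polynomial in inner products of derivatives,
   which split over the cells. *)
Lemma module_dot_d u v w : rd u -> rd v -> rd w ->
  2 * dot (act (cst u) (d (cst v))) (d (cst w)) =
  dot (d (fun t => cst u t * cst v t)) (d (cst w)) + dot (d (cst v)) (d (fun t => cst u t * cst w t))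
  - dot (d (fun t => cst v t * cst w t)) (d (cst u)).
Proof.
move=> du dv dw.
have fu := form_domain_real Kpcf Dr du; have fv := form_domain_real Kpcf Dr dv.
have fw := form_domain_real Kpcf Dr dw.
have cu := form_domain_CK fu; have cv := form_domain_CK fv; have cw := form_domain_CK fw.
rewrite (d_leibniz fu fv) (d_leibniz fu fw) (d_leibniz fv fw) !dotDl !dotDr.
have adj z s s' : CK (cst s) -> dot z (act (cst s) (d (cst s'))) = dot (act (cst s) z) (d (cst s')).
  by move=> cs; rewrite (act_adj _ _ cs) conj_real.
by rewrite (real_dotC dv du dw) !adj//; ring.
Qed.

(** Linear in [g] and [a], antilinear in [c]; it vanishes on real arguments in the domain, then on
    complex ones, then for continuous [g] by density. *)
Let cells_defect g a c := dot (act g (d a)) (d c) -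
  cell_dot (fun i => act (g \o F i) (dF i a)) (fun i => dF i c).

Let defect_g l g g' a c : CK g -> CK g' ->
  cells_defect (fun t => l * g t + g' t) a c = l * cells_defect g a c + cells_defect g' a c.
Proof.
move=> cg cg'; rewrite /cells_defect (act_comb _ _ cg cg') dotDl dotZl mulrBr -addrACA -opprD.
rewrite mulr_sumr -big_split /=; congr (_ - _); apply: eq_bigr => i _.
rewrite comp_comb (act_comb _ _ (@CKF _ i cg) (@CKF _ i cg')) dotDl dotZl mulrDr.
by congr (_ + _); exact: mulrCA.
Qed.

Let defect_a l g a a' c : CK g -> FD a -> FD a' ->
  cells_defect g (fun t => l * a t + a' t) c = l * cells_defect g a c + cells_defect g a' c.
Proof.
move=> cg da da'; rewrite /cells_defect (d_lin _ da da') (act_lin _ _ _ cg) dotDl dotZl mulrBr.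
rewrite -addrACA -opprD mulr_sumr -big_split /=; congr (_ - _); apply: eq_bigr => i _.
rewrite comp_comb (d_lin _ (FDF i da) (FDF i da')) (act_lin _ _ _ (@CKF _ i cg)) dotDl dotZl mulrDr.
by congr (_ + _); exact: mulrCA.
Qed.

Let defect_c l g a c c' : FD c -> FD c' ->
  cells_defect g a (fun t => l * c t + c' t) = l^* * cells_defect g a c + cells_defect g a c'.
Proof.
move=> dc dc'; rewrite /cells_defect (d_lin _ dc dc') dotDr dotZr mulrBr.
rewrite -addrACA -opprD mulr_sumr -big_split /=; congr (_ - _); apply: eq_bigr => i _.
rewrite comp_comb (d_lin _ (FDF i dc) (FDF i dc')) dotDr dotZr mulrDr.
by congr (_ + _); exact: mulrCA.
Qed.

Let defect_real u v w : rd u -> rd v -> rd w -> cells_defect (cst u) (cst v) (cst w) = 0.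
Proof.
move=> du dv dw; apply/eqP; rewrite subr_eq0; apply/eqP.
have two0 : 2 != 0 :> C by rewrite pnatr_eq0.
apply: (mulfI two0); rewrite (module_dot_d du dv dw) mulr_sumr.
have rdF s i : rd s -> rd (s \o F i).
  by move=> ds; exact: ((real_domain_cells Kss Dr s).1 ds i).
have fu := form_domain_real Kpcf Dr du; have fv := form_domain_real Kpcf Dr dv.
have fw := form_domain_real Kpcf Dr dw.
have M s s' := form_domainM Kss Kpcf Dr (a := s) (b := s').
rewrite (dot_d_cells (M _ _ fu fv) fw) (dot_d_cells fv (M _ _ fu fw)) (dot_d_cells (M _ _ fv fw) fu).
rewrite -big_split -sumrB /=; apply: eq_bigr => i _.
rewrite -mulrDr -mulrBr mulrCA; congr (_ * _).
by rewrite -(module_dot_d (rdF u i du) (rdF v i dv) (rdF w i dw)).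
Qed.

Let ReIm a : a = (fun t => ii R * cst (fun t => complex.Im (a t)) t + cst (fun t => complex.Re (a t)) t).
Proof. by apply/funext => t; rewrite {1}(complexRI (a t)) addrC. Qed.

Let defect_FD g a c : FD g -> FD a -> FD c -> cells_defect g a c = 0.
Proof.
have real u : rd u -> FD (cst u) by exact: (form_domain_real Kpcf Dr).
move=> fg fa fc.
have [gr gi] := (form_domainP F pi D r g).1 fg.
have [ar ai] := (form_domainP F pi D r a).1 fa.
have [cr ci] := (form_domainP F pi D r c).1 fc.
have hc u v : rd u -> rd v -> cells_defect (cst u) (cst v) c = 0.
  move=> du dv; rewrite (ReIm c) defect_c; [|exact: real..].
  by rewrite !defect_real// mulr0 addr0.
have ha u : rd u -> cells_defect (cst u) a c = 0.
  move=> du; rewrite (ReIm a) defect_a; [|exact: form_domain_CK (real _ du)|exact: real..].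
  by rewrite !hc// mulr0 addr0.
rewrite (ReIm g) defect_g; first by rewrite !ha// mulr0 addr0.
  exact: form_domain_CK (real _ gi).
exact: form_domain_CK (real _ gr).
Qed.

Lemma module_dot_cells g a c : CK g -> FD a -> FD c ->
  dot (act g (d a)) (d c) = cell_dot (fun i => act (g \o F i) (dF i a)) (fun i => dF i c).
Proof.
move=> cg da dc; apply/subr0_eq; rewrite -[LHS]/(cells_defect g a c).
pose B := nm (d a) * nm (d c) + \sum_i (r i)^-1 * (nm (dF i a) * nm (dF i c)).
apply: (@cmod_small_eq0 _ _ B) => e e0.
have [h dh hg] := form_domain_dense Kss Kpcf Dr reg cg e0.
have ch := form_domain_CK dh.
have -> : cells_defect g a c = cells_defect (fun t => -1 * h t + g t) a c.
  by rewrite (@defect_g _ _ _ a c ch cg) (defect_FD dh da dc) mulr0 add0r.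
have cgh : CK (fun t => -1 * h t + g t).
  exact: (CKD (CKM (@CK_cst _ K (-1)) ch) cg).
have hgh t : cmod (-1 * h t + g t) <= e.
  by rewrite -cmodN mulN1r opprD opprK; exact: hg.
have est (b b' : H) q : CK q -> (forall t, cmod (q t) <= e) ->
    cmod (dot (act q b) b') <= e * (nm b * nm b').
  move=> cq hq; rewrite (le_trans (cauchy_schwarz Hdot _ _))// mulrA ler_wpM2r ?nm_ge0//.
  exact: (nm_act _ cq (ltW e0) hq).
rewrite /cells_defect (le_trans (cmodD _ _))// cmodN mulrC mulrDr lerD ?est//.
rewrite mulr_sumr (le_trans (cmod_sum _ _))//; apply: ler_sum => i _.
rewrite cmodM cmod_real ger0_norm ?invr_ge0 ?(ltW (r0 i))// mulrCA ler_wpM2l ?invr_ge0 ?(ltW (r0 i))//.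
by apply: est => [|t]; [exact: (@CKF _ i cgh)|exact: hgh].
Qed.

Definition cell_weight i : C := ((Num.sqrt (r i))^-1)%:C%C.

Let cell_weightK i z z' :
  dot (cell_weight i *: z) (cell_weight i *: z') = ((r i)^-1)%:C%C * dot z z'.
Proof.
rewrite dotZl dotZr mulrA mulJ_cmod cmod_real ger0_norm ?invr_ge0 ?sqrtr_ge0// exprVn.
by rewrite sqr_sqrtr// ltW.
Qed.

(** A relation rather than a function: the same vector may be written as a sum of terms
    [act b (d a)] in several ways, and only the isometry property shows that the images coincide. *)
Inductive cells_rel : H -> ('I_N -> H) -> Prop :=
| cells_nil : cells_rel 0 (fun=> 0)
| cells_cons a b x f : FD a -> CK b -> cells_rel x f ->
  cells_rel (act b (d a) + x) (fun i => cell_weight i *: act (b \o F i) (dF i a) + f i).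

Let act_adjr b x y : CK b -> dot x (act b y) = dot (act (conj_fun b) x) y.
Proof.
move=> cb; rewrite (act_adj _ _ (CKJ cb)); congr (dot _ (act _ _)).
by apply/funext => t; rewrite /conj_fun conjCK.
Qed.

Let cells_rel_dot x y f g : cells_rel x f -> cells_rel y g ->
  dot x y = \sum_i dot (f i) (g i).
Proof.
elim=> {x f} [|a b x f da cb _ IH] yg.
  by rewrite dot0l big1// => i _; rewrite dot0l.
have -> : \sum_i dot (cell_weight i *: act (b \o F i) (dF i a) + f i) (g i) =
    \sum_i dot (cell_weight i *: act (b \o F i) (dF i a)) (g i) + \sum_i dot (f i) (g i).
  by rewrite -big_split /=; apply: eq_bigr => i _; rewrite dotDl.
rewrite dotDl IH//; congr (_ + _) => {IH x f}.
elim: yg => {y g} [|a' b' y g da' cb' _ IH].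
  by rewrite dot0r big1// => i _; rewrite dot0r.
rewrite dotDr IH (act_adjr _ _ cb') -(act_M _ (CKJ cb') cb).
have -> : \sum_i dot (cell_weight i *: act (b \o F i) (dF i a))
    (cell_weight i *: act (b' \o F i) (dF i a') + g i) =
  \sum_i dot (cell_weight i *: act (b \o F i) (dF i a)) (cell_weight i *: act (b' \o F i) (dF i a'))
  + \sum_i dot (cell_weight i *: act (b \o F i) (dF i a)) (g i).
  by rewrite -big_split /=; apply: eq_bigr => i _; rewrite dotDr.
congr (_ + _).
have cbb : CK (fun t => conj_fun b' t * b t) by exact: (CKM (CKJ cb') cb).
rewrite (module_dot_cells cbb da da'); apply: eq_bigr => i _.
rewrite cell_weightK; congr (_ * _).
rewrite (act_adjr _ _ (@CKF _ i cb')) -(act_M _ (CKJ (@CKF _ i cb')) (@CKF _ i cb)).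
by [].
Qed.

Let cells_rel_lin l x y f g : cells_rel x f -> cells_rel y g ->
  cells_rel (l *: x + y) (fun i => l *: f i + g i).
Proof.
elim=> {x f} [|a b x f da cb _ IH] yg.
  have -> : (fun i => l *: 0 + g i) = g by apply/funext => i; rewrite scaler0 add0r.
  by rewrite scaler0 add0r.
have clb : CK (fun t => l * b t) by exact: (CKM (@CK_cst _ K l) cb).
have -> : l *: (act b (d a) + x) + y = act (fun t => l * b t) (d a) + (l *: x + y).
  by rewrite (act_scale _ _ cb) scalerDr addrA.
have -> : (fun i => l *: (cell_weight i *: act (b \o F i) (dF i a) + f i) + g i) =
    (fun i => cell_weight i *: act ((fun t => l * b t) \o F i) (dF i a) + (l *: f i + g i)).
  apply/funext => i; have -> : act ((fun t => l * b t) \o F i) (dF i a) =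
    l *: act (b \o F i) (dF i a) by exact: (act_scale _ _ (@CKF _ i cb)).
  by rewrite scalerDr addrA !scalerA mulrC.
exact: cells_cons da clb (IH yg).
Qed.

Let cells_rel_act g x f : CK g -> cells_rel x f ->
  cells_rel (act g x) (fun i => act (g \o F i) (f i)).
Proof.
move=> cg; elim=> {x f} [|a b x f da cb _ IH].
  rewrite act_0//; have -> : (fun i => act (g \o F i) 0) = (fun=> 0 : H).
    by apply/funext => i; rewrite (act_0 (@CKF _ i cg)).
  exact: cells_nil.
rewrite act_D// -act_M//.
have -> : (fun i => act (g \o F i) (cell_weight i *: act (b \o F i) (dF i a) + f i)) =
    (fun i => cell_weight i *: act ((fun t => g t * b t) \o F i) (dF i a) + act (g \o F i) (f i)).
  apply/funext => i; rewrite (act_lin _ _ _ (@CKF _ i cg)).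
  by rewrite -(act_M _ (@CKF _ i cg) (@CKF _ i cb)).
exact: cells_cons da (CKM cg cb) IH.
Qed.

Let cells_rel_dense x (e : R) : 0 < e -> exists y f, cells_rel y f /\ nm (x - y) <= e.
Proof.
move=> /(module_dense x)[n [a [b [da cb h]]]].
suff [f hf] : exists f, cells_rel (\sum_k act (b k) (d (a k))) f.
  by exists (\sum_k act (b k) (d (a k))), f.
elim: (index_enum _) => [|k s [f hf]].
  by exists (fun=> 0); rewrite big_nil; exact: cells_nil.
by rewrite big_cons; eexists; exact: cells_cons (da k) (cb k) hf.
Qed.

(** Compatibility with [act] holds on the generating sums, and both sides are bounded, so it passes
    to limits. *)
Lemma cell_isometry : exists S : 'I_N -> H -> H,
  [/\ forall i (l : C) x y, S i (l *: x + y) = l *: S i x + S i y,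
      forall x y, dot x y = \sum_i dot (S i x) (S i y),
      forall i b x, CK b -> S i (act b x) = act (b \o F i) (S i x)
    & forall i a, FD a -> S i (d a) = cell_weight i *: d (a \o F i)].
Proof.
have [S [Sl Sd Sc]] := isometric_extension Hdot cells_rel_lin cells_rel_dot cells_rel_dense.
have S_nm := nm_S_le Hdot Sd; have S_B i := lin_B (Sl i).
exists S; split => // i.
- move=> b x cb; apply/subr0_eq.
  have [m m0 hm] := CK_bounded Kss cb.
  apply: (@nm_small_eq0 _ _ _ (m + m)) => e /(cells_rel_dense x)[y [f [yf xy]]].
  have -> : S i (act b x) - act (b \o F i) (S i x) =
      S i (act b (x - y)) - act (b \o F i) (S i (x - y)).
    rewrite (act_B _ _ cb) !S_B (act_B _ _ (@CKF _ i cb)).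
    by rewrite (Sc _ _ (cells_rel_act cb yf)) (Sc _ _ yf) opprD opprK addrACA addNr addr0.
  rewrite (le_trans (nmB _ _))// mulrDl lerD//.
    rewrite (le_trans (S_nm _ _))// (le_trans (nm_act _ cb m0 hm))//.
    by rewrite ler_wpM2l.
  rewrite (le_trans (nm_act _ (@CKF _ i cb) m0 _))//; first by move=> t; exact: hm.
  by rewrite ler_wpM2l// (le_trans (S_nm _ _)).
- move=> a da; have c1 := @CK_cst _ K 1.
  have := Sc _ _ (cells_cons da c1 cells_nil) i.
  rewrite !addr0 act_1 => ->; congr (_ *: _).
  have -> : (fun=> 1) \o F i = (fun=> 1 : C) by [].
  exact: act_1.
Qed.

End Module.

(** * Orthogonal projection onto a closed subspace *)

Section OrthogonalProjection.
Context (R : realType) (H : completeNormedModType R[i]).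
Variable (dot : {dot H for Num.conj}).
Hypothesis Hdot : hilbert_inner_product dot.
Variable A : set H.
Hypothesis A0 : A 0.
Hypothesis A_lin : forall c x y, A x -> A y -> A (c *: x + y).

Lemma closure_lin c x y : closure A x -> closure A y -> closure A (c *: x + y).
Proof.
move=> /closure_nmP cx /closure_nmP cy; apply/closure_nmP => e e0.
have c0 : 0 < cmod c + 1 by rewrite ltr_wpDl// cmod_ge0.
have e1 : 0 < e / (cmod c + 1) by rewrite divr_gt0.
have [x' Ax' hx] := cx _ e1; have [y' Ay' hy] := cy _ e1.
exists (c *: x' + y'); first exact: A_lin.
have -> : c *: x + y - (c *: x' + y') = c *: (x - x') + (y - y').
  by rewrite scalerBr opprD addrACA.
rewrite (le_lt_trans (nmD _ _))// nmZ.
have -> : e = cmod c * (e / (cmod c + 1)) + e / (cmod c + 1).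
  by field; rewrite gt_eqF.
by rewrite ler_ltD// ler_wpM2l ?cmod_ge0// ltW.
Qed.

Local Notation P := (orth_proj dot (closure A)).

Lemma orth_projP x : closure A (P x) /\ forall v, closure A v -> dot (x - P x) v = 0.
Proof.
have [||y Wy hy] := @projection_theorem _ _ _ Hdot (closure A) x _ closure_lin.
- exact: subset_closure.
- move=> z /closure_nmP cz; apply/closure_nmP => e e0.
  have e2 : 0 < e / 2 by rewrite divr_gt0.
  have [z' /closure_nmP/(_ _ e2)[w Aw zw] zz] := cz _ e2; exists w => //.
  by rewrite (le_lt_trans (nm_dist_tri z' _ _))// [ltRHS](splitr e) ltrD.
rewrite /orth_proj; case: xgetP => [z _ [] //|/(_ y)]; by case.
Qed.

Lemma orth_proj_in x : closure A (P x). Proof. by case: (orth_projP x). Qed.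

Lemma orth_proj_dot x v : closure A v -> dot (P x) v = dot x v.
Proof.
by move=> /(orth_projP x).2; rewrite dotBl => /subr0_eq ->.
Qed.

Lemma orth_proj_unique x y : closure A y -> (forall v, A v -> dot (x - y) v = 0) -> P x = y.
Proof.
move=> cy hy; apply/subr0_eq/nm_eq0/eqP; rewrite -sqrf_eq0 (nm_sq Hdot).
have cPy : closure A (P x - y).
  by rewrite addrC -scaleN1r; apply: closure_lin => //; exact: orth_proj_in.
rewrite {1}dotBl (orth_proj_dot _ cPy) -dotBl dotC.
by rewrite (@dot_closure _ _ _ Hdot A) ?conjC0// => v Av; apply: dot_eq0C; exact: hy.
Qed.

Lemma orth_proj_lin c x y : P (c *: x + y) = c *: P x + P y.
Proof.
apply: orth_proj_unique; first by apply: closure_lin; exact: orth_proj_in.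
move=> v /subset_closure cv.
rewrite dotBl !dotDl !dotZl !(orth_proj_dot _ cv); exact: subrr.
Qed.

Lemma orth_proj_adj x y : dot (P x) y = dot x (P y).
Proof.
have Px := @orth_proj_in x; have Py := @orth_proj_in y.
by rewrite -(orth_proj_dot x Py) [LHS]dotC -(orth_proj_dot y Px) -dotC.
Qed.

Lemma nm_orth_proj x : nm (P x) <= nm x.
Proof.
rewrite -(ler_pXn2r (n:=2)) ?nnegrE ?nm_ge0//.
have -> : x = P x + (x - P x) by rewrite subrKC.
rewrite (nm_pythagoras Hdot); first by rewrite subrKC lerDl sqr_ge0.
by apply: dot_eq0C; apply: (orth_projP x).2; exact: orth_proj_in.
Qed.

End OrthogonalProjection.

(** * Bump polynomials *)

Section Bumps.
Context (R : realType).

(** The two terms are the probabilities of no success and of exactly one success in [n.+1]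
    independent trials with success probability [s]. *)
Lemma bernoulli_mass (s : R) n : 0 <= s <= 1 ->
  (1 - s) ^+ n.+1 + n.+1%:R * s * (1 - s) ^+ n <= 1.
Proof.
move=> /andP[s0 s1]; have t0 : 0 <= 1 - s by rewrite subr_ge0.
elim: n => [|n IH]; first by rewrite expr1 expr0 mul1r mulr1 subrK.
have t1 : (1 - s) ^+ n.+1 <= 1 by rewrite exprn_ile1// lerBlDl lerDr.
have -> : (1 - s) ^+ n.+2 + n.+2%:R * s * (1 - s) ^+ n.+1 =
    (1 - s) * ((1 - s) ^+ n.+1 + n.+1%:R * s * (1 - s) ^+ n) + s * (1 - s) ^+ n.+1.
  by rewrite -[n.+2%:R]natr1 [(1 - s) ^+ n.+2]exprS [(1 - s) ^+ n.+1]exprS; ring.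
rewrite (le_trans (y := (1 - s) * 1 + s * 1))//; last by rewrite !mulr1 subrK.
by rewrite lerD// ler_wpM2l.
Qed.

(* Polynomials with derivative 1 at the origin which tend to zero uniformly on
   [-1, 1] while their derivatives remain bounded. *)
Definition bump_poly n : {poly R} := 'X * (1 - 'X^2) ^+ n.+1.

Lemma bump_polyE n (t : R) : (bump_poly n).[t] = t * (1 - t ^+ 2) ^+ n.+1.
Proof. by rewrite /bump_poly !hornerE. Qed.

Lemma bump_derivE n (t : R) : (bump_poly n)^`().[t] =
  (1 - t ^+ 2) ^+ n.+1 - 2 * (n.+1%:R * t ^+ 2 * (1 - t ^+ 2) ^+ n).
Proof.
rewrite /bump_poly derivM derivX deriv_exp derivB derivC derivXn !hornerE /=.
rewrite hornerMn hornerM hornerN hornerMn hornerXn expr1 horner_exp !hornerE.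
by rewrite -mulr_natr -[t *+ 2]mulr_natr; ring.
Qed.

Lemma bump_deriv0 n : (bump_poly n)^`().[0] = 1.
Proof. by rewrite bump_derivE expr0n subr0 expr1n mulr0 mul0r mulr0 subr0. Qed.

(** With s = t^2 the derivative is x - 2 y, where [x] and [y] are the two nonnegative terms of
    [bernoulli_mass], so it lies between -2 and 1. *)
Lemma bump_deriv_le n (t : R) : `|t| <= 1 -> `|(bump_poly n)^`().[t]| <= 2.
Proof.
move=> t1; have s1 : 0 <= t ^+ 2 <= 1.
  by rewrite sqr_ge0 -real_normK ?num_real// exprn_ile1.
have := bernoulli_mass n s1; rewrite bump_derivE.
have x0 : 0 <= (1 - t ^+ 2) ^+ n.+1 by rewrite exprn_ge0// subr_ge0; case/andP: s1.
have y0 : 0 <= n.+1%:R * t ^+ 2 * (1 - t ^+ 2) ^+ n.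
  apply: mulr_ge0; first by rewrite mulr_ge0 ?sqr_ge0.
  by rewrite exprn_ge0// subr_ge0; case/andP: s1.
move: x0 y0; set x := (1 - _) ^+ n.+1; set y := _ * (1 - _) ^+ n => x0 y0 xy.
by rewrite ler_norml; apply/andP; split; lra.
Qed.

Lemma bump_small (e : R) : 0 < e -> exists n0, forall n (t : R),
  (n0 <= n)%N -> `|t| <= 1 -> `|(bump_poly n).[t]| <= e.
Proof.
move=> e0; have [|n0 hn0] := @exists_inv_lt _ (e ^+ 2); first by rewrite exprn_gt0.
exists n0 => n t n0n t1.
rewrite -(ler_pXn2r (n:=2)) ?nnegrE ?(ltW e0)// real_normK ?num_real//.
rewrite bump_polyE exprMn -exprM.
have s1 : 0 <= t ^+ 2 <= 1.
  by rewrite sqr_ge0 -real_normK ?num_real// exprn_ile1.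
have q0 : 0 <= 1 - t ^+ 2 by rewrite subr_ge0; case/andP: s1.
(* The squared polynomial is s (1 - s)^(2 n + 2), which is the one-success probability in 2 n + 3
   trials divided by 2 n + 3. *)
have := bernoulli_mass (n.+1 * 2) s1.
have := exprn_ge0 (n.+1 * 2).+1 q0; set x := (1 - _) ^+ _.+1; set y := (1 - _) ^+ _ => x0 xy.
have m0 : 0 < (n.+1 * 2).+1%:R :> R by rewrite ltr0n.
have : (n.+1 * 2).+1%:R * (t ^+ 2 * y) <= 1 by rewrite mulrA; lra.
rewrite mulrC -ler_pdivlMr// => /le_trans; apply.
rewrite mul1r (le_trans _ (ltW hn0))// lef_pV2 ?posrE// ler_nat.
by rewrite ltnS (leq_trans n0n)// muln2 -addnn (leq_trans (leqnSn n))// leq_addr.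
Qed.

End Bumps.

(** * No vector is carried by the boundary points *)

Section Surjectivity.
Context (R : realType) (K : pseudoPMetricType R) (N : nat).
Variables (F : 'I_N -> K -> K) (pi : shift_space N -> K).
Hypothesis Kss : self_similar_structure F pi.
Hypothesis Kpcf : pcf F pi.
Variables (D : K -> K -> R) (r : 'I_N -> R).
Hypothesis Dr : harmonic_structure F pi D r.
Hypothesis reg : regular_structure r.
Context (H : completeNormedModType R[i]) (dot : {dot H for Num.conj}).
Hypothesis Hdot : hilbert_inner_product dot.
Variables (act : (K -> R[i]) -> H -> H) (d : (K -> R[i]) -> H) (J : H -> H).
Hypothesis act_rep : star_representation dot act.
Hypothesis d_der : derivation F pi D r act d.
Hypothesis J_inv : antilinear_involution F pi D r act d J.

Local Notation C := R[i].
Local Notation rd := (real_domain F pi D r).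
Local Notation FD := (form_domain F pi D r).
Local Notation V0 := (V0 F pi).
Local Notation lim_energy u := (limn (energy_m F pi D r ^~ u)).
Local Notation P := (orth_proj dot (closure (d @` FD))).
Local Notation cst u := (fun t : K => (u t)%:C%C : C).
Implicit Types (a b c : K -> C) (u v : K -> R) (x y z : H).

Let r0 i : 0 < r i. Proof. by case: Dr. Qed.
Let real u (du : rd u) : FD (cst u) := form_domain_real Kpcf Dr du.
Let realC u (du : rd u) : CK (cst u) := form_domain_CK (form_domain_real Kpcf Dr du).

Lemma dW0 : (d @` FD) 0.
Proof.
exists (fun=> 0); first exact: (form_domain_cst Kpcf Dr).
exact: (d_cst Kpcf Dr d_der).
Qed.

Lemma dW_lin l x y : (d @` FD) x -> (d @` FD) y -> (d @` FD) (l *: x + y).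
Proof.
move=> [a da <-] [b db <-]; exists (fun t => l * a t + b t).
  exact: (form_domain_lin Kpcf Dr).
exact: (d_lin d_der).
Qed.

Let conj_real u : conj_fun (cst u) = cst u.
Proof. by apply/funext => t; apply/eqP; rewrite eq_complex /= oppr0 !eqxx. Qed.

Lemma dot_d_real u v : rd u -> rd v -> dot (d (cst u)) (d (cst v)) =
  ((lim_energy (fun t => u t + v t) - lim_energy u - lim_energy v) / 2)%:C%C.
Proof.
move=> du dv; have fu := real du; have fv := real dv.
have /eqP : nm (d (cst u) + d (cst v)) ^+ 2 = lim_energy (fun t => u t + v t).
  rewrite -(d_D d_der fu fv) -(energy_real Kpcf Dr) -(nm_d d_der).
    by congr (nm (d _) ^+ 2); apply/funext => t; rewrite rmorphD.
  have -> : cst (fun t => u t + v t) = (fun t => cst u t + cst v t).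
    by apply/funext => t; rewrite rmorphD.
  exact: (form_domainD Kpcf Dr fu fv).
rewrite (nm_sqD Hdot) !(nm_d d_der)// !(energy_real Kpcf Dr) => /eqP h.
have [Jl Jn _ Jact Jd] := J_inv.
have sym : dot (d (cst u)) (d (cst v)) = dot (d (cst v)) (d (cst u)).
  by rewrite -(dot_J Hdot J_inv) (Jd _ fu) (Jd _ fv) !conj_real.
have im0 : complex.Im (dot (d (cst u)) (d (cst v))) = 0.
  have : complex.Im (dot (d (cst u)) (d (cst v))) = - complex.Im (dot (d (cst u)) (d (cst v))).
    by rewrite -ImJ {1}sym dotC.
  by lra.
rewrite (complexRI (dot _ _)) im0 mulr0 addr0; congr (_%:C)%C.
by rewrite -h; lra.
Qed.

(** Only the projection of [x] onto the closed image of [d] matters. It is approximated by some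
    [d a], and [energy_weak_null] applies to the real and imaginary parts of [a]. *)
Lemma d_weak_null (u : nat -> K -> R) (B : R) x : (forall n, rd (u n)) ->
  (forall n, nm (d (cst (u n))) <= B) ->
  (forall e : R, 0 < e -> exists n0, forall n t, (n0 <= n)%N -> `|u n t| <= e) ->
  forall e : R, 0 < e -> exists n, cmod (dot (d (cst (u n))) x) <= e.
Proof.
move=> du uB u0 e e0.
have B0 : 0 <= B by rewrite (le_trans (nm_ge0 _) (uB 0%N)).
have uE n : lim_energy (u n) <= B ^+ 2.
  rewrite -(energy_real Kpcf Dr) -(nm_d d_der); last exact: real.
  by rewrite ler_pXn2r ?nnegrE ?nm_ge0.
have hreal v (e1 : R) : rd v -> 0 < e1 -> exists n0, forall n, (n0 <= n)%N ->
    cmod (dot (d (cst (u n))) (d (cst v))) <= e1.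
  move=> dv e10; have [n0 hn0] := energy_weak_null Kpcf Dr du dv uE u0 e10.
  exists n0 => n /hn0 h; rewrite dot_d_real// cmod_real normrM normfV.
  rewrite (@ger0_norm _ 2)// (le_trans _ h)// ler_piMr//.
  by rewrite invf_le1//; lra.
pose y := P x.
have dP n : dot (d (cst (u n))) x = dot (d (cst (u n))) y.
  rewrite /y -(orth_proj_adj Hdot dW0 dW_lin).
  congr (dot _ x); apply/esym/(orth_proj_unique Hdot dW0 dW_lin).
    by apply: subset_closure; exists (cst (u n)) => //; exact: real.
  by move=> v _; rewrite subrr dot0l.
have [cl _] := orth_projP Hdot dW0 dW_lin x.
have q0 : 0 < B + 1 by rewrite ltr_wpDl.
have e3 : 0 < e / 3 by rewrite divr_gt0.
have [|_ [a da <-] ya] := (closure_nmP _ _).1 cl (e / 3 / (B + 1)); first by rewrite divr_gt0.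
have [ar ai] := (form_domainP F pi D r a).1 da.
have [n1 h1] := hreal _ _ ar e3; have [n2 h2] := hreal _ _ ai e3.
exists (n1 + n2)%N; rewrite dP -[y](subrK (d a)) dotDr.
have e_eq : e = e / 3 + (e / 3 + e / 3) by lra.
rewrite [leRHS]e_eq (le_trans (cmodD _ _))// lerD//.
  rewrite (le_trans (cauchy_schwarz Hdot _ _))//.
  rewrite (le_trans (y := B * (e / 3 / (B + 1))))//.
    by rewrite ler_pM ?nm_ge0// ltW.
  by rewrite mulrCA ler_piMr ?(ltW e3)// ler_pdivrMr// mul1r lerDl.
have -> : d a = ii R *: d (cst (fun t => complex.Im (a t))) + d (cst (fun t => complex.Re (a t))).
  rewrite -(d_lin d_der); [|exact: real..].
  by congr d; apply/funext => t; rewrite {1}(complexRI (a t)) addrC.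
rewrite dotDr dotZr (le_trans (cmodD _ _))// lerD//; last by apply: h1; exact: leq_addr.
rewrite cmodM cmodJ.
have -> : cmod (ii R) = 1.
  apply/eqP; rewrite -(@eqrXn2 _ 2) ?cmod_ge0//; rewrite cmod_sq /=.
  by rewrite !expr0n !expr1n add0r.
by rewrite mul1r; apply: h2; exact: leq_addl.
Qed.

(** The Leibniz rule along the Horner scheme: passing from p to p X + l multiplies by [u] and adds a
    constant, which [d] kills. *)
Lemma chain_rule (p : {poly R}) u : rd u ->
  rd (fun t => p.[u t]) /\ d (cst (fun t => p.[u t])) = act (cst (fun t => p^`().[u t])) (d (cst u)).
Proof.
move=> du; have fu := real du; have cu := realC du.
suff [f [g [fE gE df dg h]]] : exists f g, [/\ f = (fun t => p.[u t]),
    g = (fun t => p^`().[u t]), rd f, rd g & d (cst f) = act (cst g) (d (cst u))].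
  by rewrite fE gE in df h; split.
elim/poly_ind: p => [|p l [f [g [fE gE df dg IH]]]].
  have d0 := real_domain_cst Kpcf Dr 0.
  exists (fun=> 0), (fun=> 0); split => //.
  - by apply/funext => t; rewrite horner0.
  - by apply/funext => t; rewrite deriv0 horner0.
  by rewrite (d_cst Kpcf Dr d_der) (act_zero act_rep).
have dfu := real_domain_mul Kss Kpcf Dr df du.
have dgu := real_domain_mul Kss Kpcf Dr dg du.
exists (fun t => 1 * (f t * u t) + l), (fun t => 1 * (g t * u t) + f t); split.
- by apply/funext => t; rewrite hornerMXaddC mul1r fE.
- apply/funext => t; rewrite derivD derivC addr0 derivM derivX mulr1 hornerD hornerM hornerX mul1r.
  by rewrite fE gE.
- exact: (real_domain_lin Kpcf Dr 1 dfu (real_domain_cst Kpcf Dr l)).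
- exact: (real_domain_lin Kpcf Dr 1 dgu df).
have -> : cst (fun t => 1 * (f t * u t) + l) = (fun t => 1 * (cst f t * cst u t) + l%:C%C).
  by apply/funext => t; rewrite rmorphD !rmorphM.
have ff := real df; have ffu := form_domainM Kss Kpcf Dr ff fu.
rewrite (d_lin d_der _ ffu (form_domain_cst Kpcf Dr _)) (d_cst Kpcf Dr d_der) addr0 scale1r.
rewrite (d_leibniz d_der ff fu) IH.
have -> : cst (fun t => 1 * (g t * u t) + f t) = (fun t => 1 * (cst u t * cst g t) + cst f t).
  by apply/funext => t; rewrite rmorphD !rmorphM [(g t)%:C%C * _]mulrC.
have cg := realC dg.
rewrite (act_comb act_rep _ _ (CKM cu cg) (realC df)) scale1r.
by rewrite (act_M act_rep _ cu cg).
Qed.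

(* If [z] annihilates [act b (d a)] whenever [b] vanishes on the finite set
   [V0], then [dot (act b (d a)) z] depends on [b] through [b|V0] only. Near a
   point [p] of [V0], [d (u - u p)] may thus be replaced by [d (bump_poly n (u - u p))],
   which tends weakly to zero. *)
Lemma vanishing_total z :
  (forall a b, FD a -> CK b -> (forall p, V0 p -> b p = 0) -> dot (act b (d a)) z = 0) -> z = 0.
Proof.
move=> hz.
have ext a b b' : FD a -> CK b -> CK b' -> (forall p, V0 p -> b p = b' p) ->
    dot (act b (d a)) z = dot (act b' (d a)) z.
  move=> da cb cb' bb'; apply/subr0_eq.
  have cbb : CK (fun t => -1 * b' t + b t) by exact: (CKD (CKM (@CK_cst _ K (-1)) cb') cb).
  rewrite -dotBl addrC -scaleN1r -(act_comb act_rep _ _ cb' cb); apply: hz => // p Vp.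
  by rewrite bb'// mulN1r addNr.
have point p u e : rd u -> rd e -> V0 p -> (forall q, V0 q -> e q = (q == p)%:R) ->
    dot (act (cst e) (d (cst u))) z = 0.
  move=> du de Vp he.
  have [A A0 hA] := continuous_bounded Kss du.1.
  (* This scaling brings [g] into [-1, 1], where the bump polynomials are controlled, with value 0
     at [p]. *)
  pose k : R := (2 * A + 1)^-1; have k0 : 0 < k by rewrite invr_gt0; lra.
  pose g t := k * u t + - k * u p.
  have dg : rd g by exact: (real_domain_lin Kpcf Dr k du (real_domain_cst Kpcf Dr _)).
  have g1 t : `|g t| <= 1.
    rewrite /g mulNr -mulrBr normrM gtr0_norm// /k ler_pdivrMl ?mulr1; last by lra.
    by rewrite (le_trans (ler_normB _ _))//; have := hA t; have := hA p; lra.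
  have gp : g p = 0 by rewrite /g mulNr subrr.
  have fg := real dg; have fu := real du; have ce := realC de.
  have dgE : d (cst g) = k%:C%C *: d (cst u).
    have -> : cst g = (fun t => k%:C%C * cst u t + (- k * u p)%:C%C).
      by apply/funext => t; rewrite /g rmorphD rmorphM.
    by rewrite (d_lin d_der _ fu (form_domain_cst Kpcf Dr _)) (d_cst Kpcf Dr d_der) addr0.
  suff l0 : dot (act (cst e) (d (cst g))) z = 0.
    move: l0; rewrite dgE (act_Z act_rep _ _ ce) dotZl => /eqP; rewrite mulf_eq0 => /orP[|/eqP//].
    by rewrite (inj_eq (@complexI R) _ 0) gt_eqF.
  pose w n t := (bump_poly R n).[g t].
  have ch n := chain_rule (bump_poly R n) dg.
  have cbd n : CK (cst (fun t => (bump_poly R n)^`().[g t])).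
    apply: CK_real => t; apply: continuous_comp; first exact: dg.1.
    exact: continuous_horner.
  (* On [V0] the weight [e] lives at [p] alone, and there the derivative of the bump polynomial at
     [g p] is 1. By [ext] it may be inserted for every [n], and the left side does not depend on
     [n]. *)
  have key n : dot (act (cst e) (d (cst g))) z = dot (d (cst (w n))) (act (cst e) z).
    have -> : dot (d (cst (w n))) (act (cst e) z) = dot (act (cst e) (d (cst (w n)))) z.
      by rewrite (act_adj act_rep _ _ ce) conj_real.
    rewrite (ch n).2 -(act_M act_rep _ ce (cbd n)).
    apply: (ext _ _ _ fg ce (CKM ce (cbd n))) => q Vq; rewrite he//; have [->|_] := eqVneq q p; last by rewrite mul0r.
    by rewrite gp bump_deriv0 mulr1.
  apply: (@cmod_small_eq0 _ _ 1) => eps eps0.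
  have [|||n hn] := @d_weak_null w (2 * nm (d (cst g))) (act (cst e) z) _ _ _ eps eps0.
  - by move=> n; exact: (ch n).1.
  - move=> n; rewrite (ch n).2.
    apply: (nm_act Hdot act_rep d_der _ (cbd n)) => // t; rewrite cmod_real.
    exact: bump_deriv_le.
  - move=> e1 e10; have [n0 hn0] := bump_small e10; exists n0 => n t n0n.
    exact: hn0.
  by rewrite (key n) mul1r.
have all_real u b : rd u -> CK b -> dot (act b (d (cst u))) z = 0.
  move=> du; have fu := real du.
  have fin := V0_finite Kpcf.
  (* The list [s] contains the boundary points where [c] may be nonzero; subtracting c(p) times the
     function [e] of [point] removes one of them at a time. *)
  suff claim (s : seq K) c : CK c -> (forall q, V0 q -> q \notin s -> c q = 0) ->
      dot (act c (d (cst u))) z = 0.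
    have /finite_seqP[s V0s] := fin.
    move=> cb; apply: (claim s) => // q Vq /negP; case.
    by move: Vq; rewrite V0s.
  elim: s c => [|p s IH] c cc hc; first by apply: hz => // q Vq; exact: hc.
  have [Vp|nVp] := pselect (V0 p); last first.
    apply: IH => // q Vq qs; apply: hc => //; rewrite inE negb_or qs andbT.
    by apply/eqP => qp; apply: nVp; rewrite -qp.
  have [e de he] := form_domain_interpolate Kss Kpcf Dr reg p.
  have ce := realC de; have ceC : CK (fun t => - c p * cst e t).
    exact: (CKM (@CK_cst _ K (- c p)) ce).
  have cc' : CK (fun t => - c p * cst e t + c t) by exact: (CKD ceC cc).
  have := IH _ cc'; rewrite (act_comb act_rep _ _ ce cc) dotDl dotZl (point p)// mulr0 add0r.
  apply => q Vq qs; rewrite he//; have [->|qp] := eqVneq q p.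
    by rewrite mulr1 addNr.
  by rewrite mulr0 add0r hc// inE negb_or qp.
apply: (module_total Hdot d_der) => a b da cb.
have [ar ai] := (form_domainP F pi D r a).1 da.
have -> : d a = ii R *: d (cst (fun t => complex.Im (a t))) + d (cst (fun t => complex.Re (a t))).
  rewrite -(d_lin d_der); [|exact: real..].
  by congr d; apply/funext => t; rewrite {1}(complexRI (a t)) addrC.
by rewrite (act_lin act_rep _ _ _ cb) dotDl dotZl !all_real// mulr0 addr0.
Qed.

Variable S : 'I_N -> H -> H.
Hypothesis S_linear : forall i (l : C) x y, S i (l *: x + y) = l *: S i x + S i y.
Hypothesis dot_S : forall x y, dot x y = \sum_i dot (S i x) (S i y).
Hypothesis S_act : forall i b x, CK b -> S i (act b x) = act (b \o F i) (S i x).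
Hypothesis S_d : forall i a, FD a -> S i (d a) = cell_weight r i *: d (a \o F i).

Let S0 i : S i 0 = 0 := lin_0 (S_linear i).
Let S_B i x y : S i (x - y) = S i x - S i y := lin_B (S_linear i) x y.
Let S_nm i x : nm (S i x) <= nm x := nm_S_le Hdot dot_S i x.

Let only i x := forall j, j != i -> S j x = 0.

Let only_nm i x : only i x -> nm x = nm (S i x).
Proof.
move=> ox; apply/eqP; rewrite -(@eqrXn2 _ 2) ?nm_ge0// (nm_sq_S Hdot dot_S x).
by rewrite (bigD1 i)//= big1 ?addr0// => j ji; rewrite ox// nm0 expr0n.
Qed.

(** On vectors with a single nonzero component [S i] preserves norms, so its range [W] there is a
    closed subspace. A vector orthogonal to [W] annihilates every [act b (d a)] with [b] zero on
    [V0], hence is 0 by [vanishing_total]. *)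
Lemma cell_component_exists i y : exists x, S i x = y /\ forall j, j != i -> S j x = 0.
Proof.
pose W := [set y | exists x, S i x = y /\ only i x].
have W0 : W 0 by exists 0; split; [exact: S0|move=> j _; exact: S0].
have W_lin l z z' : W z -> W z' -> W (l *: z + z').
  move=> [x [<- ox]] [x' [<- ox']]; exists (l *: x + x'); split; first exact: S_linear.
  by move=> j ji; rewrite S_linear ox// ox'// scaler0 addr0.
have W_closed : closure W `<=` W.
  move=> z /closure_nmP cz.
  have /choice[x hx] : forall n : nat, exists x, only i x /\ nm (z - S i x) <= n.+1%:R^-1.
    move=> n; have [|_ [x [<- ox]] h] := cz n.+1%:R^-1; first by rewrite invr_gt0.
    by exists x; split => //; exact: ltW.
  have inv_le m n : (n <= m)%N -> m.+1%:R^-1 <= n.+1%:R^-1 :> R.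
    by move=> nm; rewrite lef_pV2 ?posrE// ler_nat.
  have [e e0|l hl] := nm_complete (u := x).
    have [|n hn] := @exists_inv_lt _ (e / 2); first by rewrite divr_gt0.
    exists n => m nm'; rewrite (only_nm (i:=i)); last first.
      by move=> j ji; rewrite S_B (hx m).1// (hx n).1// subrr.
    rewrite S_B (le_trans (nm_dist_tri z _ _))// [leRHS](splitr e) lerD//.
      by rewrite nm_distrC (le_trans (hx m).2)// (le_trans (inv_le _ _ nm'))// ltW.
    by rewrite (le_trans (hx n).2)// ltW.
  exists l; split => [|j ji].
    apply/subr0_eq; apply: (@nm_small_eq0 _ _ _ 2) => e e0.
    have [n1 h1] := hl e e0; have [n2 h2] := exists_inv_lt e0.
    rewrite (le_trans (nm_dist_tri (S i (x (n1 + n2)%N)) _ _))// mulr2n mulrDl mul1r lerD//.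
      by rewrite -S_B (le_trans (S_nm _ _))// nm_distrC h1// leq_addr.
    rewrite nm_distrC (le_trans (hx _).2)// (le_trans (inv_le _ n2 _)) ?leq_addl//.
    exact: ltW.
  apply: (@nm_small_eq0 _ _ _ 1) => e e0; have [n hn] := hl e e0.
  rewrite -[S j l]subr0 -((hx n).1 j ji) -S_B (le_trans (S_nm _ _))// nm_distrC mul1r.
  exact: hn.
have [y0 Wy0 hy0] := projection_theorem Hdot y W0 W_lin W_closed.
suff z0 : y - y0 = 0 by move/subr0_eq: z0 => ->.
apply: vanishing_total => a b da cb b0; apply: dot_eq0C; apply: hy0.
(* [a] is extended arbitrarily within the domain and [b] by zero, which stays continuous as [b]
   vanishes on [V0]. The product then lives on the cell [i] alone. *)
have [u du ua] := form_domain_extend Kss Kpcf Dr reg i da.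
have [g cg gb] := CK_extend0 Kss i cb b0.
have rw0 : cell_weight r i != 0.
  rewrite /cell_weight (inj_eq (@complexI R) _ 0) invr_eq0 gt_eqF// sqrtr_gt0.
  exact: r0.
exists ((cell_weight r i)^-1 *: act g (d u)).
have SE j : S j ((cell_weight r i)^-1 *: act g (d u)) =
    (cell_weight r i)^-1 *: act (g \o F j) (S j (d u)).
  by rewrite -[X in S j X]addr0 S_linear S0 addr0 S_act.
split => [|j ji]; rewrite SE gb.
  by rewrite eqxx S_d// ua (act_Z act_rep _ _ cb) scalerA mulVf// scale1r.
by rewrite (negbTE ji) (act_zero act_rep) scaler0.
Qed.

End Surjectivity.

(** * The phase and its commutators *)

Section Commutator.
Context (R : realType) (K : pseudoPMetricType R) (N : nat).
Variables (F : 'I_N -> K -> K) (pi : shift_space N -> K).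
Hypothesis Kss : self_similar_structure F pi.
Hypothesis Kpcf : pcf F pi.
Variables (D : K -> K -> R) (r : 'I_N -> R).
Hypothesis Dr : harmonic_structure F pi D r.
Hypothesis reg : regular_structure r.
Context (H : completeNormedModType R[i]) (dot : {dot H for Num.conj}).
Hypothesis Hdot : hilbert_inner_product dot.
Variables (act : (K -> R[i]) -> H -> H) (d : (K -> R[i]) -> H).
Hypothesis act_rep : star_representation dot act.
Hypothesis d_der : derivation F pi D r act d.

Local Notation C := R[i].
Local Notation rd := (real_domain F pi D r).
Local Notation FD := (form_domain F pi D r).
Local Notation V0 := (V0 F pi).
Local Notation P := (phase_proj F pi D r dot d).
Local Notation T := (phase_commutator F pi D r dot act d).
Local Notation cst u := (fun t : K => (u t)%:C%C : C).
Implicit Types (a b : K -> C) (u v : K -> R) (x y z : H).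

Let dW0 := dW0 Kpcf Dr d_der.
Let dW_lin := dW_lin Kpcf Dr d_der.

Let P_lin l x y : P (l *: x + y) = l *: P x + P y.
Proof. exact: (orth_proj_lin Hdot dW0 dW_lin). Qed.

Let P_adj x y : dot (P x) y = dot x (P y).
Proof. exact: (orth_proj_adj Hdot dW0 dW_lin). Qed.

Let P_in x : closure (d @` FD) (P x).
Proof. exact: (orth_proj_in Hdot dW0 dW_lin). Qed.

Let P_unique x y : closure (d @` FD) y -> (forall a, FD a -> dot (x - y) (d a) = 0) -> P x = y.
Proof.
move=> cy h; apply: (orth_proj_unique Hdot dW0 dW_lin) => // _ [a da <-].
exact: h.
Qed.

Let P_id x : closure (d @` FD) x -> P x = x.
Proof. by move=> cx; apply: P_unique => // a _; rewrite subrr dot0l. Qed.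

Let nm_P x : nm (P x) <= nm x.
Proof. exact: (nm_orth_proj Hdot dW0 dW_lin). Qed.

(** [phase] is 2 P - 1, and the identity commutes with everything. *)
Lemma phase_commutatorE a x : CK a -> T a x = 2 *: (P (act a x) - act a (P x)).
Proof.
move=> ca; rewrite /phase_commutator /phase !(act_B act_rep _ _ ca).
move: (act a x) (act a (P x)) (P (act a x)) => s q p.
rewrite scaler_nat mulr2n (opprB s p) (opprB s q) opprD addrACA; congr (_ + _).
by rewrite opprB subrKA.
Qed.

Lemma phase_commutator_adj a : CK a ->
  adjoint_pair dot (T a) (fun x => - T (conj_fun a) x).
Proof.
move=> ca x y; have cJa := CKJ ca.
rewrite (phase_commutatorE _ ca) (phase_commutatorE _ cJa) dotNr dotZl dotZr rmorph_nat.
rewrite dotBl dotBr P_adj (act_adj act_rep _ _ ca) (act_adj act_rep _ _ ca) P_adj.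
by rewrite -mulrN opprB.
Qed.

(** Subtracting the constant [l] from [a] leaves the commutator unchanged. The 4 comes from the
    factor 2 in [phase_commutatorE] and the two terms of a commutator. *)
Lemma nm_phase_commutator a (l : C) (e : R) x : CK a -> 0 <= e ->
  (forall t, cmod (a t - l) <= e) -> nm (T a x) <= 4 * e * nm x.
Proof.
move=> ca e0 he; have cl := @CK_cst _ K (- l).
have cal : CK (fun t => a t + - l) by exact: (CKD ca cl).
have actE z : act a z = act (fun t => a t + - l) z + l *: z.
  have -> : act (fun t => a t + - l) z = act a z + act (fun=> - l) z.
    rewrite -[act a z]scale1r -(act_comb act_rep _ _ ca cl); congr act.
    by apply/funext => t; rewrite mul1r.
  by rewrite (act_cst Hdot act_rep d_der) scaleNr subrK.
rewrite (phase_commutatorE _ ca) (actE x) (actE (P x)).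
have -> : P (act (fun t => a t + - l) x + l *: x) = P (act (fun t => a t + - l) x) + l *: P x.
  by rewrite addrC P_lin addrC.
rewrite opprD addrACA subrr addr0 nmZ.
have -> : cmod (2 : C) = 2.
  have -> : 2 = (2 : R)%:C%C :> C by rewrite rmorph_nat.
  by rewrite cmod_real ger0_norm.
have nma z : nm (act (fun t => a t + - l) z) <= e * nm z.
  exact: (nm_act Hdot act_rep d_der _ cal e0 he).
have h1 := le_trans (nm_P _) (nma x).
have h2 : nm (act (fun t => a t + - l) (P x)) <= e * nm x.
  by rewrite (le_trans (nma _))// ler_wpM2l.
have := nmB (P (act (fun t => a t + - l) x)) (act (fun t => a t + - l) (P x)).
lra.
Qed.

Variables (S V : 'I_N -> H -> H).
Hypothesis S_linear : forall i (l : C) x y, S i (l *: x + y) = l *: S i x + S i y.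
Hypothesis dot_S : forall x y, dot x y = \sum_i dot (S i x) (S i y).
Hypothesis S_act : forall i b x, CK b -> S i (act b x) = act (b \o F i) (S i x).
Hypothesis S_d : forall i a, FD a -> S i (d a) = cell_weight r i *: d (a \o F i).
Hypothesis S_V : forall i j y, S j (V i y) = if j == i then y else 0.

Let r0 i : 0 < r i. Proof. by case: Dr. Qed.

Let S_Z i l x : S i (l *: x) = l *: S i x := lin_Z (S_linear i) l x.
Let S_B i x y : S i (x - y) = S i x - S i y := lin_B (S_linear i) x y.

Let weight_neq0 i : cell_weight r i != 0.
Proof.
rewrite /cell_weight (inj_eq (@complexI R) _ 0) invr_eq0 gt_eqF// sqrtr_gt0.
exact: r0.
Qed.

Let S_closure i x : closure (d @` FD) x -> closure (d @` FD) (S i x).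
Proof.
move=> /closure_nmP cx; apply/closure_nmP => e /cx[_ [a da <-] xa].
have fa := (form_domain_cells Kss Dr a).1 da i.
exists (S i (d a)).
  rewrite S_d// -(d_Z Kpcf Dr d_der _ fa); eexists; last reflexivity.
  exact: (form_domainZ Kpcf Dr).
by rewrite -S_B (le_lt_trans _ xa)// (nm_S_le Hdot dot_S).
Qed.

Let V_vanishing i a : FD a -> (forall p, V0 p -> a p = 0) -> closure (d @` FD) (V i (d a)).
Proof.
move=> da a0; have [u du hu] := form_domain_extend0 Kss Kpcf Dr i da a0.
suff -> : V i (d a) = d (fun t => (cell_weight r i)^-1 * u t).
  apply: subset_closure; eexists; last reflexivity.
  exact: (form_domainZ Kpcf Dr).
apply: (dot_ext Hdot) => z; rewrite !dot_S; apply: eq_bigr => j _; congr (dot _ _).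
rewrite S_V (d_Z Kpcf Dr d_der _ du) S_Z S_d// hu.
have [->|_] := eqVneq j i; first by rewrite scalerA mulVf ?weight_neq0// scale1r.
by rewrite (d_cst Kpcf Dr d_der) !scaler0.
Qed.

Let e_ex p : exists u, rd u /\ forall q, V0 q -> u q = (q == p)%:R.
Proof. by have [u du hu] := form_domain_interpolate Kss Kpcf Dr reg p; exists u. Qed.

(* The finite-rank defect between the projection [P] of [H] and the direct sum
   of its copies on the cells. *)
Lemma phase_defect : exists Y : seq H, forall x, (forall y, y \in Y -> dot x y = 0) ->
  forall i, S i (P x) = P (S i x).
Proof.
have [e he] := choice e_ex; have /finite_seqP[s V0s] := V0_finite Kpcf.
pose z i p := V i (d (cst (e p))).
(* Orthogonality of [x] to z - P z says that x - P x is orthogonal to z, because [P] is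
   self-adjoint. *)
exists [seq z i p - P (z i p) | i <- enum 'I_N, p <- s] => x hx i.
apply/esym/P_unique => [|a]; first by apply: S_closure; exact: P_in.
rewrite -S_B -(dot_V dot_S S_V).
(* Correcting [b] at one boundary point at a time reduces to [b] vanishing on [V0], for which
   [V i (d b)] lies in the closed image of [d]. *)
suff claim (s' : seq K) b : {subset s' <= s} -> FD b ->
    (forall q, V0 q -> q \notin s' -> b q = 0) -> dot (x - P x) (V i (d b)) = 0.
  move=> da; apply: (claim s) => // q Vq /negP; case.
  by move: Vq; rewrite V0s.
elim: s' b => [|p s' IH] b ss db hb.
  have cV := @V_vanishing i b db (fun p Vp => hb p Vp isT).
  by rewrite dotBl P_adj P_id// subrr.
have ps : p \in s by apply: ss; exact: mem_head.
have Vp : V0 p by rewrite V0s.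
have [dep hep] := he p; have fe := form_domain_real Kpcf Dr dep.
have := IH (fun t => - b p * cst (e p) t + b t) _ _ _.
have zip0 : dot (x - P x) (z i p) = 0.
  rewrite dotBl P_adj -dotBr; apply: hx.
  by apply/allpairsP; exists (i, p); split => //=; rewrite mem_enum.
rewrite (dot_V dot_S S_V) (d_lin d_der _ fe db) dotDr dotZr -!(dot_V dot_S S_V) zip0 mulr0 add0r.
apply.
- by move=> q qs; apply: ss; rewrite inE qs orbT.
- exact: (form_domain_lin Kpcf Dr).
move=> q Vq qs; rewrite hep//; have [->|qp] := eqVneq q p.
  by rewrite mulr1 addNr.
by rewrite mulr0 add0r hb// inE negb_or qp.
Qed.

Lemma commutator_cells a : CK a -> exists Y : seq H, forall x,
  (forall y, y \in Y -> dot x y = 0) ->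
  nm (T a x) ^+ 2 = \sum_i nm (T (a \o F i) (S i x)) ^+ 2.
Proof.
move=> ca; have [Y hY] := phase_defect.
(* The second batch of constraints makes [act a x], and not only [x], orthogonal to [Y]. *)
exists (Y ++ [seq act (conj_fun a) y | y <- Y]) => x hx.
rewrite (nm_sq_S Hdot dot_S); apply: eq_bigr => i _; congr (nm _ ^+ 2).
have cai : CK (a \o F i).
  by apply: (CK_comp _ ca); case: Kss => _ _ /(_ i)[].
rewrite (phase_commutatorE _ ca) (phase_commutatorE _ cai) S_Z S_B; congr (_ *: (_ - _)).
  rewrite hY ?S_act// => y yY; rewrite (act_adj act_rep _ _ ca); apply: hx.
  by rewrite mem_cat (map_f _ yY) orbT.
by rewrite S_act// hY// => y yY; apply: hx; rewrite mem_cat yY.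
Qed.

(** A direct sum is no larger than its largest summand, so the level 4 e does not deteriorate with
    the depth; each depth only adds finitely many constraints. *)
Lemma commutator_small_cells (e : R) m a : 0 <= e -> CK a ->
  on_cells F (fun b => forall s t, cmod (b s - b t) <= e) m a -> small_at dot (4 * e) (T a).
Proof.
move=> e0; elim: m a => [|m IH] a ca /= ha.
  by exists [::] => x _; apply: (@nm_phase_commutator a (a point) e).
have [Y hY] := commutator_cells ca.
apply: (small_at_direct_sum (T_ := fun i => T (a \o F i)) Hdot dot_S S_V hY).
  by rewrite mulr_ge0.
move=> i; apply: (IH (a \o F i) _ (ha i)).
by apply: (CK_comp _ ca); case: Kss => _ _ /(_ i)[].
Qed.

Lemma commutator_small a : CK a -> small_op dot (T a).
Proof.
move=> ca e e0; have e4 : 0 < e / 4 by rewrite divr_gt0.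
have [|||m hm] := small_cells Kss (dist := fun s t => cmod (s - t)) (a := a) _ _ _ e4.
- by move=> s t; rewrite -cmodN opprB.
- by move=> s t w; rewrite -[s - w](subrKA t) cmodD.
- exact: CK_near.
have := commutator_small_cells (ltW e4) ca hm.
by rewrite mulrC divfK// pnatr_eq0.
Qed.

End Commutator.

Theorem theorem3p12 (R : realType)
  (K : pseudoPMetricType R) (N : nat)
  (F : 'I_N -> K -> K) (pi : shift_space N -> K)
  (K_self_similar : self_similar_structure F pi) (K_pcf : pcf F pi)
  (D : K -> K -> R) (r : 'I_N -> R)
  (Dr_harmonic : harmonic_structure F pi D r) (Dr_regular : regular_structure r)
  (mu_ : 'I_N -> R) (mu : probability (g_sigma_algebraType (@open K)) R)
  (mu_self_similar : self_similar_measure F mu_ mu)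
  (rmu_lt1 : forall i, r i * mu_ i < 1)
  (dS : R) (dS_spectral : spectral_exponent r mu_ dS)
  (H : completeNormedModType R[i]) (dot : {dot H for Num.conj})
  (H_hilbert : hilbert_inner_product dot)
  (act : (K -> R[i]) -> H -> H) (act_rep : star_representation dot act)
  (d : (K -> R[i]) -> H) (d_derivation : derivation F pi D r act d)
  (J : H -> H) (J_involution : antilinear_involution F pi D r act d J)
  (omega : (R -> R) -> R) (omega_dixmier : dixmier_functional omega)
  (a : K -> R[i]) (a_domain : form_domain F pi D r a) :
  energy_functional F pi D r dot act d omega dS a =
  (\sum_(i < N) energy_functional F pi D r dot act d omega dS (a \o F i))%E.
Proof.
have ca := form_domain_CK a_domain.
have cai i : CK (a \o F i).
  exact: form_domain_CK ((form_domain_cells K_self_similar Dr_harmonic a).1 a_domain i).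
have N0 : (0 < N)%N by case: K_self_similar => _ N2 _ _ _; exact: ltnW.
have [S [S_linear dot_S S_act S_d]] := cell_isometry K_self_similar K_pcf Dr_harmonic Dr_regular
  H_hilbert act_rep d_derivation J_involution.
(* Pointwise choice is enough, a vector being determined by its components under the norm-preserving
   [S]. *)
have /choice[V hV] : forall i, exists Vi : H -> H, forall y,
    S i (Vi y) = y /\ forall j, j != i -> S j (Vi y) = 0.
  move=> i; have /choice[Vi hVi] : forall y, exists x, S i x = y /\ forall j, j != i -> S j x = 0.
    exact: (cell_component_exists K_self_similar K_pcf Dr_harmonic Dr_regular H_hilbert act_rep
      d_derivation J_involution S_linear dot_S S_act S_d).
  by exists Vi.
have S_V i j y : S j (V i y) = if j == i then y else 0.
  by have [e h] := hV i y; have [->|/h] := eqVneq j i.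
have [Y hY] := commutator_cells K_self_similar K_pcf Dr_harmonic Dr_regular H_hilbert act_rep
  d_derivation S_linear dot_S S_act S_d S_V ca.
(* A bound for [a] bounds every [a \o F i], so one operator bound 4 M serves [K] and all the
   cells. *)
have [M M0 hM] := CK_bounded K_self_similar ca.
have sm b : CK b -> small_op dot (phase_commutator F pi D r dot act d b).
  move=> cb; exact: (commutator_small K_self_similar K_pcf Dr_harmonic Dr_regular H_hilbert act_rep
    d_derivation S_linear dot_S S_act S_d S_V cb).
have bd b : CK b -> (forall t, cmod (b t) <= M) ->
    forall x, nm (phase_commutator F pi D r dot act d b x) <= 4 * M * nm x.
  move=> cb hb x; have hb0 t : cmod (b t - 0) <= M by rewrite subr0.
  exact: (nm_phase_commutator K_pcf Dr_harmonic H_hilbert act_rep d_derivation x cb M0 hb0).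
have ad b : CK b -> adjoint_pair dot (phase_commutator F pi D r dot act d b)
    (fun x => - phase_commutator F pi D r dot act d (conj_fun b) x).
  move=> cb; exact: (phase_commutator_adj K_pcf Dr_harmonic H_hilbert act_rep d_derivation cb).
have M4 : 0 <= 4 * M by rewrite mulr_ge0.
apply: (dixmier_trace_direct_sum H_hilbert N0 S_linear dot_S S_V hY (ad _ ca) (fun i => ad _ (cai i))
  M4 (fun i => M4) (bd _ ca hM) (fun i => bd _ (cai i) (fun t => hM (F i t))) (sm _ ca)
  (fun i => sm _ (cai i)) dS_spectral.1 omega_dixmier).
Qed.
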